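(* Let $\mu\in(0,1)$, let $V_\mu\subset E_\mu$ be open, and suppose the following two hypotheses hold. (1) $(A,F_1): V_\mu\to \mathcal{M}_\mu(E_1,E_0)\times E_0$ is locally Lipschitz continuous (with $\mathcal{M}_\mu(E_1,E_0)$ carrying the norm of $\mathcal{L}(E_1,E_0)$). (2) There is a number $\beta\in(\mu,1)$ such that $F_2:V_\mu\cap E_\beta\to E_0$, and there are $m\in\mathbb{N}$ and numbers $\beta_j\in[\mu,\beta]$, $\rho_j\ge 0$ with $$\frac{\rho_j(\beta-\mu)+(\beta_j-\mu)}{1-\mu}\le 1\qquad\text{for all } j=1,\dots,m,$$ such that for each $x_0\in V_\mu$ and $R>0$ there is a constant $C_R=C_R(x_0)>0$ for which $$|F_2(x_1)-F_2(x_2)|_{E_0}\le C_R\sum_{j=1}^m\big(1+|x_1|_{E_\beta}^{\rho_j}+|x_2|_{E_\beta}^{\rho_j}\big)|x_1-x_2|_{E_{\beta_j}}$$ holds for all $x_1,x_2\in\bar B_{E_\mu}(x_0,R)\cap(V_\mu\cap E_\beta)$. For $x\in V_\mu$ let $u(\cdot,x)$, defined on $[0,t^+(x))$, be the maximal solution of $$\dot u+A(u)u=F_1(u)+F_2(u)\ \text{ for } t>0,\qquad u(0)=x. \tag{P}$$ Given $x_0\in V_\mu$, let $\tau,\varepsilon,\sigma>0$ be constants (depending on $x_0$) such that for all $x\in\bar B_{E_\mu}(x_0,\varepsilon)$ problem (P) has a unique solution $u(\cdot,x)\in\mathbb{E}_{1,\mu}([0,\tau])$ and $\|u(\cdot,x_1)-u(\cdot,x_2)\|_{\mathbb{E}_{1,\mu}([0,\tau])}\le\sigma|x_1-x_2|_{E_\mu}$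 for all $x_1,x_2\in\bar B_{E_\mu}(x_0,\varepsilon)$ (such constants exist). Then there exists a positive constant $c=c(x_0)$ so that $$\|u(\cdot,x_1)-u(\cdot,x_2)\|_{C([0,\tau],E_\mu)}\le c|x_1-x_2|_{E_\mu}\qquad\text{for } x_1,x_2\in\bar B_{E_\mu}(x_0,\varepsilon).$$ Consequently, the map $[(t,x)\mapsto u(t,x)]$ defines a locally Lipschitz continuous semiflow on $V_\mu$.
   Context: $E_0,E_1$ are Banach spaces with $E_1$ continuously and densely embedded in $E_0$. For $\theta\in(0,1)$, $E_\theta:=(E_0,E_1)^0_{\theta,\infty}$ is the continuous interpolation space (the closure of $E_1$ in the real interpolation space $(E_0,E_1)_{\theta,\infty}$). $\bar B_E(x,R)$ is the closed ball in $E$. For a Banach space $E$, $\mu\in(0,1)$, $J=[0,T]$, $\dot J=(0,T]$: $$BC_{1-\mu}(J,E):=\{v\in C(\dot J,E): [t\mapsto t^{1-\mu}v(t)]\in BC(\dot J,E),\ \lim_{t\to0^+}|t^{1-\mu}v(t)|_E=0\},$$ $$BC^1_{1-\mu}(J,E):=\{v\in C^1(\dot J,E): v,\dot v\in BC_{1-\mu}(J,E)\}.$$ Set $\mathbb{E}_{0,\mu}(J):=BC_{1-\mu}(J,E_0)$ with norm $\sup_{t\in\dot J}t^{1-\mu}|v(t)|_{E_0}$, and $\mathbb{E}_{1,\mu}(J):=BC^1_{1-\mu}(J,E_0)\cap BC_{1-\mu}(J,E_1)$ with norm $\sup_{t\in\dot J}t^{1-\mu}(|\dot v(t)|_{E_0}+|v(t)|_{E_1})$.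 Functions in $\mathbb{E}_{1,\mu}(J)$ extend continuously to $t=0$ with values in $E_0$. $\mathcal{M}_\mu(E_1,E_0)$ is the set of all $B\in\mathcal{L}(E_1,E_0)$ such that, for some (hence all) $T>0$ and $J=[0,T]$: for every $(f,x)\in\mathbb{E}_{0,\mu}(J)\times E_\mu$ there is a unique $u\in\mathbb{E}_{1,\mu}(J)$ with $\dot u(t)+Bu(t)=f(t)$ for $t\in\dot J$ and $u(0)=x$. A solution of (P) on $[0,T]$ is a function $u\in\mathbb{E}_{1,\mu}([0,T])$ with values in $V_\mu$ satisfying the equation on $(0,T]$ and $u(0)=x$; the maximal solution $u(\cdot,x)$ is defined on the maximal interval $[0,t^+(x))$ to which the solution extends. Local Lipschitz continuity of the semiflow on $V_\mu$ means: $\mathcal{D}:=\bigcup_{x\in V_\mu}[0,t^+(x))\times\{x\}$ is open in $\mathbb{R}_+\times V_\mu$ (with $\mathbb{R}_+=[0,\infty)$), the map $[(t,x)\mapsto u(t,x)]$ is continuous on $\mathcal{D}$, and for all $(t_0,x_0)\in\mathcal{D}$ there is a product neighborhood $U\times V\subset\mathcal{D}$ of $(t_0,x_0)$ and $c>0$ so that $|u(t,x)-u(t,y)|_{E_\mu}\le c|x-y|_{E_\mu}$ for $(t,x),(t,y)\in U\times V$. *)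

(* Defs.v *)
From HB Require Import structures.
From mathcomp Require Import all_boot all_order all_algebra.
From mathcomp Require Import all_classical all_reals all_analysis.
Import Order.TTheory GRing.Theory Num.Theory.
Import numFieldNormedType.Exports.
Set Implicit Arguments.
Unset Strict Implicit.
Unset Printing Implicit Defensive.
Local Open Scope classical_set_scope.
Local Open Scope ring_scope.

(* Spaces between [E1] and [E0] are subsets of [E0] carrying their own norm.
   [E1] embeds into [E0] through a linear map [j]; a function with values in
   [E1] is a function with values in [range j] composed with [linv j]. *)

Definition linv (R : realType) (E0 E1 : completeNormedModType R)
    (j : {linear E1 -> E0}) : E0 -> E1 := pinv [set: E1] j.

Definition banach_couple (R : realType) (E0 E1 : completeNormedModType R)
    (j : {linear E1 -> E0}) : Prop :=
  [/\ injective j, continuous j & dense (range j)].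

Definition opnorm (R : realType) (E F : normedModType R) (B : E -> F) : R :=
  sup [set `|B v| | v in [set v : E | `|v| <= 1]].

Section Interpolation.
Context (R : realType) (E0 E1 : completeNormedModType R)
  (j : {linear E1 -> E0}).

(* Peetre's K-functional *)
Definition Kfun (t : R) (x : E0) : R :=
  inf [set `|x - j b| + t * `|b| | b in [set: E1]].

(* the norm of (E0, E1)_(theta, oo); it is +oo outside that space *)
Definition interp_enorm (theta : R) (x : E0) : \bar R :=
  ereal_sup [set (t `^ (- theta) * Kfun t x)%:E | t in [set t : R | 0 < t]].

Definition interp_norm (theta : R) (x : E0) : R := fine (interp_enorm theta x).

(* E_theta = (E0, E1)^0_(theta, oo), the closure of E1 in (E0, E1)_(theta, oo) *)
Definition cinterp (theta : R) : set E0 :=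
  [set x | (interp_enorm theta x < +oo)%E /\
     forall e : R, 0 < e ->
       exists y : E1, (interp_enorm theta (x - j y)%R < e%:E)%E].

Definition interp_open (theta : R) (V : set E0) : Prop :=
  V `<=` cinterp theta /\
  forall x, V x -> exists2 r : R, 0 < r &
    forall y, cinterp theta y -> interp_norm theta (y - x) < r -> V y.

Definition interp_cball (theta : R) (x0 : E0) (r : R) : set E0 :=
  [set x | cinterp theta x /\ interp_norm theta (x - x0) <= r].

(* C([0, T], E_theta) and its norm *)
Definition interp_C0 (theta T : R) (w : R -> E0) : Prop :=
  (forall t, 0 <= t <= T -> cinterp theta (w t)) /\
  forall t, 0 <= t <= T ->
    interp_norm theta (w s - w t) @[s --> within `[0, T] (nbhs t)] --> (0 : R).

Definition interp_C0_norm (theta T : R) (w : R -> E0) : \bar R :=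
  ereal_sup [set (interp_norm theta (w t))%:E | t in `[0, T]%classic].

End Interpolation.

Section WeightedSpaces.
Context (R : realType) (E : completeNormedModType R).

Definition BC (D : set R) (v : R -> E) : Prop :=
  {within D, continuous v} /\ [bounded v t | t in D].

Definition BCw (mu T : R) (v : R -> E) : Prop :=
  [/\ {within `]0, T], continuous v},
      BC `]0, T]%classic (fun t => t `^ (1 - mu) *: v t) &
      `|t `^ (1 - mu) *: v t| @[t --> 0^'+] --> (0 : R)].

(* The derivative is relative to (0, T], hence one-sided at T. *)
Definition diffq (v : R -> E) (t h : R) : E := h^-1 *: (v (t + h) - v t).

Definition diffq_filter (T t : R) : set_system R :=
  within [set h | 0 < t + h <= T] 0^'.

Definition ddt (T : R) (v : R -> E) (t : R) : E :=
  lim (diffq v t @ diffq_filter T t).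

Definition C1 (T : R) (v : R -> E) : Prop :=
  [/\ {within `]0, T], continuous v},
      forall t, 0 < t <= T -> cvg (diffq v t @ diffq_filter T t) &
      {within `]0, T], continuous (ddt T v)}].

Definition BC1w (mu T : R) (v : R -> E) : Prop :=
  [/\ C1 T v, BCw mu T v & BCw mu T (ddt T v)].

End WeightedSpaces.

Section QuasilinearProblem.
Context (R : realType) (E0 E1 : completeNormedModType R)
  (j : {linear E1 -> E0}) (mu : R).

(* The last clause says that [v 0] is the value at 0 of the continuous
   extension to [0, T]; values of [v] outside [0, T] are irrelevant. *)
Definition E1mu (T : R) (v : R -> E0) : Prop :=
  [/\ BC1w mu T v,
      forall t, 0 < t <= T -> range j (v t),
      BCw mu T (linv j \o v) &
      v t @[t --> 0^'+] --> v 0].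

Definition E1mu_norm (T : R) (v : R -> E0) : \bar R :=
  ereal_sup [set (t `^ (1 - mu) * (`|ddt T v t| + `|linv j (v t)|))%:E
            | t in `]0, T]%classic].

Definition linear_solution (B : E1 -> E0) (T : R) (f : R -> E0) (x : E0)
    (v : R -> E0) : Prop :=
  [/\ E1mu T v,
      forall t, 0 < t <= T -> ddt T v t + B (linv j (v t)) = f t &
      v 0 = x].

(* the class M_mu(E1, E0) *)
Definition Mmu (B : {linear E1 -> E0}) : Prop :=
  continuous B /\
  exists2 T : R, 0 < T &
    forall f x, BCw mu T f -> cinterp j mu x ->
      exists2 v, linear_solution B T f x v &
        forall w, linear_solution B T f x w ->
          forall t, 0 <= t <= T -> w t = v t.

Context (V : set E0) (A : E0 -> {linear E1 -> E0}) (F1 F2 : E0 -> E0).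

Definition hypothesis1 : Prop :=
  (forall x, V x -> Mmu (A x)) /\
  forall x0, V x0 -> exists r L : R, 0 < r /\
    forall x y, V x -> V y ->
      interp_norm j mu (x - x0) < r -> interp_norm j mu (y - x0) < r ->
      opnorm (fun v => A x v - A y v) + `|F1 x - F1 y|
        <= L * interp_norm j mu (x - y).

Definition hypothesis2 : Prop :=
  exists beta : R, mu < beta < 1 /\
  exists (m : nat) (bet rho : 'I_m -> R),
    (forall k, [/\ mu <= bet k <= beta, 0 <= rho k &
       (rho k * (beta - mu) + (bet k - mu)) / (1 - mu) <= 1]) /\
    forall (x0 : E0) (r : R), V x0 -> 0 < r -> exists2 C : R, 0 < C &
      forall x1 x2 : E0,
        (interp_cball j mu x0 r `&` (V `&` cinterp j beta)) x1 ->
        (interp_cball j mu x0 r `&` (V `&` cinterp j beta)) x2 ->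
        `|F2 x1 - F2 x2| <= C * \sum_(k < m)
          (1 + interp_norm j beta x1 `^ rho k + interp_norm j beta x2 `^ rho k)
          * interp_norm j (bet k) (x1 - x2).

Definition solution (T : R) (x : E0) (v : R -> E0) : Prop :=
  [/\ 0 < T, E1mu T v,
      forall t, 0 <= t <= T -> V (v t),
      forall t, 0 < t <= T ->
        ddt T v t + A (v t) (linv j (v t)) = F1 (v t) + F2 (v t) &
      v 0 = x].

Definition maximal_solution (x : E0) (tp : \bar R) (v : R -> E0) : Prop :=
  [/\ (0 < tp)%E,
      forall T : R, 0 < T -> (T%:E < tp)%E -> solution T x v &
      forall (T : R) w, solution T x w ->
        (T%:E < tp)%E /\ forall t, 0 <= t <= T -> w t = v t].

(* [u x] is the solution starting at [x]. *)
Definition local_constants (u : E0 -> R -> E0) (x0 : E0) (tau eps sigma : R)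
    : Prop :=
  [/\ 0 < tau, 0 < eps & 0 < sigma] /\
  (forall x, interp_cball j mu x0 eps x ->
     solution tau x (u x) /\
     forall w, solution tau x w -> forall t, 0 <= t <= tau -> w t = u x t) /\
  forall x1 x2, interp_cball j mu x0 eps x1 -> interp_cball j mu x0 eps x2 ->
    (E1mu_norm tau (fun t => (u x1 t - u x2 t)%R)
       <= (sigma * interp_norm j mu (x1 - x2))%:E)%E.

Definition flow_domain (tp : E0 -> \bar R) (t : R) (x : E0) : Prop :=
  [/\ V x, 0 <= t & (t%:E < tp x)%E].

Definition semiflow (tp : E0 -> \bar R) (u : E0 -> R -> E0) : Prop :=
  [/\ forall x, V x -> flow_domain tp 0 x /\ u x 0 = x,
      forall t x, flow_domain tp t x -> V (u x t) &
      forall s t x, flow_domain tp s x -> flow_domain tp t (u x s) ->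
        flow_domain tp (s + t) x /\ u x (s + t) = u (u x s) t].

Definition time_nbhs (t0 : R) (U : set R) : Prop :=
  U `<=` [set t | 0 <= t] /\
  exists2 d : R, 0 < d & forall t, 0 <= t -> `|t - t0| < d -> U t.

Definition state_nbhs (x0 : E0) (W : set E0) : Prop :=
  W `<=` V /\
  exists2 d : R, 0 < d &
    forall x, V x -> interp_norm j mu (x - x0) < d -> W x.

Definition locally_lipschitz_semiflow (tp : E0 -> \bar R)
    (u : E0 -> R -> E0) : Prop :=
  [/\ semiflow tp u,
      forall t0 x0, flow_domain tp t0 x0 ->
        exists U W, [/\ time_nbhs t0 U, state_nbhs x0 W &
          forall t x, U t -> W x -> flow_domain tp t x],
      forall t0 x0 (e : R), flow_domain tp t0 x0 -> 0 < e ->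
        exists U W, [/\ time_nbhs t0 U, state_nbhs x0 W &
          forall t x, U t -> W x -> flow_domain tp t x ->
            interp_norm j mu (u x t - u x0 t0) < e] &
      forall t0 x0, flow_domain tp t0 x0 ->
        exists U W (c : R), [/\ time_nbhs t0 U, state_nbhs x0 W, 0 < c,
          forall t x, U t -> W x -> flow_domain tp t x &
          forall t x y, U t -> W x -> W y ->
            interp_norm j mu (u x t - u y t) <= c * interp_norm j mu (x - y)]].

End QuasilinearProblem.

(* Main.v *)
Require Import Defs.
From mathcomp Require Import all_boot all_order all_algebra.
From mathcomp Require Import all_classical all_reals all_analysis.
From mathcomp Require Import ring lra.
Import Order.TTheory GRing.Theory Num.Theory.
Import numFieldNormedType.Exports.
Local Open Scope classical_set_scope.
Local Open Scope ring_scope.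

(** Why the theorem is true.

    Everything rests on one linear estimate. If [B] has maximal regularity on
    some interval [0, T], then there is a constant [M] such that, on every shorter
    interval, the solution of [v' + B v = f], [v 0 = x] is bounded by [M] times
    the data (Mmu_estimate). The bound on [0, T] is the open mapping theorem,
    obtained from a category argument for countably subadditive seminorms
    (countably_subadditive_bounded), since the space of maximal regularity is
    complete (reg_complete). The constant survives on a shorter interval because
    data extend without increasing their weighted norm (wcont_extend), and so does
    uniqueness: the primitive of a null solution is a classical null solution that
    vanishes at 0 and can therefore be shifted to the right end of [0, T]
    (linsol_unique_short). This needs primitives of functions with values in a
    Banach space (primitive_exists, wcont_primitive).

    The trace estimate (reg_trace) says that [v t - v 0] is bounded in [E_mu] by
    the norm of [v] in the space of maximal regularity, with a constant that does
    not depend on the interval. It gives the continuity of solutions with values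
    in [E_mu], and it turns the Lipschitz estimate in the space of maximal
    regularity into the one in [C([0, tau], E_mu)]. Together with the
    interpolation inequality between [E_mu] and [E1] (interp_ineq) it also
    controls all the norms in the growth condition on [F2].

    Write the equation as [v' + A x0 v = N v], where [N] collects the change of
    [A] and the nonlinear terms. Near [x0] in [E_mu], and where the weighted [E1]
    norm is small, [N] has a small Lipschitz constant (nonlin_lipschitz). This
    covers the critical case of the growth condition: there the smallness comes
    from the weighted [E1] norm, which tends to 0 at [t = 0], and not from a power
    of [t]. With the linear estimate this gives local existence with a uniform
    existence time near [x0], Lipschitz dependence on the initial value
    (local_existence, sol_lipschitz), and uniqueness (sol_unique).

    Restarting a solution at a positive time would put a singularity there, since
    the space of maximal regularity allows one at its initial time. Solutions are
    therefore always continued with an overlap (sol_splice), which is possible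
    because the existence time is locally uniform. This yields maximal solutions
    and the semiflow property. The set of times up to which the flow is Lipschitz
    continuous near [x0] is propagated along the trajectory of [x0], one local
    existence interval at a time (lipschitz_step, lipschitz_flow). *)

(** * Identities in a module *)

Inductive modexp (R : Type) : Type :=
  | ModVar of nat | ModZero | ModAdd of modexp R & modexp R
  | ModOpp of modexp R | ModScale of R & modexp R.
Arguments ModVar {R}.
Arguments ModZero {R}.
Arguments ModAdd {R}.
Arguments ModOpp {R}.
Arguments ModScale {R}.

Fixpoint mod_eval {R : pzRingType} {V : lmodType R} (s : seq V) (e : modexp R) : V :=
  match e with
  | ModVar i => nth 0 s i
  | ModZero => 0
  | ModAdd a b => mod_eval s a + mod_eval s b
  | ModOpp a => - mod_eval s a
  | ModScale c a => c *: mod_eval s a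
  end.

Fixpoint mod_coef {R : pzRingType} (e : modexp R) (i : nat) : R :=
  match e with
  | ModVar k => if eqn k i then 1 else 0
  | ModZero => 0
  | ModAdd a b => mod_coef a i + mod_coef b i
  | ModOpp a => - mod_coef a i
  | ModScale c a => c * mod_coef a i
  end.

Fixpoint mod_eqn {R : pzRingType} (a b : modexp R) (n : nat) : Prop :=
  match n with
  | O => True
  | S n => mod_coef a n = mod_coef b n /\ mod_eqn a b n
  end.

Lemma mod_evalE {R : pzRingType} {V : lmodType R} (s : seq V) (e : modexp R) :
  mod_eval s e = \sum_(i < size s) mod_coef e i *: nth 0 s i.
Proof.
elim: e => [k||a IHa b IHb|a IHa|c a IHa] /=; rewrite ?IHa ?IHb.
- have [ks|sk] := ltnP k (size s).
    rewrite (bigD1 (Ordinal ks)) //= big1 ?addr0; last first.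
      move=> i; rewrite -val_eqE /= => ik.
      by case: eqnP => [ki|_]; [rewrite ki eqxx in ik|rewrite scale0r].
    by case: eqnP => // _; rewrite scale1r.
  rewrite nth_default // big1 // => i _.
  case: eqnP => [ki|_]; last by rewrite scale0r.
  by have := ltn_ord i; rewrite -ki ltnNge sk.
- by rewrite big1 // => i _; rewrite scale0r.
- by rewrite -big_split; apply: eq_bigr => i _; rewrite scalerDl.
- by rewrite -sumrN; apply: eq_bigr => i _; rewrite scaleNr.
- by rewrite scaler_sumr; apply: eq_bigr => i _; rewrite scalerA.
Qed.

(** Two expressions in a module agree as soon as their coefficients at each
    atom do; the latter is left to the tactic for commutative rings. *)
Lemma mod_eqnP {R : pzRingType} {V : lmodType R} (s : seq V) (a b : modexp R) :
  mod_eqn a b (size s) -> mod_eval s a = mod_eval s b.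
Proof.
rewrite !mod_evalE => H; apply: eq_bigr => -[i /= ilt] _; congr (_ *: _).
by elim: (size s) i ilt H => //= n IH i; rewrite ltnS leq_eqVlt => /predU1P[->|/IH h] [].
Qed.

Ltac mod_mem x s :=
  lazymatch s with
  | nil => constr:(false)
  | cons x _ => constr:(true)
  | cons _ ?s' => mod_mem x s'
  end.
Ltac mod_index x s :=
  lazymatch s with
  | cons x _ => constr:(O)
  | cons _ ?s' => let n := mod_index x s' in constr:(S n)
  end.
Ltac mod_atoms s t :=
  lazymatch t with
  | (?a + ?b)%R => let s' := mod_atoms s a in mod_atoms s' b
  | (- ?a)%R => mod_atoms s a
  | (?c *: ?a)%R => mod_atoms s a
  | 0%R => s
  | _ => let m := mod_mem t s in
         lazymatch m with true => s | false => constr:(cons t s) end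
  end.
Ltac mod_reify R s t :=
  lazymatch t with
  | (?a + ?b)%R => let x := mod_reify R s a in let y := mod_reify R s b in
                   constr:(@ModAdd R x y)
  | (- ?a)%R => let x := mod_reify R s a in constr:(@ModOpp R x)
  | (?c *: ?a)%R => let x := mod_reify R s a in constr:(@ModScale R c x)
  | 0%R => constr:(@ModZero R)
  | _ => let i := mod_index t s in constr:(@ModVar R i)
  end.
Ltac modring R :=
  lazymatch goal with
  | |- @eq ?V ?x ?y =>
    let s0 := mod_atoms (@nil V) x in
    let s := mod_atoms s0 y in
    let ex := mod_reify R s x in
    let ey := mod_reify R s y in
    refine (@mod_eqnP R _ s ex ey _);
    cbn [mod_eqn mod_coef eqn size];
    repeat split; ring
  end.


(** * Real induction and geometric convergence *)

(** A property that can be transported across every point of the interval, from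
    some earlier time to some later one, reaches the end of the interval. Nothing
    is asked of the points that are jumped over. *)
Lemma real_induction {R : realType} (P : R -> Prop) (a b : R) : a <= b -> P a ->
  (forall c, a <= c <= b -> exists2 d, 0 < d &
     forall s t, a <= s <= c -> c - d < s -> c <= t <= b -> t < c + d ->
       P s -> P t) ->
  P b.
Proof.
move=> ab Pa step.
pose S := [set x | a <= x <= b /\ P x].
have Sa : S a by split=> //; rewrite lexx ab.
have supS : has_sup S by split; [exists a|exists b => x [/andP[]]].
have Sub x : S x -> x <= sup S by move=> Sx; apply: ub_le_sup => //; case: supS.
have ac : a <= sup S by exact: Sub.
have cb : sup S <= b by apply: ge_sup; [exists a|move=> x [/andP[]]].
have [|d d0 Hd] := step (sup S); first by rewrite ac cb.
have [s Ss cs] : exists2 s, S s & sup S - d < s by apply: sup_adherent.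
have [/andP[as_ sb] Ps] := Ss.
have sc := Sub _ Ss.
have [bc|cb'] := leP b (sup S + d / 2).
  by apply: (Hd s b) => //; lra.
suff /Sub : S (sup S + d / 2) by lra.
split; first lra.
by apply: (Hd s) => //; lra.
Qed.

(** The variant for properties that pass to limits from the left but are only
    continued from the point that has been reached. *)
Lemma real_induction_closed {R : realType} (P : R -> Prop) (a b : R) :
  a <= b -> P a ->
  (forall s t, a <= s <= t -> t <= b -> P t -> P s) ->
  (forall c, a < c <= b -> (forall s, a <= s < c -> P s) -> P c) ->
  (forall c, a <= c < b -> P c -> exists2 d, 0 < d &
     forall t, c < t <= b -> t < c + d -> P t) ->
  P b.
Proof.
move=> ab Pa down clos step.
pose S := [set x | a <= x <= b /\ P x].
have Sa : S a by split=> //; rewrite lexx ab.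
have supS : has_sup S by split; [exists a|exists b => x [/andP[]]].
have Sub x : S x -> x <= sup S by move=> Sx; apply: ub_le_sup => //; case: supS.
have ac : a <= sup S by exact: Sub.
have cb : sup S <= b by apply: ge_sup; [exists a|move=> x [/andP[]]].
have Pc : P (sup S).
  have [<-//|ca] := eqVneq a (sup S).
  apply: clos; first by rewrite lt_neqAle ca ac cb.
  move=> s /andP[as_ sc].
  have [r [/andP[ar rb] Pr] sr] : exists2 r, S r & sup S - (sup S - s) < r.
    by apply: sup_adherent => //; lra.
  by apply: (down s r) => //; lra.
have [cb'|] := ltP (sup S) b; last first.
  by move=> bc; have -> : b = sup S by lra.
have [|d d0 Hd] := step (sup S) _ Pc; first by rewrite ac cb'.
pose t := Num.min (sup S + d / 2) b.
suff /Sub : S t by rewrite /t /Num.min; case: ifP; lra.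
have tc : sup S < t <= b /\ t < sup S + d.
  by rewrite /t /Num.min; case: ifP; lra.
by case: tc => tc td; split; [lra|exact: Hd].
Qed.


Lemma geometric_small {R : realType} (C e : R) : 0 < e ->
  exists n, C / 2 ^+ n <= e.
Proof.
move=> e0.
have q0 : 0 <= `|C| / e by rewrite divr_ge0 ?normr_ge0 ?ltW.
have Hn := Num.Theory.archi_boundP q0.
set n := Num.bound _ in Hn.
exists n; rewrite ler_pdivrMr ?exprn_gt0 //.
have nn : (n%:R : R) <= 2 ^+ n by rewrite -natrX ler_nat ltnW // ltn_expl.
rewrite mulrC -ler_pdivrMr //.
have C1 : C / e <= `|C| / e by rewrite ler_pM2r ?invr_gt0 // ler_norm.
lra.
Qed.

Lemma le_geometric {R : realType} (x y C : R) :
  (forall n, x <= y + C / 2 ^+ n) -> x <= y.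
Proof.
move=> H; apply/ler_addgt0Pr => e e0.
by have [n Hn] := geometric_small C e e0; have := H n; lra.
Qed.

Lemma geometric_dist {R : realType} {E : normedModType R} (s : nat -> E) (c : R) :
  (forall n, `|s n.+1 - s n| <= c / 2 ^+ n) ->
  forall n m, (n <= m)%N -> `|s m - s n| <= 2 * c / 2 ^+ n.
Proof.
move=> H n m /subnKC <-.
have c0 : 0 <= c by have := H 0%N; have := normr_ge0 (s 1%N - s 0%N); rewrite expr0; lra.
suff : `|s (n + (m - n))%N - s n| <= 2 * c / 2 ^+ n - 2 * c / 2 ^+ (n + (m - n)).
  move=> h; apply: (le_trans h); rewrite gerBl divr_ge0 ?exprn_ge0 //; lra.
elim: (m - n)%N => [|k IH]; first by rewrite addn0 !subrr normr0.
have -> : s (n + k.+1)%N - s n = (s (n + k).+1 - s (n + k)%N) + (s (n + k)%N - s n).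
  by rewrite addnS; modring R.
apply: (le_trans (ler_normD _ _)).
have := H (n + k)%N; move: IH; rewrite addnS exprS invfM.
set q := (2 ^+ (n + k))^-1; set r := (2 ^+ n)^-1 => h1 h2; lra.
Qed.

Lemma geometric_cvg {R : realType} {E : completeNormedModType R} (s : nat -> E)
    (c : R) :
  (forall n, `|s n.+1 - s n| <= c / 2 ^+ n) ->
  exists l, forall n, `|l - s n| <= 2 * c / 2 ^+ n.
Proof.
move=> H; have D := geometric_dist s c H.
have cs : cvg (s @ \oo).
  apply/cauchy_cvgP/cauchy_exP => e e0.
  have [|n Hn] := geometric_small (2 * c) (e / 2); first lra.
  exists (s n); exists n => // m /= nm.
  rewrite -ball_normE /= distrC.
  by have := D n m nm; lra.
exists (lim (s @ \oo)) => n.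
apply/ler_addgt0Pr => e e0.
have [N _ HN] := (iffLR (cvgrPdist_le _ _)) cs e e0.
have h1 := HN (maxn N n) (leq_maxl _ _); rewrite /= in h1.
have h2 := D n (maxn N n) (leq_maxr _ _).
have -> : lim (s @ \oo) - s n =
  (lim (s @ \oo) - s (maxn N n)) + (s (maxn N n) - s n) by rewrite addrA subrK.
apply: (le_trans (ler_normD _ _)); lra.
Qed.

(** * Mean value inequality and primitives in a Banach space *)

(** The mean value inequality, with [p] as a change of variable: a Lipschitz
    bound with respect to [p] near every point adds up along the interval. *)
Lemma lipschitz_chain {R : realType} {E : normedModType R} (v : R -> E)
    (p : R -> R) (L a b : R) : a <= b ->
  (forall s t, a <= s -> s <= t -> t <= b -> p s <= p t) ->
  (forall c, a <= c <= b -> exists2 d, 0 < d & forall s, a <= s <= b ->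
     `|s - c| < d -> `|v s - v c| <= L * `|p s - p c|) ->
  `|v b - v a| <= L * (p b - p a).
Proof.
move=> ab pm loc.
apply: (@real_induction _ (fun t => `|v t - v a| <= L * (p t - p a)) a b) => //.
  by rewrite !subrr normr0 mulr0.
move=> c cab; have [d d0 Hd] := loc c cab.
exists d => // s t /andP[as_ sc] cs /andP[ct tb] tc Hs.
have h1 : `|v s - v c| <= L * `|p s - p c| by apply: Hd; [lra|rewrite ltr_norml; lra].
have h2 : `|v t - v c| <= L * `|p t - p c| by apply: Hd; [lra|rewrite ltr_norml; lra].
have -> : v t - v a = (v t - v c) - (v s - v c) + (v s - v a).
  by modring R.
apply: (le_trans (ler_normD _ _)); have := ler_normB (v t - v c) (v s - v c).
have q1 : p s <= p c by apply: pm; lra.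
have q2 : p c <= p t by apply: pm; lra.
rewrite ler0_norm in h1; last lra.
rewrite ger0_norm in h2; last lra.
lra.
Qed.

(** Primitives are taken with respect to a monotone [p]; with [p t = t `^ mu] an
    integrand that is singular at 0 becomes continuous there. *)
Definition eprim {R : realType} {E : normedModType R} (p : R -> R) (g : R -> E)
    (e b : R) (W : R -> E) := forall c, 0 <= c <= b -> exists2 d, 0 < d &
  forall s, 0 <= s <= b -> `|s - c| < d ->
    `|W s - W c - (p s - p c) *: g c| <= e * `|p s - p c|.

(** As long as [g] oscillates by less than [e], a function that is affine in [p]
    is an approximate primitive; real induction glues these pieces. *)
Lemma eprim_exists {R : realType} {E : normedModType R} (p : R -> R) (g : R -> E)
    (e b : R) : 0 <= b -> 0 < e ->
  (forall c, 0 <= c <= b -> forall e, 0 < e -> exists2 d, 0 < d &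
     forall s, 0 <= s <= b -> `|s - c| < d -> `|g s - g c| <= e) ->
  exists2 W, W 0 = 0 & eprim p g e b W.
Proof.
move=> b0 e0 gc.
apply: (@real_induction _ (fun t => exists2 W, W 0 = 0 & eprim p g e t W) 0 b) => //.
  exists (fun=> 0) => // c c0; exists 1 => // s s0 _.
  have -> : s = c by lra.
  by rewrite !subrr scale0r subr0 !normr0 mulr0.
move=> c cb.
have e2 : 0 < e / 2 by lra.
have [d d0 Hd] := gc c cb _ e2.
exists d => // s t /andP[s0 sc] cs /andP[ct tb] tc [W W0 HW].
pose W' r := if r <= s then W r else W s + (p r - p s) *: g c.
have close r : s <= r <= t -> `|g c - g r| <= e / 2.
  by move=> rs; rewrite distrC; apply: Hd; [lra|rewrite ltr_norml; lra].
have aux q r : s <= r <= t -> `|q *: g c - q *: g r| <= e * `|q|.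
  move=> /close rs; rewrite -scalerBr normrZ mulrC ler_wpM2r //; lra.
exists W'; first by rewrite /W' s0.
move=> r rt.
have [rs|sr|rs] := ltgtP r s.
- have [d' d'0 Hd'] : exists2 d, 0 < d &
      forall s', 0 <= s' <= s -> `|s' - r| < d ->
      `|W s' - W r - (p s' - p r) *: g r| <= e * `|p s' - p r|.
    by apply: HW; lra.
  exists (Num.min d' (s - r)); first by rewrite lt_min d'0; lra.
  move=> r' r't; rewrite lt_min ltr_norml => /andP[h1 h2].
  rewrite ltr_norml in h2.
  rewrite /W' (ltW rs); have -> : r' <= s by lra.
  by apply: Hd' => //; [lra|rewrite ltr_norml].
- exists (r - s); first lra.
  move=> r' r't; rewrite ltr_norml => h.
  rewrite /W' !ifF; [|by apply/negbTE; rewrite -ltNge; lra..].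
  have -> : W s + (p r' - p s) *: g c - (W s + (p r - p s) *: g c) =
            (p r' - p r) *: g c.
    by modring R.
  by apply: aux; lra.
- rewrite {r}rs in rt *.
  have [d' d'0 Hd'] : exists2 d, 0 < d &
      forall s', 0 <= s' <= s -> `|s' - s| < d ->
      `|W s' - W s - (p s' - p s) *: g s| <= e * `|p s' - p s|.
    by apply: HW; lra.
  exists d' => // r' r't h.
  rewrite /W' lexx; have [r's|sr'] := leP r' s; first by apply: Hd' => //; lra.
  have -> : W s + (p r' - p s) *: g c - W s - (p r' - p s) *: g s =
            (p r' - p s) *: g c - (p r' - p s) *: g s by modring R.
  by apply: aux; lra.
Qed.

(** By the mean value inequality approximate primitives with small errors are
    close to each other, increments included, so they converge to a primitive. *)
Lemma primitive_exists {R : realType} {E : completeNormedModType R} (p : R -> R)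
    (g : R -> E) (b : R) : 0 <= b ->
  (forall s t, 0 <= s -> s <= t -> t <= b -> p s <= p t) ->
  (forall c, 0 <= c <= b -> forall e, 0 < e -> exists2 d, 0 < d &
     forall s, 0 <= s <= b -> `|s - c| < d -> `|g s - g c| <= e) ->
  exists2 W, W 0 = 0 & forall e, 0 < e -> eprim p g e b W.
Proof.
move=> b0 pm gc.
have ex n : {W : R -> E | W 0 = 0 /\ eprim p g (1 / 2 ^+ n) b W}.
  apply: cid; have [|W W0 HW] := eprim_exists p g (1 / 2 ^+ n) b b0 _ gc.
    by rewrite divr_gt0 ?exprn_gt0.
  by exists W.
pose Wn n := projT1 (ex n).
have Wn0 n : Wn n 0 = 0 by have [] := projT2 (ex n).
have WnP n : eprim p g (1 / 2 ^+ n) b (Wn n) by have [] := projT2 (ex n).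
have diff n m s t : 0 <= s -> s <= t -> t <= b ->
    `|(Wn n t - Wn m t) - (Wn n s - Wn m s)| <= (1 / 2 ^+ n + 1 / 2 ^+ m) * (p t - p s).
  move=> s0 st tb.
  apply: (@lipschitz_chain R E (fun t => Wn n t - Wn m t)) => //.
    by move=> ? ? ? ? ?; apply: pm; lra.
  move=> c cst.
  have cb : 0 <= c <= b by lra.
  have [d1 d10 H1] := WnP n c cb; have [d2 d20 H2] := WnP m c cb.
  exists (Num.min d1 d2); first by rewrite lt_min d10.
  move=> r rst; rewrite lt_min => /andP[r1 r2].
  have rb : 0 <= r <= b by lra.
  have := H1 r rb r1; have := H2 r rb r2.
  set x1 := _ - _ *: _; set x2 := _ - _ *: _ => h1 h2.
  have -> : Wn n r - Wn m r - (Wn n c - Wn m c) = x2 - x1.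
    by rewrite /x1 /x2; modring R.
  by apply: (le_trans (ler_normB _ _)); rewrite mulrDl; lra.
have cauchy t : 0 <= t <= b -> forall n,
    `|Wn n.+1 t - Wn n t| <= 2 * (p t - p 0) / 2 ^+ n.
  move=> tb n; have := diff n.+1 n 0 t; rewrite !Wn0 !subrr subr0 => h.
  apply: (le_trans (h _ _ _)); [lra..|].
  have p0 : 0 <= p t - p 0 by rewrite subr_ge0 pm //; lra.
  have n0 : 0 <= (2 ^+ n)^-1 :> R by rewrite invr_ge0 exprn_ge0.
  have := mulr_ge0 p0 n0.
  by rewrite exprS invfM; set q := (2 ^+ n)^-1; nra.
have lim t : {l | 0 <= t <= b ->
    forall n, `|l - Wn n t| <= 2 * (2 * (p t - p 0)) / 2 ^+ n}.
  apply: cid; case: (boolP (0 <= t <= b)) => tb; last by exists 0.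
  by have [l Hl] := geometric_cvg _ _ (cauchy t tb); exists l.
pose W t := if t == 0 then 0 else projT1 (lim t).
have WP t : 0 <= t <= b ->
    forall n, `|W t - Wn n t| <= 2 * (2 * (p t - p 0)) / 2 ^+ n.
  rewrite /W; case: eqP => [-> _ n|_ tb].
    by rewrite Wn0 subrr normr0 subrr !mulr0 mul0r.
  exact: (projT2 (lim t) tb).
exists W; first by rewrite /W eqxx.
have incr n s t : 0 <= s <= b -> 0 <= t <= b ->
    `|(W t - Wn n t) - (W s - Wn n s)| <= 1 / 2 ^+ n * `|p t - p s|.
  wlog st : s t / s <= t.
    move=> wl sb tb; have [st|ts] := leP s t; first exact: wl.
    by rewrite distrC [`|p _ - _|]distrC; apply: wl => //; exact: ltW.
  move=> sb tb.
  rewrite ger0_norm ?subr_ge0 ?pm //; [|lra..].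
  apply: (@le_geometric _ _ _ (p t - p s + 2 * (2 * (p t - p 0)) + 2 * (2 * (p s - p 0)))) => m.
  have h1 := WP t tb m; have h2 := WP s sb m.
  have h3 : `|(Wn m t - Wn n t) - (Wn m s - Wn n s)| <= (1 / 2 ^+ m + 1 / 2 ^+ n) * (p t - p s).
    by apply: diff; lra.
  have -> : (W t - Wn n t) - (W s - Wn n s) =
     (W t - Wn m t) - (W s - Wn m s) + ((Wn m t - Wn n t) - (Wn m s - Wn n s)).
    by modring R.
  apply: (le_trans (ler_normD _ _)).
  have := ler_normB (W t - Wn m t) (W s - Wn m s).
  by set q := (2 ^+ m)^-1 in h1 h2 h3 *; lra.
move=> e e0 c cb.
have [n Hn] := geometric_small 2 e e0.
have [d d0 Hd] := WnP n c cb.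
exists d => // s sb sc.
have := Hd s sb sc; have := incr n c s cb sb => h1 h2.
have -> : W s - W c - (p s - p c) *: g c =
  ((W s - Wn n s) - (W c - Wn n c)) + (Wn n s - Wn n c - (p s - p c) *: g c).
  by modring R.
apply: (le_trans (ler_normD _ _)).
have : 2 / 2 ^+ n * `|p s - p c| <= e * `|p s - p c| by rewrite ler_wpM2r.
lra.
Qed.

(** * Continuity and differentiability on a half-open interval *)

Definition contI {R : realType} {E : normedModType R} (T : R) (v : R -> E) (t : R) :=
  forall e, 0 < e -> exists2 d, 0 < d &
    forall s, 0 < s <= T -> `|s - t| < d -> `|v s - v t| <= e.

Definition derI {R : realType} {E : normedModType R} (T : R) (v : R -> E) (t : R)
    (l : E) :=
  forall e, 0 < e -> exists2 d, 0 < d &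
    forall s, 0 < s <= T -> `|s - t| < d ->
      `|v s - v t - (s - t) *: l| <= e * `|s - t|.

Section HalfOpen.
Context {R : realType} {E F : normedModType R}.
Implicit Types (v w : R -> E) (T t s : R) (l : E).

Lemma contI_local T T' v w t d0 : 0 < d0 -> v t = w t ->
  (forall s, 0 < s <= T -> `|s - t| < d0 -> s <= T' /\ v s = w s) ->
  contI T' v t -> contI T w t.
Proof.
move=> d00 vwt loc cv e e0; have [d dpos Hd] := cv e e0.
exists (Num.min d d0); first by rewrite lt_min dpos.
move=> s sT; rewrite lt_min => /andP[sd sd0].
have [sT' <-] := loc s sT sd0; rewrite -vwt; apply: Hd => //.
by case/andP: sT => -> _.
Qed.

Lemma derI_local T T' v w t l d0 : 0 < d0 -> v t = w t ->
  (forall s, 0 < s <= T -> `|s - t| < d0 -> s <= T' /\ v s = w s) ->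
  derI T' v t l -> derI T w t l.
Proof.
move=> d00 vwt loc cv e e0; have [d dpos Hd] := cv e e0.
exists (Num.min d d0); first by rewrite lt_min dpos.
move=> s sT; rewrite lt_min => /andP[sd sd0].
have [sT' <-] := loc s sT sd0; rewrite -vwt; apply: Hd => //.
by case/andP: sT => -> _.
Qed.

Lemma contI_restrict T T' v t : T' <= T -> contI T v t -> contI T' v t.
Proof.
move=> TT c e e0; have [d d0 H] := c e e0; exists d => // s sT; apply: H.
by move: sT TT; lra.
Qed.

Lemma derI_restrict T T' v t l : T' <= T -> derI T v t l -> derI T' v t l.
Proof.
move=> TT c e e0; have [d d0 H] := c e e0; exists d => // s sT; apply: H.
by move: sT TT; lra.
Qed.

Lemma contI_shift T v s t : 0 < s -> contI T v (s + t) ->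
  contI (T - s) (fun r => v (s + r)) t.
Proof.
move=> s0 c e e0; have [d d0 H] := c e e0; exists d => // r rT rt.
by apply: H; [lra|have -> : s + r - (s + t) = r - t by ring].
Qed.

Lemma derI_shift T v s t l : 0 < s -> derI T v (s + t) l ->
  derI (T - s) (fun r => v (s + r)) t l.
Proof.
move=> s0 c e e0; have [d d0 H] := c e e0; exists d => // r rT rt.
have E1 : s + r - (s + t) = r - t by ring.
by rewrite -E1; apply: H; [lra|rewrite E1].
Qed.

Lemma contI_lin T a v w t : contI T v t -> contI T w t ->
  contI T (fun r => a *: v r + w r) t.
Proof.
move=> cv cw e e0.
have a1 : 0 < `|a| + 1 by have := normr_ge0 a; lra.
have [|d1 d10 H1] := cv (e / 2 / (`|a| + 1)); first by rewrite divr_gt0 //; lra.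
have [|d2 d20 H2] := cw (e / 2); first lra.
exists (Num.min d1 d2); first by rewrite lt_min d10.
move=> s sT; rewrite lt_min => /andP[/(H1 s sT) h1 /(H2 s sT) h2].
have -> : a *: v s + w s - (a *: v t + w t) = a *: (v s - v t) + (w s - w t).
  by modring R.
apply: (le_trans (ler_normD _ _)); rewrite normrZ.
move: h1; rewrite ler_pdivlMr // => h1.
have := normr_ge0 (v s - v t); nra.
Qed.

Lemma contI_scale T (p : R -> R) v t : @contI R R T p t -> contI T v t ->
  contI T (fun r => p r *: v r) t.
Proof.
move=> cp cv e e0.
have v1 : 0 < `|v t| + 1 by have := normr_ge0 (v t); lra.
have p1 : 0 < `|p t| + 1 by have := normr_ge0 (p t); lra.
have [|d1 d10 H1] := cp (Num.min 1 (e / 2 / (`|v t| + 1))).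
  by rewrite lt_min ltr01 divr_gt0 //; lra.
have [|d2 d20 H2] := cv (e / 2 / (`|p t| + 1)); first by rewrite divr_gt0 //; lra.
exists (Num.min d1 d2); first by rewrite lt_min d10.
move=> s sT; rewrite lt_min => /andP[/(H1 s sT) h1 /(H2 s sT) h2].
move: h1 h2; rewrite le_min => /andP[h1 h1']; move: h1'.
rewrite ler_pdivlMr // => h1'; rewrite ler_pdivlMr // => h2.
have -> : p s *: v s - p t *: v t = p s *: (v s - v t) + (p s - p t) *: v t.
  by modring R.
apply: (le_trans (ler_normD _ _)); rewrite !normrZ.
have ps : `|p s| <= `|p t| + 1.
  have -> : p s = p t + (p s - p t) by ring.
  by apply: (le_trans (ler_normD _ _)); lra.
have := ler_wpM2r (normr_ge0 (v s - v t)) ps.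
have := normr_ge0 (p s - p t); lra.
Qed.

Lemma derI_lin T a v w t l m : derI T v t l -> derI T w t m ->
  derI T (fun r => a *: v r + w r) t (a *: l + m).
Proof.
move=> cv cw e e0.
have a1 : 0 < `|a| + 1 by have := normr_ge0 a; lra.
have [|d1 d10 H1] := cv (e / 2 / (`|a| + 1)); first by rewrite divr_gt0 //; lra.
have [|d2 d20 H2] := cw (e / 2); first lra.
exists (Num.min d1 d2); first by rewrite lt_min d10.
move=> s sT; rewrite lt_min => /andP[/(H1 s sT) h1 /(H2 s sT) h2].
have -> : a *: v s + w s - (a *: v t + w t) - (s - t) *: (a *: l + m) =
  a *: (v s - v t - (s - t) *: l) + (w s - w t - (s - t) *: m).
  by modring R.
apply: (le_trans (ler_normD _ _)); rewrite normrZ.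
move: h1; rewrite mulrAC ler_pdivlMr // => h1.
have := normr_ge0 (v s - v t - (s - t) *: l); nra.
Qed.

Lemma derI_contI T v t l : derI T v t l -> contI T v t.
Proof.
move=> D e e0; have [d d0 H] := D 1 ltr01.
have l1 : 0 < `|l| + 1 by have := normr_ge0 l; lra.
exists (Num.min d (e / (`|l| + 1))); first by rewrite lt_min d0 divr_gt0.
move=> s sT; rewrite lt_min ltr_pdivlMr // => /andP[/(H s sT) h1 h2].
have -> : v s - v t = (v s - v t - (s - t) *: l) + (s - t) *: l by modring R.
by apply: (le_trans (ler_normD _ _)); rewrite normrZ; lra.
Qed.

(** Points of the interval accumulate at [t] from the left. *)
Lemma derI_unique T v t l m : 0 < t <= T -> derI T v t l -> derI T v t m -> l = m.
Proof.
move=> tT D1 D2; apply/eqP; rewrite -subr_eq0 -normr_le0.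
apply/ler_addgt0Pr => e e0; rewrite add0r.
have [|d1 d10 H1] := D1 (e / 2); first lra.
have [|d2 d20 H2] := D2 (e / 2); first lra.
pose h := Num.min (t / 2) (Num.min (d1 / 2) (d2 / 2)).
have h0 : 0 < h by rewrite !lt_min; lra.
have [ht [hd1 hd2]] : h <= t / 2 /\ h <= d1 / 2 /\ h <= d2 / 2.
  by rewrite !ge_min !lexx !orbT.
have sT : 0 < t - h <= T by lra.
have E1 : t - h - t = - h by ring.
have /(H1 _ sT) : `|t - h - t| < d1 by rewrite E1 normrN gtr0_norm //; lra.
have /(H2 _ sT) : `|t - h - t| < d2 by rewrite E1 normrN gtr0_norm //; lra.
rewrite E1 normrN (gtr0_norm h0).
set x := v _ - v _ => h1 h2.
have : `|h *: (l - m)| <= e * h.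
  have -> : h *: (l - m) = (x - (- h) *: l) - (x - (- h) *: m) by modring R.
  by apply: (le_trans (ler_normB _ _)); lra.
by rewrite normrZ gtr0_norm // mulrC ler_pM2r.
Qed.

Lemma derI_linear T v t l (B : {linear E -> F}) K :
  (forall x, `|B x| <= K * `|x|) -> derI T v t l ->
  derI T (fun r => B (v r)) t (B l).
Proof.
move=> BK D e e0.
have K1 : 0 < `|K| + 1 by have := normr_ge0 K; lra.
have [|d d0 H] := D (e / (`|K| + 1)); first by rewrite divr_gt0.
exists d => // s sT /(H s sT); rewrite mulrAC ler_pdivlMr // => h.
rewrite -linearZ -!linearB; apply: (le_trans (BK _)).
have := normr_ge0 (v s - v t - (s - t) *: l); have := ler_norm K; nra.
Qed.

Lemma contI_linear T v t (B : {linear E -> F}) K :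
  (forall x, `|B x| <= K * `|x|) -> contI T v t -> contI T (fun r => B (v r)) t.
Proof.
move=> BK D e e0.
have K1 : 0 < `|K| + 1 by have := normr_ge0 K; lra.
have [|d d0 H] := D (e / (`|K| + 1)); first by rewrite divr_gt0.
exists d => // s sT /(H s sT); rewrite ler_pdivlMr // => h.
rewrite -!linearB; apply: (le_trans (BK _)).
have := normr_ge0 (v s - v t); have := ler_norm K; nra.
Qed.

Lemma mvi T v dv c s t : 0 < s -> s <= t -> t <= T ->
  (forall r, s <= r <= t -> derI T v r (dv r)) ->
  (forall r, s <= r <= t -> `|dv r| <= c) -> `|v t - v s| <= c * (t - s).
Proof.
move=> s0 st tT D dc; apply/ler_addgt0Pr => e e0.
have ts : 0 <= t - s by lra.
suff h : forall e, 0 < e -> `|v t - v s| <= (c + e) * (t - s).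
  have k0 : 0 < t - s + 1 by lra.
  apply: (le_trans (h (e / (t - s + 1)) _)); first by rewrite divr_gt0.
  rewrite mulrDl lerD2l mulrAC ler_pdivrMr //; nra.
move=> {e0} {}e e0.
apply: (@lipschitz_chain R E v id) => // r rst.
have [d d0 H] := D r rst e e0; exists d => // r' r'st r'r.
have h : `|v r' - v r - (r' - r) *: dv r| <= e * `|r' - r| by apply: H => //; lra.
have -> : v r' - v r = (v r' - v r - (r' - r) *: dv r) + (r' - r) *: dv r by modring R.
apply: (le_trans (ler_normD _ _)); rewrite normrZ.
have := dc r rst; have := normr_ge0 (r' - r); nra.
Qed.

End HalfOpen.

Section Power.
Context {R : realType}.

Lemma powR_der (a T t : R) : 0 < t ->
  @derI R R T (fun s => s `^ a) t (a * t `^ (a - 1)).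
Proof.
move=> t0 e e0.
have [dv dE] := @is_derive1_powR R a t t0.
have : (h^-1 *: ((h *: 1 + t) `^ a - t `^ a)) @[h --> 0^'] --> (a * t `^ (a - 1) : R).
  by rewrite -dE; exact: dv.
move/cvgrPdist_le => /(_ e e0) [d /= d0 H].
exists d => // s sT st.
have [->|nst] := eqVneq s t.
  by rewrite !subrr scale0r subr0 normr0 mulr0.
have h0 : s - t != 0 by rewrite subr_eq0.
have := H (s - t); rewrite /= sub0r normrN => /(_ st h0).
rewrite /GRing.scale /= mulr1 subrK => h.
have -> : s `^ a - t `^ a - (s - t) * (a * t `^ (a - 1)) =
  - ((s - t) * (a * t `^ (a - 1) - (s - t)^-1 * (s `^ a - t `^ a))) by field.
by rewrite normrN normrM mulrC ler_wpM2r.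
Qed.

Lemma powR_cont (a T t : R) : 0 < t -> @contI R R T (fun s => s `^ a) t.
Proof. by move=> t0; apply: derI_contI; exact: powR_der. Qed.

Lemma powR_small (a e : R) : 0 < a -> 0 < e ->
  exists2 d, 0 < d & forall t, 0 <= t -> t <= d -> t `^ a <= e.
Proof.
move=> a0 e0; exists (e `^ a^-1); first exact: powR_gt0.
move=> t t0 te.
have -> : e = (e `^ a^-1) `^ a by rewrite -powRrM mulVf ?gt_eqF // powRr1 ?ltW.
by apply: ge0_ler_powR; rewrite ?nnegrE ?powR_ge0 // ltW.
Qed.

Lemma powR_incr (a s t : R) : 0 <= a -> 0 <= s -> s <= t -> s `^ a <= t `^ a.
Proof. by move=> *; apply: ge0_ler_powR; rewrite ?nnegrE //; lra. Qed.

(** The function [c / mu * t `^ mu] has derivative [c * t `^ (mu - 1)], so the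
    singularity that the weight allows at 0 is integrable. *)
Lemma mvi_weight {E : normedModType R} (mu T : R) (v dv : R -> E) c s t :
  0 < mu -> 0 < s -> s <= t -> t <= T ->
  (forall r, s <= r <= t -> derI T v r (dv r)) ->
  (forall r, s <= r <= t -> r `^ (1 - mu) * `|dv r| <= c) ->
  `|v t - v s| <= c / mu * (t `^ mu - s `^ mu).
Proof.
move=> mu0 s0 st tT D dc.
have pinc r r' : s <= r -> r <= r' -> r' <= t -> r `^ mu <= r' `^ mu.
  by move=> *; apply: powR_incr; lra.
apply/ler_addgt0Pr => e e0.
suff h : forall e, 0 < e -> `|v t - v s| <= (c / mu + e) * (t `^ mu - s `^ mu).
  have k0 : 0 < t `^ mu - s `^ mu + 1 by have := pinc s t; lra.
  apply: (le_trans (h (e / (t `^ mu - s `^ mu + 1)) _)); first by rewrite divr_gt0.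
  rewrite mulrDl lerD2l mulrAC ler_pdivrMr //.
  by have := pinc s t; nra.
move=> {e0} {}e e0.
apply: (@lipschitz_chain R E v (fun r => r `^ mu)) => // r rst.
have r0 : 0 < r by lra.
have c0 : 0 <= c.
  by apply: le_trans (dc r rst); rewrite mulr_ge0 ?powR_ge0.
pose z := r `^ (mu - 1).
have z0 : 0 < z by exact: powR_gt0.
have zE : r `^ (1 - mu) = z^-1 by rewrite /z -powRN opprB.
have dr : `|dv r| <= c * z.
  by have := dc r rst; rewrite zE mulrC ler_pdivrMr.
(* near [r] the slope of [r `^ mu] is at least [mu * z - k] and that of [v] at
   most [c * z + k]; this [k] makes the second at most [L] times the first *)
pose L := c / mu + e.
have L0 : 0 < L by rewrite /L; have := divr_ge0 c0 (ltW mu0); lra.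
pose k := e * mu * z / (1 + L).
have k0 : 0 < k by rewrite /k divr_gt0 ?mulr_gt0 //; lra.
have [d1 d10 H1] := D r rst k k0.
have [d2 d20 H2] := powR_der mu T r r0 k k0.
exists (Num.min d1 d2); first by rewrite lt_min d10.
move=> r' r'st; rewrite lt_min => /andP[h1 h2].
have r'T : 0 < r' <= T by lra.
have := H1 r' r'T h1; have := H2 r' r'T h2.
rewrite /GRing.scale /= -/z => g2 g1.
set y := `|r' - r| in g1 g2 *.
have y0 : 0 <= y := normr_ge0 _.
have u1 : `|v r' - v r| <= (c * z + k) * y.
  have -> : v r' - v r = (v r' - v r - (r' - r) *: dv r) + (r' - r) *: dv r by modring R.
  apply: (le_trans (ler_normD _ _)); rewrite normrZ -/y; nra.
have u2 : (mu * z - k) * y <= `|r' `^ mu - r `^ mu|.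
  have -> : (mu * z - k) * y = `|(r' - r) * (mu * z)| - k * y.
    by rewrite normrM -/y (gtr0_norm (mulr_gt0 mu0 z0)); ring.
  rewrite lerBlDr.
  have -> : (r' - r) * (mu * z) = (r' `^ mu - r `^ mu) -
    (r' `^ mu - r `^ mu - (r' - r) * (mu * z)) by ring.
  by apply: (le_trans (ler_normB _ _)); lra.
apply: (le_trans u1); apply: (@le_trans _ _ (L * ((mu * z - k) * y))); last first.
  by rewrite ler_pM2l.
rewrite mulrA ler_wpM2r //.
have kL : k * (1 + L) = e * mu * z by rewrite /k divfK //; lra.
have cL : c * z = (L - e) * mu * z.
  by rewrite /L; field; rewrite gt_eqF.
by rewrite mulrBr -subr_ge0; move: kL; rewrite mulrDr mulr1 cL => kL; nra.
Qed.

End Power.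

(** * Weighted continuous functions *)

Definition wcont {R : realType} {E : normedModType R} (mu T : R) (v : R -> E) :=
  (forall t, 0 < t <= T -> contI T v t) /\
  forall e, 0 < e -> exists2 d, 0 < d &
    forall t, 0 < t <= T -> t < d -> t `^ (1 - mu) * `|v t| <= e.

Definition wbound {R : realType} {E : normedModType R} (mu T : R) (v : R -> E)
    (c : R) := forall t, 0 < t <= T -> t `^ (1 - mu) * `|v t| <= c.

Lemma contIP {R : realType} {E : normedModType R} (T : R) (v : R -> E) :
  (forall t, 0 < t <= T -> contI T v t) <-> {within `]0, T], continuous v}.
Proof.
split=> [H|/subspace_continuousP H].
  apply/subspace_continuousP => t; rewrite set_itvE /= => tT.
  apply/cvgrPdist_le => e e0; have [d d0 Hd] := H t tT e e0.
  exists d => //= s st sT; rewrite distrC; apply: Hd; last by rewrite distrC.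
  by [].
move=> t tT e e0.
have /H /cvgrPdist_le /(_ e e0) [d /= d0 Hd] : `]0, T]%classic t by rewrite set_itvE.
exists d => // s sT st; rewrite distrC; by apply: Hd; rewrite /= 1?distrC // set_itvE.
Qed.

Section Weighted.
Context {R : realType} (mu : R) (mu01 : 0 < mu < 1).

Let mu1 : 0 < 1 - mu. Proof. by case/andP: mu01; lra. Qed.
Let w0 (t : R) : 0 <= t `^ (1 - mu). Proof. exact: powR_ge0. Qed.

Let w_incr (s t : R) : 0 <= s -> s <= t -> s `^ (1 - mu) <= t `^ (1 - mu).
Proof. by apply: powR_incr; exact: ltW. Qed.

Section OneSpace.
Context {E : normedModType R}.
Implicit Types (v w : R -> E) (T c : R).

Lemma wcont_restrict T T' v : T' <= T -> wcont mu T v -> wcont mu T' v.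
Proof.
move=> TT [c z]; split=> [t tT|e e0].
  by apply: (@contI_restrict _ _ T) => //; apply: c; lra.
by have [d d0 H] := z e e0; exists d => // t tT; apply: H; lra.
Qed.

Lemma wbound_restrict T T' v c : T' <= T -> wbound mu T v c -> wbound mu T' v c.
Proof. by move=> TT h t tT; apply: h; lra. Qed.

Lemma wbound_le T v c c' : c <= c' -> wbound mu T v c -> wbound mu T v c'.
Proof. by move=> cc h t tT; exact: le_trans (h t tT) cc. Qed.

Lemma wcont_ext T v w : (forall t, 0 < t <= T -> v t = w t) ->
  wcont mu T v -> wcont mu T w.
Proof.
move=> vw [c z]; split=> [t tT|e e0].
  by apply: (@contI_local R E T T v w t 1) => //; [exact: vw|
    move=> s sT _; split; [lra|exact: vw]|exact: c].
by have [d d0 H] := z e e0; exists d => // t tT; rewrite -vw //; apply: H.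
Qed.

Lemma wbound_ext T v w c : (forall t, 0 < t <= T -> v t = w t) ->
  wbound mu T v c -> wbound mu T w c.
Proof. by move=> vw h t tT; rewrite -vw //; exact: h. Qed.

Lemma wbound_lin T a v w c c' : wbound mu T v c -> wbound mu T w c' ->
  wbound mu T (fun r => a *: v r + w r) (`|a| * c + c').
Proof.
move=> hv hw t tT; have := hv t tT; have := hw t tT => h1 h2.
apply: (@le_trans _ _ (t `^ (1 - mu) * (`|a| * `|v t| + `|w t|))).
  by rewrite ler_wpM2l // -normrZ ler_normD.
rewrite mulrDr lerD // mulrCA ler_wpM2l //.
Qed.

Lemma wboundB T v w c c' : wbound mu T v c -> wbound mu T w c' ->
  wbound mu T (fun r => v r - w r) (c + c').
Proof.
move=> hv hw.
have := wbound_lin T (-1) w v _ _ hw hv; rewrite normrN normr1 mul1r addrC.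
by apply: wbound_ext => t _; modring R.
Qed.

Lemma wcont_lin T a v w : wcont mu T v -> wcont mu T w ->
  wcont mu T (fun r => a *: v r + w r).
Proof.
move=> [c1 z1] [c2 z2]; split=> [t tT|e e0].
  by apply: contI_lin; [exact: c1|exact: c2].
have a1 : 0 < `|a| + 1 by have := normr_ge0 a; lra.
have [|d1 d10 H1] := z1 (e / 2 / (`|a| + 1)); first by rewrite divr_gt0 //; lra.
have [|d2 d20 H2] := z2 (e / 2); first lra.
exists (Num.min d1 d2); first by rewrite lt_min d10.
move=> t tT; rewrite lt_min => /andP[/(H1 t tT) h1 /(H2 t tT) h2].
apply: (@le_trans _ _ (t `^ (1 - mu) * (`|a| * `|v t| + `|w t|))).
  by rewrite ler_wpM2l // -normrZ ler_normD.
move: h1; rewrite ler_pdivlMr // => h1.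
have := mulr_ge0 (w0 t) (normr_ge0 (v t)).
by have := normr_ge0 a; nra.
Qed.

Lemma wcontB T v w : wcont mu T v -> wcont mu T w ->
  wcont mu T (fun r => v r - w r).
Proof.
move=> hv hw; have := wcont_lin T (-1) w v hw hv.
by apply: wcont_ext => t _; modring R.
Qed.

Lemma wcont_shift T v s : 0 < s < T -> wcont mu T v ->
  wcont mu (T - s) (fun r => v (s + r)).
Proof.
move=> sT [c _]; split=> [t tT|e e0].
  by apply: contI_shift; [lra|apply: c; lra].
have [|d d0 H] := c s _ 1 ltr01; first lra.
have k0 : 0 < `|v s| + 1 by have := normr_ge0 (v s); lra.
have [d' d'0 H'] := @powR_small R (1 - mu) (e / (`|v s| + 1)) mu1 (divr_gt0 e0 k0).
exists (Num.min d d'); first by rewrite lt_min d0.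
move=> t tT; rewrite lt_min => /andP[td td'].
have h1 := H' t (ltac:(lra)) (ltW td').
have h2 : `|v (s + t) - v s| <= 1.
  by apply: H; [lra|rewrite addrC addKr gtr0_norm //; lra].
have h3 : `|v (s + t)| <= `|v s| + 1.
  have -> : v (s + t) = v s + (v (s + t) - v s) by modring R.
  by apply: (le_trans (ler_normD _ _)); lra.
move: h1; rewrite ler_pdivlMr // => h1; apply: le_trans h1.
by rewrite ler_wpM2l.
Qed.

Lemma wcont_cst T (x : E) : wcont mu T (fun=> x).
Proof.
split=> [t tT e e0|e e0]; first by exists 1 => // s _ _; rewrite subrr normr0 ltW.
have k0 : 0 < `|x| + 1 by have := normr_ge0 x; lra.
have [d' d'0 H'] := @powR_small R (1 - mu) (e / (`|x| + 1)) mu1 (divr_gt0 e0 k0).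
exists d' => // t tT td.
have := H' t (ltac:(lra)) (ltW td); rewrite ler_pdivlMr // => h1.
by apply: le_trans h1; rewrite ler_wpM2l //= lerDl.
Qed.

Lemma wcont_bounded T v : 0 <= T -> wcont mu T v ->
  exists2 c, 0 < c & wbound mu T v c.
Proof.
move=> T0 [c z].
apply: (@real_induction _ (fun t => exists2 c, 0 < c & wbound mu t v c) 0 T) => //.
  by exists 1 => // t; lra.
move=> a aT.
have [d d0 [k k0 Hd]] : exists2 d, 0 < d & exists2 k, 0 < k &
    forall t, 0 < t <= T -> `|t - a| < d -> t `^ (1 - mu) * `|v t| <= k.
  have [a0|/negPf a0] := eqVneq a 0.
    have [d d0 H] := z 1 ltr01; exists d => //; exists 1 => // t tT.
    by rewrite a0 subr0 gtr0_norm; [exact: H|lra].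
  have aT' : 0 < a <= T by rewrite lt_neqAle eq_sym a0.
  have [d d0 H] := c a aT' 1 ltr01.
  have T1 : 0 <= T `^ (1 - mu) := w0 T.
  exists d => //; exists (T `^ (1 - mu) * (`|v a| + 1) + 1).
    by have := normr_ge0 (v a); nra.
  move=> t tT td; have h := H t tT td.
  have h3 : `|v t| <= `|v a| + 1.
    have -> : v t = v a + (v t - v a) by modring R.
    by apply: (le_trans (ler_normD _ _)); lra.
  have : t `^ (1 - mu) <= T `^ (1 - mu) by apply: w_incr; lra.
  by move=> ?; rewrite ler_wpDr // ler_pM.
exists d => // s t sa as_ at_ td [k' k'0 Hk'].
exists (k + k'); first lra.
move=> r rt; have [rs|sr] := leP r s.
  by apply: (le_trans (Hk' r _)); lra.
by apply: (le_trans (Hd r _ _)); [lra|rewrite ltr_norml; lra|lra].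
Qed.

End OneSpace.

Lemma wcont_linear {E F : normedModType R} (T K : R) (v : R -> E)
    (B : {linear E -> F}) :
  (forall x, `|B x| <= K * `|x|) -> wcont mu T v -> wcont mu T (fun r => B (v r)).
Proof.
move=> BK [c z]; split=> [t tT|e e0]; first exact: contI_linear BK (c t tT).
have K1 : 0 < `|K| + 1 by have := normr_ge0 K; lra.
have [|d d0 H] := z (e / (`|K| + 1)); first by rewrite divr_gt0.
exists d => // t tT td; have := H t tT td; rewrite ler_pdivlMr // => h.
have := BK (v t); have := normr_ge0 (v t); have := ler_norm K; have := w0 t.
set q := t `^ _ in h *; move=> q0 k1 v0 Bv.
apply: le_trans h; rewrite -mulrA ler_wpM2l //; nra.
Qed.

(** Boundedness on the half-open interval follows from continuity and the limit
    at 0. *)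
Lemma BCwP {E : completeNormedModType R} (T : R) (v : R -> E) : 0 < T ->
  BCw mu T v <-> wcont mu T v.
Proof.
move=> T0; split=> [[/contIP c _ z]|h].
  split=> // e e0; move/cvgrPdist_le : z => /(_ e e0) [d /= d0 H].
  exists d => // t tT td.
  have := H t; rewrite /= sub0r normrN gtr0_norm; last lra.
  move=> /(_ td); rewrite sub0r normrN normr_id normrZ ger0_norm //.
  by apply; lra.
have [c z] := h; split; first by apply/contIP.
- split.
    apply/contIP => t tT; apply: contI_scale; last exact: c.
    by apply: powR_cont; lra.
  have [k k0 Hk] := wcont_bounded T v (ltW T0) h.
  exists k; split=> [|M kM t]; first exact: num_real.
  rewrite set_itvE /= => tT; rewrite normrZ ger0_norm //.
  by apply: le_trans (ltW kM); exact: Hk.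
- apply/cvgrPdist_le => e e0; have [d d0 H] := z e e0.
  exists (Num.min d T); first by rewrite /= lt_min d0.
  move=> t /=; rewrite sub0r normrN => tT t0.
  rewrite sub0r normrN normr_id normrZ ger0_norm //.
  by move: tT; rewrite gtr0_norm // lt_min => /andP[td tT]; apply: H => //; lra.
Qed.

Lemma wcont_complete {E : completeNormedModType R} (T c : R) (s : nat -> R -> E) :
  (forall n, wcont mu T (s n)) ->
  (forall n, wbound mu T (fun t => s n.+1 t - s n t) (c / 2 ^+ n)) ->
  exists2 v, wcont mu T v &
    forall n, wbound mu T (fun t => v t - s n t) (2 * c / 2 ^+ n).
Proof.
move=> sc sb.
have wE (t : R) : 0 < t -> 0 < t `^ (1 - mu) by move=> t0; rewrite powR_gt0.
have lim t : {l | 0 < t <= T ->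
    forall n, t `^ (1 - mu) * `|l - s n t| <= 2 * c / 2 ^+ n}.
  apply: cid; case: (boolP (0 < t <= T)) => tT; last by exists 0.
  have t0 : 0 < t `^ (1 - mu) by apply: wE; case/andP: tT.
  have [n|l Hl] := geometric_cvg (fun n => s n t) (c / t `^ (1 - mu)).
    by have h := sb n t tT; rewrite mulrAC ler_pdivlMr // mulrC.
  exists l => _ n; have h := Hl n.
  by rewrite mulrC -ler_pdivlMr //; apply: (le_trans h); rewrite mulrA mulrAC.
pose v t := projT1 (lim t).
have vP n : wbound mu T (fun t => v t - s n t) (2 * c / 2 ^+ n).
  by move=> t tT; exact: (projT2 (lim t) tT).
exists v => //; split=> [t tT e e0|e e0].
  have q0 : 0 < (t / 2) `^ (1 - mu) by rewrite wE //; lra.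
  have [|n Hn] := geometric_small (2 * c) (e / 3 * (t / 2) `^ (1 - mu)).
    by rewrite mulr_gt0 //; lra.
  have [|d d0 Hd] := (sc n).1 t tT (e / 3); first lra.
  exists (Num.min d (t / 2)); first by rewrite lt_min d0; lra.
  move=> r rT; rewrite lt_min => /andP[/(Hd r rT) h1]; rewrite ltr_norml => h2.
  have near x : 0 < x <= T -> t / 2 <= x -> `|v x - s n x| <= e / 3.
    move=> xT tx; have := vP n x xT.
    have : (t / 2) `^ (1 - mu) <= x `^ (1 - mu) by apply: w_incr; lra.
    have := normr_ge0 (v x - s n x) => n0 p1 p2.
    by rewrite -(ler_pM2r q0); apply: le_trans Hn; apply: le_trans p2; rewrite mulrC ler_wpM2r.
  have -> : v r - v t = (v r - s n r) - (v t - s n t) + (s n r - s n t) by modring R.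
  apply: (le_trans (ler_normD _ _)); have := ler_normB (v r - s n r) (v t - s n t).
  have := near r rT; have := near t tT; lra.
have [|n Hn] := geometric_small (2 * c) (e / 2); first lra.
have [|d d0 Hd] := (sc n).2 (e / 2); first lra.
exists d => // t tT td; have := Hd t tT td; have := vP n t tT => h1 h2.
have -> : v t = (v t - s n t) + s n t by modring R.
apply: (@le_trans _ _ (t `^ (1 - mu) * (`|v t - s n t| + `|s n t|))).
  by rewrite ler_wpM2l // ler_normD.
by rewrite mulrDr; lra.
Qed.

End Weighted.

(** * Interpolation spaces *)

Lemma continuous_linear_le {R : realType} {E F : normedModType R}
    (B : {linear E -> F}) : continuous B ->
  exists2 K, 0 < K & forall x, `|B x| <= K * `|x|.
Proof.
move=> /linear_bounded_continuous /linear_boundedP [M [_ HM]].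
pose K := Num.max M 0 + 1.
have m0 : 0 <= Num.max M 0 by rewrite le_max lexx orbT.
have mM : M <= Num.max M 0 by rewrite le_max lexx.
by exists K => [|x]; [|apply: HM]; rewrite /K; lra.
Qed.

(** The norm bound by [c] in the real interpolation space, as an inequality
    between reals. Unlike a bound on [interp_norm], which has the default value 0
    outside that space, it contains the membership of [x]. *)
Definition interp_le {R : realType} {E0 E1 : completeNormedModType R}
    (j : {linear E1 -> E0}) (theta : R) (x : E0) (c : R) :=
  forall t, 0 < t -> Kfun j t x <= c * t `^ theta.

Section Interp.
Context {R : realType} {E0 E1 : completeNormedModType R} (j : {linear E1 -> E0}).
Context (Hj : banach_couple j).
Implicit Types (x y : E0) (b : E1) (t theta c : R).

Lemma linvK b : linv j (j b) = b.
Proof.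
case: Hj => jinj _ _.
by rewrite /linv pinvKV ?in_setT // => u v _ _; exact: jinj.
Qed.

Lemma K_has_inf t x : 0 < t -> has_inf [set `|x - j b| + t * `|b| | b in [set: E1]].
Proof.
move=> t0; split; first by exists (`|x - j 0| + t * `|0 : E1|); exists 0.
by exists 0 => _ [b _ <-]; rewrite addr_ge0 // mulr_ge0 // ltW.
Qed.

Lemma K_le t x b : 0 < t -> Kfun j t x <= `|x - j b| + t * `|b|.
Proof. by move=> /(K_has_inf t x) [_ h]; apply: ge_inf => //; exists b. Qed.

Lemma K_ge0 t x : 0 < t -> 0 <= Kfun j t x.
Proof.
move=> t0; apply: lb_le_inf; first exact: (K_has_inf t x t0).1.
by move=> _ [b _ <-]; rewrite addr_ge0 // mulr_ge0 // ltW.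
Qed.

Lemma K_adherent t x e : 0 < t -> 0 < e ->
  exists b, `|x - j b| + t * `|b| < Kfun j t x + e.
Proof.
by move=> /(K_has_inf t x) h e0; have [_ [b _ <-] ?] := inf_adherent e0 h; exists b.
Qed.

Lemma K_lin t (a : R) x y : 0 < t ->
  Kfun j t (a *: x + y) <= `|a| * Kfun j t x + Kfun j t y.
Proof.
move=> t0; apply/ler_addgt0Pr => e e0.
have a1 : 0 < `|a| + 1 by have := normr_ge0 a; lra.
have [|b Hb] := K_adherent t x (e / (`|a| + 1)) t0; first by rewrite divr_gt0.
have [b' Hb'] := K_adherent t y (e / (`|a| + 1)) t0 (divr_gt0 e0 a1).
apply: (le_trans (K_le t _ (a *: b + b') t0)).
have -> : a *: x + y - j (a *: b + b') = a *: (x - j b) + (y - j b').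
  by rewrite linearD linearZ /=; modring R.
have h1 := ler_normD (a *: (x - j b)) (y - j b').
have h2 := ler_normD (a *: b) b'.
rewrite !normrZ in h1 h2.
have h3 : t * `|a *: b + b'| <= t * (`|a| * `|b| + `|b'|) by rewrite ler_pM2l.
have e1 : (`|a| + 1) * (e / (`|a| + 1)) = e by rewrite mulrC divfK // gt_eqF.
have h4 : `|a| * (`|x - j b| + t * `|b|) <= `|a| * (Kfun j t x + e / (`|a| + 1)).
  by rewrite ler_wpM2l // ltW.
move: e1 h4 Hb'; set q := e / _; nra.
Qed.

Lemma K_lip t x y : 0 < t -> Kfun j t x <= Kfun j t y + `|x - y|.
Proof.
move=> t0; apply/ler_addgt0Pr => e e0.
have [b Hb] := K_adherent t y e t0 e0.
apply: (le_trans (K_le t _ b t0)).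
have -> : x - j b = (y - j b) + (x - y) by modring R.
by have := ler_normD (y - j b) (x - y); lra.
Qed.

Lemma K_norm t x : 0 < t -> Kfun j t x <= `|x|.
Proof. by move=> t0; have := K_le t x 0 t0; rewrite linear0 subr0 normr0 mulr0 addr0. Qed.

Lemma interp_leP theta x c :
  (interp_enorm j theta x <= c%:E)%E <-> interp_le j theta x c.
Proof.
split=> [/ereal_supP h t t0|h].
  have : ((t `^ (- theta) * Kfun j t x)%:E <= c%:E)%E by apply: h; exists t.
  by rewrite lee_fin powRN mulrC ler_pdivrMr // powR_gt0.
apply/ereal_supP => _ [t /= t0 <-].
by rewrite lee_fin powRN mulrC ler_pdivrMr ?powR_gt0 //; exact: h.
Qed.

Lemma interp_enorm_ge0 theta x : (0 <= interp_enorm j theta x)%E.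
Proof.
apply: le_ereal_sup_tmp; exists ((1 `^ (- theta) * Kfun j 1 x)%:E); first by exists 1 => //=.
by rewrite lee_fin mulr_ge0 ?powR_ge0 // K_ge0.
Qed.

Lemma interp_norm_ge0 theta x : 0 <= interp_norm j theta x.
Proof. exact/fine_ge0/interp_enorm_ge0. Qed.

Lemma interp_le_norm theta x c : interp_le j theta x c -> interp_norm j theta x <= c.
Proof.
move=> /interp_leP h; have h0 := interp_enorm_ge0 theta x.
rewrite -lee_fin /interp_norm fineK // ge0_fin_numE //.
exact: le_lt_trans h (ltry _).
Qed.

Lemma interp_norm_le theta x : (interp_enorm j theta x < +oo)%E ->
  interp_le j theta x (interp_norm j theta x).
Proof.
move=> h; apply/interp_leP; rewrite /interp_norm fineK //.
by rewrite ge0_fin_numE // interp_enorm_ge0.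
Qed.

Lemma interp_le_ge0 theta x c : interp_le j theta x c -> 0 <= c.
Proof. by move=> h; have := h 1 ltr01; rewrite powR1 mulr1; have := K_ge0 1 x ltr01; lra. Qed.

Lemma interp_le_trans theta x c c' : c <= c' -> interp_le j theta x c ->
  interp_le j theta x c'.
Proof.
move=> cc h t t0; apply: (le_trans (h t t0)).
by rewrite ler_wpM2r ?powR_ge0.
Qed.

Lemma interp_le_lin theta (a : R) x y c c' :
  interp_le j theta x c -> interp_le j theta y c' ->
  interp_le j theta (a *: x + y) (`|a| * c + c').
Proof.
move=> hx hy t t0; apply: (le_trans (K_lin t a x y t0)).
rewrite mulrDl lerD //; last exact: hy.
by rewrite -mulrA ler_wpM2l //; exact: hx.
Qed.

Lemma interp_le0 theta c : 0 <= c -> interp_le j theta 0 c.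
Proof.
move=> c0 t t0; apply: (le_trans (K_norm t 0 t0)).
by rewrite normr0 mulr_ge0 ?powR_ge0.
Qed.

Lemma interp_leD theta x y c c' : interp_le j theta x c -> interp_le j theta y c' ->
  interp_le j theta (x + y) (c + c').
Proof.
move=> hx hy; have := interp_le_lin theta 1 x y c c' hx hy.
by rewrite scale1r normr1 mul1r.
Qed.

Lemma interp_leN theta x c : interp_le j theta x c -> interp_le j theta (- x) c.
Proof.
move=> hx; have := interp_le_lin theta (-1) x 0 c 0 hx (interp_le0 theta 0 (lexx _)).
by rewrite addr0 normrN normr1 mul1r addr0 scaleN1r.
Qed.

Lemma interp_le_sym theta x y c : interp_le j theta (x - y) c -> interp_le j theta (y - x) c.
Proof. by move=> h; rewrite -opprB; exact: interp_leN. Qed.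

Lemma j_bounded : exists2 J, 0 < J & forall b, `|j b| <= J * `|b|.
Proof. by case: Hj => _ jc _; exact: continuous_linear_le. Qed.

Lemma interp_embed0 theta : exists2 J, 0 < J &
  forall x c, interp_le j theta x c -> `|x| <= J * c.
Proof.
have [J J0 HJ] := j_bounded; exists (1 + J); first lra.
move=> x c h; apply/ler_addgt0Pr => e e0.
have [|b Hb] := K_adherent 1 x (e / (1 + J)) ltr01; first by rewrite divr_gt0 //; lra.
have -> : x = (x - j b) + j b by modring R.
apply: (le_trans (ler_normD _ _)).
have := h 1 ltr01; rewrite powR1 mulr1 => h1.
have := HJ b; have := normr_ge0 b; have := normr_ge0 (x - j b).
have e1 : (1 + J) * (e / (1 + J)) = e by rewrite mulrC divfK //; lra.
move: e1 Hb; set q := e / _; nra.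
Qed.

Lemma interp_embed1 theta : 0 <= theta <= 1 -> exists2 J, 0 < J &
  forall b, interp_le j theta (j b) (J * `|b|).
Proof.
move=> th; have [J J0 HJ] := j_bounded; exists (1 + J); first lra.
move=> b t t0; have b0 := normr_ge0 b.
have [t1|t1] := leP t 1.
  apply: (le_trans (K_le t _ b t0)); rewrite subrr normr0 add0r.
  have : t <= t `^ theta by apply: ger1_powR; lra.
  have p0 : 0 <= `|b| * t `^ theta by rewrite mulr_ge0 ?powR_ge0.
  by move=> /(ler_wpM2r b0); nra.
apply: (le_trans (K_norm t _ t0)); apply: (le_trans (HJ b)).
have : 1 <= t `^ theta.
  by have := @powR_incr R theta 1 t; rewrite powR1; apply; lra.
have : 0 <= (1 + J) * `|b| by nra.
move=> h0 /(ler_wpM2l h0); nra.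
Qed.

Lemma interp_norm_embed1 theta b : 0 <= theta <= 1 -> 
  (interp_enorm j theta (j b) < +oo)%E.
Proof.
move=> /interp_embed1 [J J0 /(_ b) /interp_leP h].
exact: le_lt_trans h (ltry _).
Qed.

(** The reiteration inequality: [K t x] is both at most [m * t `^ mu] and at
    most [n * t], hence at most the corresponding geometric mean. *)
Lemma interp_ineq (mu g : R) b m n : 0 < mu < 1 -> mu <= g <= 1 ->
  interp_le j mu (j b) m -> `|b| <= n ->
  interp_le j g (j b) (m `^ (1 - (g - mu) / (1 - mu)) * n `^ ((g - mu) / (1 - mu))).
Proof.
move=> mu01 g1 hm hn t t0.
set a := (g - mu) / (1 - mu).
have a01 : 0 <= a <= 1.
  rewrite /a divr_ge0 ?ler_pdivrMr; lra.
have m0 := interp_le_ge0 _ _ _ hm.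
have n0 : 0 <= n by apply: le_trans hn.
have K0 := K_ge0 t (j b) t0.
have k1 := hm t t0.
have k2 : Kfun j t (j b) <= n * t.
  apply: (le_trans (K_le t _ b t0)); rewrite subrr normr0 add0r mulrC.
  by rewrite ler_wpM2r // ltW.
have -> : Kfun j t (j b) = Kfun j t (j b) `^ (1 - a) * Kfun j t (j b) `^ a.
  rewrite -powRD; first by rewrite subrK powRr1.
  by rewrite subrK oner_eq0.
apply: (@le_trans _ _ ((m * t `^ mu) `^ (1 - a) * (n * t) `^ a)).
  by apply: ler_pM; rewrite ?powR_ge0 //; apply: powR_incr => //; lra.
rewrite !powRM ?powR_ge0 // ?(ltW t0) // mulrACA -powRrM -powRD; last first.
  by rewrite (gt_eqF t0) implybT.
have -> // : mu * (1 - a) + a = g.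
by rewrite /a; field; apply/eqP; lra.
Qed.

Lemma cinterpP theta x : cinterp j theta x <->
  (exists c, interp_le j theta x c) /\
  forall e, 0 < e -> exists b, interp_le j theta (x - j b) e.
Proof.
split=> [[h1 h2]|[[c /interp_leP h1] h2]].
  split; first by exists (interp_norm j theta x); exact: interp_norm_le.
  by move=> e /h2 [b /ltW hb]; exists b; exact/interp_leP.
split; first exact: le_lt_trans h1 (ltry _).
move=> e e0; have [|b /interp_leP hb] := h2 (e / 2); first lra.
by exists b; apply: (le_lt_trans hb); rewrite lte_fin; lra.
Qed.

Lemma cinterp_norm theta x : cinterp j theta x ->
  interp_le j theta x (interp_norm j theta x).
Proof. by case=> h _; exact: interp_norm_le. Qed.

Lemma cinterp_j theta b : 0 <= theta <= 1 -> cinterp j theta (j b).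
Proof.
move=> th; split; first exact: interp_norm_embed1.
move=> e e0; exists b; rewrite subrr.
by apply: (@le_lt_trans _ _ 0%:E); [apply/interp_leP/interp_le0|rewrite lte_fin].
Qed.

Lemma cinterp_lin theta (a : R) x y : cinterp j theta x -> cinterp j theta y ->
  cinterp j theta (a *: x + y).
Proof.
move=> /cinterpP [[c1 h1] d1] /cinterpP [[c2 h2] d2]; apply/cinterpP; split.
  by exists (`|a| * c1 + c2); exact: interp_le_lin.
move=> e e0; have a1 : 0 < `|a| + 1 by have := normr_ge0 a; lra.
have q0 : 0 < e / (`|a| + 1) by rewrite divr_gt0.
have [b1 B1] := d1 _ q0; have [b2 B2] := d2 _ q0.
exists (a *: b1 + b2).
have -> : a *: x + y - j (a *: b1 + b2) = a *: (x - j b1) + (y - j b2).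
  by rewrite linearD linearZ /=; modring R.
have := interp_le_lin theta a _ _ _ _ B1 B2.
suff -> : `|a| * (e / (`|a| + 1)) + e / (`|a| + 1) = e by [].
by field; rewrite gt_eqF.
Qed.

Lemma cinterpB theta x y : cinterp j theta x -> cinterp j theta y ->
  cinterp j theta (x - y).
Proof.
move=> hx hy; have -> : x - y = (-1) *: y + x by modring R.
exact: cinterp_lin.
Qed.

Lemma interp_normN theta x : interp_norm j theta (- x) = interp_norm j theta x.
Proof.
have K t : 0 < t -> Kfun j t (- x) = Kfun j t x.
  move=> t0; apply/eqP; rewrite eq_le.
  have K0 : Kfun j t 0 = 0.
    by apply/eqP; rewrite eq_le K_ge0 // -[leRHS](@normr0 _ E0) K_norm.
  have := K_lin t (-1) x 0 t0; have := K_lin t (-1) (- x) 0 t0.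
  by rewrite !addr0 !scaleN1r opprK normrN normr1 !mul1r K0 !addr0 => -> ->.
rewrite /interp_norm /interp_enorm; congr (fine (ereal_sup _)).
by apply/seteqP; split=> _ [t t0 <-]; exists t => //; rewrite K.
Qed.

Lemma interp_normB theta x y : interp_norm j theta (x - y) = interp_norm j theta (y - x).
Proof. by rewrite -interp_normN opprB. Qed.

Lemma interp_normD theta x y : cinterp j theta x -> cinterp j theta y ->
  interp_norm j theta (x + y) <= interp_norm j theta x + interp_norm j theta y.
Proof.
by move=> hx hy; apply/interp_le_norm/interp_leD; exact: cinterp_norm.
Qed.

Lemma interp_dist theta x y z : cinterp j theta x -> cinterp j theta y ->
  cinterp j theta z -> interp_norm j theta (x - z) <=
  interp_norm j theta (x - y) + interp_norm j theta (y - z).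
Proof.
move=> hx hy hz; have -> : x - z = (x - y) + (y - z) by modring R.
by apply: interp_normD; exact: cinterpB.
Qed.

(** The norm is lower semicontinuous with respect to that of [E0], and the
    limit stays in the closure of [E1]: [E_theta] is complete. *)
Lemma cinterp_complete theta (s : nat -> E0) c :
  (forall n, cinterp j theta (s n)) ->
  (forall n, interp_le j theta (s n.+1 - s n) (c / 2 ^+ n)) ->
  exists2 x, cinterp j theta x & forall n, interp_le j theta (x - s n) (2 * c / 2 ^+ n).
Proof.
move=> sc sd; have [J J0 HJ] := interp_embed0 theta.
have [n|x Hx] := geometric_cvg s (J * c).
  by have := HJ _ _ (sd n); rewrite mulrA.
have c0 : 0 <= c.
  by have := interp_le_ge0 _ _ _ (sd 0%N); rewrite expr0 divr1.
have dist n k : interp_le j theta (s (n + k)%N - s n)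
    (2 * c / 2 ^+ n - 2 * c / 2 ^+ (n + k)).
  elim: k => [|k IH]; first by rewrite addn0 !subrr; exact: interp_le0.
  have -> : s (n + k.+1)%N - s n = (s (n + k).+1 - s (n + k)%N) + (s (n + k)%N - s n).
    by rewrite addnS; modring R.
  have := interp_leD _ _ _ _ _ (sd (n + k)%N) IH.
  apply: interp_le_trans; rewrite addnS exprS invfM.
  by set q := (2 ^+ (n + k))^-1; lra.
have lim n : interp_le j theta (x - s n) (2 * c / 2 ^+ n).
  move=> t t0; apply: (@le_geometric _ _ _ (2 * (J * c))) => k.
  apply: (le_trans (K_lip t _ (s (n + k)%N - s n) t0)).
  have -> : x - s n - (s (n + k)%N - s n) = x - s (n + k)%N by modring R.
  apply: lerD.
    apply: (le_trans (dist n k t t0)); rewrite ler_wpM2r ?powR_ge0 //.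
    by rewrite gerBl divr_ge0 ?exprn_ge0 // mulr_ge0.
  apply: (le_trans (Hx _)); rewrite ler_wpM2l //.
    by rewrite !mulr_ge0 // ltW.
  by rewrite lef_pV2 ?posrE ?exprn_gt0 // ler_weXn2l ?ler1n // leq_addl.
exists x => //; apply/cinterpP; split.
  exists (2 * c / 2 ^+ 0 + interp_norm j theta (s 0%N)).
  have -> : x = (x - s 0%N) + s 0%N by modring R.
  by apply: interp_leD => //; exact: cinterp_norm.
move=> e e0; have [|n Hn] := geometric_small (2 * c) (e / 2); first lra.
have [_ /(_ (e / 2)) [|b hb]] := iffLR (cinterpP theta (s n)) (sc n); first lra.
exists b; have -> : x - j b = (x - s n) + (s n - j b) by modring R.
apply: (interp_le_trans _ _ _ _ _ (interp_leD _ _ _ _ _ (lim n) hb)); lra.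
Qed.

End Interp.

(** * The maximal regularity space *)

(** The space of maximal regularity, with the [E1]-valued representative [y] and
    the derivative [d] as data: linear operations act on the triple, whereas
    [linv j] and [ddt] respect them only on the space itself. *)
Definition reg {R : realType} {E0 E1 : completeNormedModType R}
    (j : {linear E1 -> E0}) (mu T : R) (v : R -> E0) (y : R -> E1) (d : R -> E0) :=
  [/\ wcont mu T y, wcont mu T d,
      forall t, 0 < t <= T -> v t = j (y t),
      forall t, 0 < t <= T -> derI T v t (d t) &
      forall e, 0 < e -> exists2 r, 0 < r &
        forall t, 0 < t <= T -> t < r -> `|v t - v 0| <= e].

Section DerivativeFilter.
Context {R : realType} {E : completeNormedModType R}.
Implicit Types (v : R -> E) (T t : R).

Lemma diffq_filter_proper T t : 0 < t <= T -> ProperFilter (diffq_filter T t).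
Proof.
move=> tT; apply: Build_ProperFilter_ex => P.
move=> [d /= d0 H].
pose h := Num.min (d / 2) (t / 2).
have h0 : 0 < h by rewrite lt_min; lra.
have [h1 h2] : h <= d / 2 /\ h <= t / 2 by rewrite !ge_min !lexx orbT.
exists (- h); apply: H => /=; [|by rewrite oppr_eq0 gt_eqF|lra].
by rewrite sub0r opprK gtr0_norm //; lra.
Qed.

Lemma derIP T v t l : 0 < t <= T ->
  derI T v t l <-> diffq v t h @[h --> diffq_filter T t] --> l.
Proof.
move=> tT; have FF := diffq_filter_proper T t tT.
split=> [H|/cvgrPdist_le H].
  apply/cvgrPdist_le => e e0; have [d d0 Hd] := H e e0.
  exists d => //= h; rewrite /= sub0r normrN => hd h0 hT.
  have E1 : t + h - t = h by ring.
  have := Hd (t + h) hT; rewrite E1 => /(_ hd) Hh.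
  have -> : l - diffq v t h = - (h^-1 *: (v (t + h) - v t - h *: l)).
    by rewrite /diffq [in RHS]scalerBr scalerA mulVf // scale1r opprB.
  rewrite normrN normrZ normfV mulrC ler_pdivrMr ?normr_gt0 //.
move=> e e0; have [d /= d0 Hd] := H e e0.
exists d => // s sT st; have [->|nst] := eqVneq s t.
  by rewrite !subrr scale0r subr0 !normr0 mulr0.
have h0 : s - t != 0 by rewrite subr_eq0.
have E1 : t + (s - t) = s by ring.
have := Hd (s - t); rewrite /= sub0r normrN E1 => /(_ st h0 sT).
rewrite /diffq E1 => Hh.
have -> : v s - v t - (s - t) *: l = - ((s - t) *: (l - (s - t)^-1 *: (v s - v t))).
  by rewrite scalerBr scalerA mulfV // scale1r opprB.
by rewrite normrN normrZ mulrC ler_wpM2r.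
Qed.

Lemma derI_ddt T v t l : 0 < t <= T -> derI T v t l -> ddt T v t = l.
Proof.
move=> tT /(derIP _ _ _ _ tT) h; have FF := diffq_filter_proper T t tT.
exact: cvg_lim.
Qed.

End DerivativeFilter.

Section Reg.
Context {R : realType} {E0 E1 : completeNormedModType R} (j : {linear E1 -> E0}).
Context (mu : R) (Hj : banach_couple j) (mu01 : 0 < mu < 1).
Implicit Types (T t c : R) (v w d : R -> E0) (y : R -> E1).

Lemma reg_E1mu T v y d : 0 < T -> reg j mu T v y d ->
  E1mu j mu T v /\
  forall t, 0 < t <= T -> ddt T v t = d t /\ linv j (v t) = y t.
Proof.
move=> T0 [cy cd vy dv v0].
have dE t : 0 < t <= T -> ddt T v t = d t by move=> tT; apply: derI_ddt => //; exact: dv.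
have yE t : 0 < t <= T -> linv j (v t) = y t by move=> tT; rewrite vy // linvK.
have cddt : wcont mu T (ddt T v) by apply: wcont_ext cd => t tT; rewrite dE.
have [J J0 HJ] := j_bounded j Hj.
have cv : wcont mu T v.
  by apply: (wcont_ext _ _ (fun t => j (y t))) => [t tT|]; [rewrite vy|exact: wcont_linear HJ cy].
split=> [|t tT]; last by rewrite dE // yE.
split.
- split; [split|exact/BCwP|exact/BCwP].
  + by apply/contIP => t tT; apply: cv.1.
  + move=> t tT; apply/cvg_ex; exists (d t); apply/(derIP _ _ _ _ tT); exact: dv.
  + by apply/contIP => t tT; apply: cddt.1.
- by move=> t tT; exists (y t) => //; rewrite vy.
- by apply/BCwP => //; apply: wcont_ext cy => t tT; rewrite /= yE.
- apply/cvgrPdist_le => e e0; have [r r0 Hr] := v0 e e0.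
  exists (Num.min r T); first by rewrite /= lt_min r0.
  move=> t /=; rewrite sub0r normrN => tr t0; rewrite distrC.
  by move: tr; rewrite gtr0_norm // lt_min => /andP[t1 t2]; apply: Hr => //; lra.
Qed.

Lemma E1mu_reg T v : 0 < T -> E1mu j mu T v ->
  reg j mu T v (linv j \o v) (ddt T v).
Proof.
move=> T0 [[[_ cvd _] _ /(BCwP _ mu01 _ _ T0) cd] rg /(BCwP _ mu01 _ _ T0) cy v0].
split=> //.
- by move=> t /rg [b _ bE]; rewrite /= -bE (linvK j Hj).
- by move=> t tT; apply/(derIP _ _ _ _ tT); apply: cvd.
- move=> e e0; move/cvgrPdist_le : v0 => /(_ e e0) [r /= r0 H]; exists r => // t tT tr.
  rewrite distrC; apply: H => /=; last lra.
  by rewrite sub0r normrN gtr0_norm //; lra.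
Qed.

Lemma reg_restrict T T' v y d : T' <= T -> reg j mu T v y d -> reg j mu T' v y d.
Proof.
move=> TT [cy cd vy dv v0]; split.
- exact: (@wcont_restrict _ _ _ T).
- exact: (@wcont_restrict _ _ _ T).
- by move=> t tT; apply: vy; lra.
- by move=> t tT; apply: (derI_restrict T) => //; apply: dv; lra.
- by move=> e /v0 [r r0 H]; exists r => // t tT; apply: H; lra.
Qed.

Lemma reg_ext T v y d v' y' d' : reg j mu T v y d ->
  (forall t, 0 <= t <= T -> v t = v' t) ->
  (forall t, 0 < t <= T -> y t = y' t) -> (forall t, 0 < t <= T -> d t = d' t) ->
  reg j mu T v' y' d'.
Proof.
move=> [cy cd vy dv v0] ev ey ed; split.
- exact: wcont_ext cy.
- exact: wcont_ext cd.
- by move=> t tT; rewrite -ev ?vy ?ey //; lra.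
- move=> t tT; rewrite -ed //.
  apply: (@derI_local _ _ T T v v' t _ 1) => //; [apply: ev; lra| |exact: dv].
  by move=> s sT _; split; [lra|apply: ev; lra].
- move=> e e0; have [r r0 H] := v0 e e0; exists r => // t tT tr.
  by rewrite -!ev; [exact: H|lra..].
Qed.

Lemma reg_lin T (a : R) v y d v' y' d' : reg j mu T v y d -> reg j mu T v' y' d' ->
  reg j mu T (fun t => a *: v t + v' t) (fun t => a *: y t + y' t)
    (fun t => a *: d t + d' t).
Proof.
move=> [cy cd vy dv v0] [cy' cd' vy' dv' v0']; split.
- exact: wcont_lin.
- exact: wcont_lin.
- by move=> t tT; rewrite linearD linearZ /= vy // vy'.
- by move=> t tT; apply: derI_lin; [exact: dv|exact: dv'].
- move=> e e0.
  have a1 : 0 < `|a| + 1 by have := normr_ge0 a; lra.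
  have [|d1 d10 H1] := v0 (e / 2 / (`|a| + 1)); first by rewrite divr_gt0 //; lra.
  have [|d2 d20 H2] := v0' (e / 2); first lra.
  exists (Num.min d1 d2); first by rewrite lt_min d10.
  move=> s sT; rewrite lt_min => /andP[/(H1 s sT) h1 /(H2 s sT) h2].
  have -> : a *: v s + v' s - (a *: v 0 + v' 0) = a *: (v s - v 0) + (v' s - v' 0).
    by modring R.
  apply: (le_trans (ler_normD _ _)); rewrite normrZ.
  move: h1; rewrite ler_pdivlMr // => h1.
  have := normr_ge0 (v s - v 0); nra.
Qed.

Lemma regB T v y d v' y' d' : reg j mu T v y d -> reg j mu T v' y' d' ->
  reg j mu T (fun t => v t - v' t) (fun t => y t - y' t) (fun t => d t - d' t).
Proof.
move=> h h'; have := reg_lin T (-1) _ _ _ _ _ _ h' h.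
by move/reg_ext; apply=> t _; modring R.
Qed.

Lemma reg_shift T v y d s : 0 < s < T -> reg j mu T v y d ->
  reg j mu (T - s) (fun t => v (s + t)) (fun t => y (s + t)) (fun t => d (s + t)).
Proof.
move=> sT [cy cd vy dv v0]; split.
- exact: wcont_shift.
- exact: wcont_shift.
- by move=> t tT; apply: vy; lra.
- by move=> t tT; apply: derI_shift; [lra|apply: dv; lra].
- move=> e e0; have [|r r0 H] := derI_contI _ _ _ _ (dv s _) e e0; first lra.
  exists r => // t tT tr; rewrite addr0; apply: H; first lra.
  by rewrite addrC addKr gtr0_norm //; lra.
Qed.

Lemma reg_cst T b : reg j mu T (fun=> j b) (fun=> b) (fun=> 0).
Proof.
split=> //; [exact: wcont_cst|exact: wcont_cst| |].
- move=> t tT e e0; exists 1 => // s _ _.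
  by rewrite subrr scaler0 subr0 normr0 mulr_ge0 // ltW.
- by move=> e e0; exists 1 => // t _ _; rewrite subrr normr0 ltW.
Qed.

(** A derivative of size [t `^ (mu - 1)] is integrable at 0. *)
Lemma reg_dist0 T v y d c t : reg j mu T v y d -> wbound mu T d c ->
  0 <= t <= T -> `|v t - v 0| <= c / mu * t `^ mu.
Proof.
move=> [_ _ _ dv v0] dc tT.
have mu0 : 0 < mu by case/andP: mu01.
have [->|tn] := eqVneq t 0; first by rewrite subrr normr0 powR0 ?gt_eqF // mulr0.
have t0 : 0 < t by rewrite lt_neqAle eq_sym tn; lra.
apply/ler_addgt0Pr => e e0; have [r r0 Hr] := v0 e e0.
pose s := Num.min (r / 2) t.
have s0 : 0 < s by rewrite lt_min; lra.
have [sr st] : s <= r / 2 /\ s <= t by rewrite !ge_min !lexx orbT.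
have c0 : 0 <= c.
  by apply: le_trans (dc t _); [rewrite mulr_ge0 ?powR_ge0|lra].
have h1 : `|v t - v s| <= c / mu * (t `^ mu - s `^ mu).
  apply: (@mvi_weight _ _ mu T v d) => //; [lra| |].
    by move=> q qq; apply: dv; lra.
  by move=> q qq; apply: dc; lra.
have h2 : `|v s - v 0| <= e by apply: Hr; lra.
have -> : v t - v 0 = (v t - v s) + (v s - v 0) by modring R.
apply: (le_trans (ler_normD _ _)).
have := powR_ge0 s mu; have := divr_ge0 c0 (ltW mu0); nra.
Qed.

(** The trace estimate. For [s <= t] split [v 0 - v t] at [v s]: the part
    [v s - v t] lies in [E1], with norm of order [s `^ (mu - 1)], and the part
    [v 0 - v s] is of order [s `^ mu] in [E0]. *)
Lemma reg_trace T v y d c t : 0 < T -> reg j mu T v y d -> wbound mu T y c ->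
  wbound mu T d c -> 0 <= t <= T -> interp_le j mu (v t - v 0) ((2 + mu^-1) * c).
Proof.
move=> T0 rv yc dc tT; have /andP[mu0' mu1'] := mu01.
have mu0 : 0 < mu by case/andP: mu01.
have c0 : 0 <= c.
  by apply: le_trans (dc T _); [rewrite mulr_ge0 ?powR_ge0|lra].
have mi : 0 < mu^-1 by rewrite invr_gt0.
have [->|tn] := eqVneq t 0.
  by rewrite subrr; apply: (interp_le0 j); rewrite mulr_ge0 //; lra.
have t0 : 0 < t by rewrite lt_neqAle eq_sym tn; lra.
apply: (interp_le_sym j) => s s0.
have smu : 0 < s `^ mu by rewrite powR_gt0.
have [st|ts] := leP s t; last first.
  apply: (le_trans (K_norm j s _ s0)); rewrite distrC.
  apply: (le_trans (reg_dist0 _ _ _ _ _ _ rv dc tT)).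
  have : t `^ mu <= s `^ mu by apply: powR_incr; lra.
  move=> /(ler_wpM2l (mulr_ge0 c0 (ltW mi))) h; apply: (le_trans h).
  by rewrite ler_wpM2r ?powR_ge0 //; nra.
have sT : 0 < s <= T by lra.
have [_ _ vy _ _] := rv.
apply: (le_trans (K_le j s _ (y s - y t) s0)).
have -> : v 0 - v t - j (y s - y t) = - (v s - v 0).
  by rewrite linearB /= -!vy //; [modring R|lra].
rewrite normrN.
have h1 : `|v s - v 0| <= c / mu * s `^ mu by apply: (reg_dist0 _ _ _ _ _ _ rv dc); lra.
have yb r : s <= r -> r <= T -> s * `|y r| <= c * s `^ mu.
  move=> sr rT; have := yc r (ltac:(lra)) => h.
  have h2 : s `^ (1 - mu) * `|y r| <= c.
    by apply: le_trans h; rewrite ler_wpM2r //; apply: powR_incr; lra.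
  have -> : s * `|y r| = s `^ mu * (s `^ (1 - mu) * `|y r|).
    rewrite mulrA -powRD; last by rewrite (gt_eqF s0) implybT.
    by rewrite addrC subrK powRr1 // ltW.
  by rewrite mulrC ler_wpM2r // ltW.
have h2 := yb s (lexx _) (ltac:(lra)).
have h3 := yb t st (ltac:(lra)).
have h4 : s * `|y s - y t| <= s * (`|y s| + `|y t|) by rewrite ler_pM2l // ler_normB.
move: h1 h4; rewrite mulrDr !mulrDl mulrAC; lra.
Qed.

Lemma reg_cinterp T v y d t : 0 < T -> reg j mu T v y d -> 0 <= t <= T ->
  cinterp j mu (v t).
Proof.
have /andP[mu0' mu1'] := mu01.
move=> T0 rv tT; have [cy cd vy _ _] := rv.
have mu1 : 0 <= mu <= 1 by case/andP: mu01 => /ltW -> /ltW ->.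
have [t0|tn] := ltP 0 t; first by rewrite vy; [exact: cinterp_j|lra].
have -> : t = 0 by lra.
have mi : 0 < mu^-1 by rewrite invr_gt0; case/andP: mu01.
have key e : 0 < e -> exists b, interp_le j mu (v 0 - j b) e.
  move=> e0; have k0 : 0 < e / (2 + mu^-1) by rewrite divr_gt0 // addr_gt0.
  have [d1 d10 H1] := cy.2 _ k0; have [d2 d20 H2] := cd.2 _ k0.
  pose s := Num.min T (Num.min (d1 / 2) (d2 / 2)).
  have s0 : 0 < s by rewrite !lt_min; lra.
  have [sT [s1 s2]] : s <= T /\ s <= d1 / 2 /\ s <= d2 / 2.
    by rewrite !ge_min !lexx !orbT.
  exists (y s); rewrite -vy; last lra.
  apply: (interp_le_sym j).
  have -> : e = (2 + mu^-1) * (e / (2 + mu^-1)) by rewrite mulrC divfK //; lra.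
  apply: (reg_trace s v y d) => //.
  + exact: (reg_restrict T).
  + by move=> r rs; apply: H1; lra.
  + by move=> r rs; apply: H2; lra.
  + lra.
apply/(cinterpP j); split=> //; have [b hb] := key 1 ltr01.
have [J J0 HJ] := interp_embed1 j Hj mu mu1.
exists (1 + J * `|b|); have -> : v 0 = (v 0 - j b) + j b by modring R.
exact: (interp_leD j).
Qed.

(** Continuity at 0 is the trace estimate on short intervals, continuity
    elsewhere comes from the continuity with values in [E1]. *)
Lemma reg_interp_cont T v y d t e : 0 < T -> reg j mu T v y d -> 0 <= t <= T ->
  0 < e -> exists2 r, 0 < r & forall s, 0 <= s <= T -> `|s - t| < r ->
    interp_le j mu (v s - v t) e.
Proof.
have /andP[mu0' mu1'] := mu01.
move=> T0 rv tT e0; have [cy cd vy _ _] := rv.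
have mu1 : 0 <= mu <= 1 by case/andP: mu01 => /ltW -> /ltW ->.
have mi : 0 < mu^-1 by rewrite invr_gt0; case/andP: mu01.
have [t0|tn] := ltP 0 t; last first.
  have -> : t = 0 by lra.
  have k0 : 0 < e / (2 + mu^-1) by rewrite divr_gt0 // addr_gt0.
  have [d1 d10 H1] := cy.2 _ k0; have [d2 d20 H2] := cd.2 _ k0.
  pose s := Num.min T (Num.min (d1 / 2) (d2 / 2)).
  have s0 : 0 < s by rewrite !lt_min; lra.
  have [sT [s1 s2]] : s <= T /\ s <= d1 / 2 /\ s <= d2 / 2.
    by rewrite !ge_min !lexx !orbT.
  exists s => // r rT; rewrite subr0 ltr_norml => rs.
  have -> : e = (2 + mu^-1) * (e / (2 + mu^-1)) by rewrite mulrC divfK //; lra.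
  apply: (reg_trace s v y d) => //.
  + exact: (reg_restrict T).
  + by move=> q qs; apply: H1; lra.
  + by move=> q qs; apply: H2; lra.
  + lra.
have [J J0 HJ] := interp_embed1 j Hj mu mu1.
have [||r r0 Hr] := cy.1 t _ (e / J); [lra|by rewrite divr_gt0|].
exists (Num.min r t); first by rewrite lt_min r0.
move=> s sT; rewrite lt_min !ltr_norml => /andP[sr st].
rewrite !vy; [|lra..]; rewrite -linearB.
apply: (interp_le_trans j _ _ _ _ _ (HJ _)).
rewrite mulrC -ler_pdivlMr //; apply: Hr; first lra.
by rewrite ltr_norml.
Qed.

End Reg.

(** * Countably subadditive seminorms *)

(** [Q x c] and [P x c] stand for bounds by [c] on a complete norm and on a
    seminorm of [x]; working with the bounds makes it possible to use norms
    that are only defined on a subspace of the ambient module. *)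
Section Zabreiko.
Context {R : realType} {L : lmodType R} (Q P : L -> R -> Prop).
Context (Q_le : forall x c c', c <= c' -> Q x c -> Q x c')
  (Q_lin : forall (a : R) x y c c', Q x c -> Q y c' -> Q (a *: x + y) (`|a| * c + c'))
  (Q_zero : Q 0 0)
  (Q_complete : forall (s : nat -> L) c, Q (s 0%N) c ->
     (forall n, Q (s n.+1 - s n) (c / 2 ^+ n)) ->
     exists x, forall n, Q (x - s n) (2 * c / 2 ^+ n)).
Context (P_ge0 : forall x c, P x c -> 0 <= c)
  (P_lin : forall (a : R) x y c c', P x c -> P y c' -> P (a *: x + y) (`|a| * c + c'))
  (P_zero : P 0 0)
  (P_total : forall x c, Q x c -> exists d, P x d)
  (P_le : forall x c c', c <= c' -> P x c -> P x c')
  (P_sigma : forall (s : nat -> L) x c d, s 0%N = 0 ->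
     (forall n, P (s n.+1 - s n) (c / 2 ^+ n)) ->
     (forall n, Q (x - s n) (d / 2 ^+ n)) -> P x (2 * c)).

Let QD x y c c' : Q x c -> Q y c' -> Q (x + y) (c + c').
Proof. by move=> hx hy; have := Q_lin 1 _ _ _ _ hx hy; rewrite scale1r normr1 mul1r. Qed.

Let QZ (a : R) x c : Q x c -> Q (a *: x) (`|a| * c).
Proof. by move=> hx; have := Q_lin a _ _ _ _ hx Q_zero; rewrite !addr0. Qed.

Let PZ (a : R) x c : P x c -> P (a *: x) (`|a| * c).
Proof. by move=> hx; have := P_lin a _ _ _ _ hx P_zero; rewrite !addr0. Qed.

Let QB x y c c' : Q x c -> Q y c' -> Q (x - y) (c + c').
Proof.
move=> hx hy; have := Q_lin (-1) _ _ _ _ hy hx.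
by rewrite scaleN1r normrN normr1 mul1r [c + c']addrC [- y + x]addrC.
Qed.

Let PB x y c c' : P x c -> P y c' -> P (x - y) (c + c').
Proof.
move=> hx hy; have := P_lin (-1) _ _ _ _ hy hx.
by rewrite scaleN1r normrN normr1 mul1r [c + c']addrC [- y + x]addrC.
Qed.

(** The Baire category argument: otherwise one could choose nested balls, the
    n-th one avoiding [P _ n], and the seminorm would be infinite at their
    common point. *)
Lemma somewhere_dense : exists (a : L) (r : R) (n : nat), 0 < r /\
  forall y, Q (y - a) r -> forall e, 0 < e -> exists2 z, Q (y - z) e & P z n%:R.
Proof.
apply: contrapT => H.
have step (b : nat * (L * R)) : {b' : L * R | 0 < b.2.2 ->
    [/\ 0 < b'.2, b'.2 <= b.2.2 / 2, Q (b'.1 - b.2.1) (b.2.2 / 4) &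
        forall z, Q (z - b'.1) b'.2 -> ~ P z b.1%:R]}.
  apply: cid; case: b => n [a r] /=.
  have [r0|_] := ltP 0 r; last by exists (a, r).
  suff [y [Qy [e [e0 He]]]] : exists y, Q (y - a) (r / 4) /\ exists e, 0 < e /\
      forall z, Q (y - z) e -> ~ P z n%:R.
    exists (y, Num.min e (r / 2)) => _ /=; split=> //.
    - by rewrite lt_min e0; lra.
    - by rewrite ge_min lexx orbT.
    - move=> z Qz; apply: He; rewrite -opprB -scaleN1r.
      have := QZ (-1) _ _ Qz; rewrite normrN normr1 mul1r.
      by apply: Q_le; rewrite ge_min lexx.
  apply: contrapT => H'; apply: H; exists a, (r / 4), n; split; first lra.
  move=> y Qy e e0; apply: contrapT => H2; apply: H'; exists y; split=> //.
  by exists e; split=> // z Qz Pz; apply: H2; exists z.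
pose ball := fix ball n : L * R :=
  if n is n'.+1 then projT1 (step (n', ball n')) else (0, 1 : R).
have ball0 n : 0 < (ball n).2.
  elim: n => [|n IH] /=; first exact: ltr01.
  by have [] := projT2 (step (n, ball n)) IH.
have ballS n : [/\ (ball n.+1).2 <= (ball n).2 / 2,
    Q ((ball n.+1).1 - (ball n).1) ((ball n).2 / 4) &
    forall z, Q (z - (ball n.+1).1) (ball n.+1).2 -> ~ P z n%:R].
  by have [] := projT2 (step (n, ball n)) (ball0 n).
have radius n k : (ball (n + k)%N).2 <= (ball n).2 / 2 ^+ k.
  elim: k => [|k IH]; first by rewrite addn0 expr0 divr1.
  rewrite addnS; have [h _ _] := ballS (n + k)%N; apply: (le_trans h).
  by rewrite exprS invfM; move: IH; set q := (2 ^+ k)^-1; lra.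
have r1 n : (ball n).2 <= 1 / 2 ^+ n by have := radius 0%N n; rewrite add0n.
have [||x Hx] := Q_complete (fun n => (ball n).1) (1 / 4).
- by apply: (Q_le _ 0) => /=; [lra|exact: Q_zero].
- move=> n; have [_ h _] := ballS n; apply: Q_le h.
  by have := r1 n; set q := (2 ^+ n)^-1; lra.
have inball n : Q (x - (ball n).1) (ball n).2.
  have dist k : Q ((ball (n + k)%N).1 - (ball n).1)
      ((ball n).2 / 2 - (ball n).2 / 2 / 2 ^+ k).
    elim: k => [|k IH]; first by rewrite addn0 expr0 divr1 !subrr.
    have [_ h _] := ballS (n + k)%N.
    have := QD _ _ _ _ h IH; rewrite addnS.
    have -> : (ball (n + k).+1).1 - (ball (n + k)%N).1 +
      ((ball (n + k)%N).1 - (ball n).1) = (ball (n + k).+1).1 - (ball n).1.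
      by rewrite addrA subrK.
    apply: Q_le; have := radius n k; rewrite exprS invfM.
    by set q := (2 ^+ k)^-1; lra.
  have [|k Hk] := geometric_small (1 / 2) ((ball n).2 / 2).
    by have := ball0 n; lra.
  have -> : x - (ball n).1 = (x - (ball (n + k)%N).1) + ((ball (n + k)%N).1 - (ball n).1).
    by rewrite addrA subrK.
  apply: Q_le (QD _ _ _ _ (Hx (n + k)%N) (dist k)).
  have i0 : 0 <= (2 ^+ k)^-1 :> R by rewrite invr_ge0 exprn_ge0.
  have i1 : (2 ^+ (n + k))^-1 <= (2 ^+ k)^-1 :> R.
    by rewrite lef_pV2 ?posrE ?exprn_gt0 // ler_weXn2l ?ler1n // leq_addl.
  have := mulr_ge0 (ltW (ball0 n)) i0.
  by move: Hk; set q := (2 ^+ k)^-1 in i0 i1 *; set p := (2 ^+ (n + k))^-1 in i1 *; lra.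
have [|c Pc] := P_total x 1.
  by have := inball 0%N; rewrite /= subr0.
have [n Hn] : exists n : nat, c <= n%:R.
  by exists (Num.bound c); apply/ltW/Num.Theory.archi_boundP/(P_ge0 x).
have [_ _ h] := ballS n.
by apply: (h x (inball n.+1)); apply: P_le Pc.
Qed.

(** By translation and scaling the density statement holds around every point
    at every scale; approximating the successive remainders writes [x] as a
    series whose terms have geometrically small seminorms. *)
Lemma countably_subadditive_bounded :
  exists2 M, 0 < M & forall x c, 0 < c -> Q x c -> P x (M * c).
Proof.
have [a [r [n [r0 H]]]] := somewhere_dense.
pose K := 2 * n%:R / r.
have K0 : 0 <= K by rewrite /K divr_ge0 ?mulr_ge0 ?ler0n // ltW.
have dense0 y e : Q y r -> 0 < e -> exists2 z, Q (y - z) e & P z (2 * n%:R).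
  move=> Qy e0; have [||z1 Qz1 Pz1] := H (a + y) _ (e / 2); [by rewrite addrC addKr|lra|].
  have [||z2 Qz2 Pz2] := H a _ (e / 2);
    [by rewrite subrr; apply: Q_le Q_zero; exact: ltW|lra|].
  exists (z1 - z2); last by have := PB _ _ _ _ Pz1 Pz2; congr (P _ _); ring.
  have := QB _ _ _ _ Qz1 Qz2.
  have -> : a + y - z1 - (a - z2) = y - (z1 - z2) by modring R.
  by congr (Q _ _); lra.
have dense y c e : 0 < c -> 0 < e -> Q y c -> exists2 z, Q (y - z) e & P z (K * c).
  move=> c0 e0 Qy.
  have rc : 0 < r / c by rewrite divr_gt0.
  have cr : 0 < c / r by rewrite divr_gt0.
  have [||z Qz Pz] := dense0 ((r / c) *: y) (r / c * e).
  - have := QZ (r / c) _ _ Qy; rewrite gtr0_norm // divfK ?gt_eqF //.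
  - by rewrite mulr_gt0.
  exists ((c / r) *: z).
    have := QZ (c / r) _ _ Qz; rewrite gtr0_norm // scalerBr scalerA.
    have -> : c / r * (r / c) = 1 by field; rewrite !gt_eqF.
    rewrite scale1r; congr (Q _ _); field; rewrite !gt_eqF //.
  have := PZ (c / r) _ _ Pz; rewrite gtr0_norm //.
  by congr (P _ _); rewrite /K; field; rewrite gt_eqF.
exists (2 * (K + 1)) => [|x c c0 Qx]; first lra.
have next (b : nat * L) : {z : L | Q b.2 (c / 2 ^+ b.1) ->
    Q (b.2 - z) (c / 2 ^+ b.1.+1) /\ P z (K * (c / 2 ^+ b.1))}.
  apply: cid; case: b => k y /=; have [Qy|?] := pselect (Q y (c / 2 ^+ k)); last by exists 0.
  have [||z Qz Pz] := dense y (c / 2 ^+ k) (c / 2 ^+ k.+1) _ _ Qy.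
  - by rewrite divr_gt0 ?exprn_gt0.
  - by rewrite divr_gt0 ?exprn_gt0.
  by exists z.
pose rem := fix rem k : L :=
  if k is k'.+1 then rem k' - projT1 (next (k', rem k')) else x.
have Qrem k : Q (rem k) (c / 2 ^+ k).
  elim: k => [|k IH]; first by rewrite expr0 divr1.
  by have [] := projT2 (next (k, rem k)) IH.
have Prem k : P (rem k - rem k.+1) (K * (c / 2 ^+ k)).
  have [_ h] := projT2 (next (k, rem k)) (Qrem k).
  by rewrite /= opprB addrCA subrr addr0.
have := P_sigma (fun k => x - rem k) x (K * c) c; rewrite /= subrr => h.
apply: (P_le _ (2 * (K * c))); first nra.
apply: h => // k.
  have -> : x - (rem k - projT1 (next (k, rem k))) - (x - rem k) = rem k - rem k.+1.
    by rewrite /=; modring R.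
  by rewrite -mulrA; exact: Prem.
by have -> : x - (x - rem k) = rem k by modring R.
Qed.

End Zabreiko.

(** * The linear problem *)

Definition linsol {R : realType} {E0 E1 : completeNormedModType R}
    (j : {linear E1 -> E0}) (mu T : R) (B : E1 -> E0) (f : R -> E0) (x : E0)
    (v : R -> E0) (y : R -> E1) (d : R -> E0) :=
  [/\ reg j mu T v y d, v 0 = x & forall t, 0 < t <= T -> d t + B (y t) = f t].

Section Linear.
Context {R : realType} {E0 E1 : completeNormedModType R} (j : {linear E1 -> E0}).
Context (mu : R) (Hj : banach_couple j) (mu01 : 0 < mu < 1).
Implicit Types (T t c : R) (v w d : R -> E0) (y : R -> E1).

(** The maximal regularity space is complete, and the trace at 0 and the
    derivative pass to the limit. *)
Lemma reg_complete T c c' x (U : nat -> R -> E0) (y : nat -> R -> E1)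
    (d : nat -> R -> E0) : 0 < T ->
  (forall n, reg j mu T (U n) (y n) (d n)) ->
  (forall n, wbound mu T (fun t => y n.+1 t - y n t) (c / 2 ^+ n)) ->
  (forall n, wbound mu T (fun t => d n.+1 t - d n t) (c / 2 ^+ n)) ->
  (forall n, `|x - U n 0| <= c' / 2 ^+ n) ->
  exists v y' d', [/\ reg j mu T v y' d', v 0 = x,
    forall n, wbound mu T (fun t => y' t - y n t) (2 * c / 2 ^+ n) &
    forall n, wbound mu T (fun t => d' t - d n t) (2 * c / 2 ^+ n)].
Proof.
have /andP[mu0 mu1] := mu01 => T0 rU yb db x0.
have [|y' cy' yb'] := wcont_complete mu mu01 T c y _ yb.
  by move=> n; have [] := rU n.
have [|d' cd' db'] := wcont_complete mu mu01 T c d _ db.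
  by move=> n; have [] := rU n.
pose v t := if t == 0 then x else j (y' t).
have vE t : 0 < t <= T -> v t = j (y' t).
  by move=> /andP[t0 _]; rewrite /v gt_eqF.
have v0 : v 0 = x by rewrite /v eqxx.
clearbody v.
have c0 : 0 <= c.
  have h := yb 0%N T; rewrite expr0 divr1 T0 lexx in h.
  by apply: le_trans (h isT); rewrite mulr_ge0 ?powR_ge0.
have half n k : (2 ^+ (n + k))^-1 <= (2 ^+ n)^-1 :> R /\ (2 ^+ (n + k))^-1 <= (2 ^+ k)^-1 :> R.
  by split; rewrite lef_pV2 ?posrE ?exprn_gt0 // ler_weXn2l ?ler1n // ?leq_addl ?leq_addr.
have dd n k : wbound mu T (fun t => d (n + k)%N t - d n t) (4 * c / 2 ^+ n).
  have := wboundB mu T _ _ _ _ (db' n) (db' (n + k)%N) => h.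
  apply: (wbound_le mu T _ (2 * c / 2 ^+ n + 2 * c / 2 ^+ (n + k))).
    have [h1 _] := half n k; have := ler_wpM2l c0 h1.
    by set q := _^-1; set p := _^-1; lra.
  by move: h; apply: wbound_ext => t _; modring R.
have [J J0 HJ] := j_bounded j Hj.
have rUU n k : reg j mu T (fun t => U (n + k)%N t - U n t)
   (fun t => y (n + k)%N t - y n t) (fun t => d (n + k)%N t - d n t).
  by apply: regB.
have vlim t m : 0 < t <= T -> `|v t - U m t| <= J * (t `^ (1 - mu))^-1 * (2 * c) / 2 ^+ m.
  move=> tT; rewrite (vE t tT); have [_ _ /(_ t tT) -> _ _] := rU m; rewrite -linearB.
  apply: (le_trans (HJ _)); rewrite -!mulrA ler_pM2l // [leRHS]mulrC ler_pdivlMr ?powR_gt0 //.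
    by have := yb' m t tT; rewrite mulrC -mulrA.
  by case/andP: tT.
have vder t : 0 < t <= T -> derI T v t (d' t).
  move=> tT e e0; have t0 : 0 < t / 2 by lra.
  have q0 : 0 < (t / 2) `^ (1 - mu) by rewrite powR_gt0.
  have [|n Hn] := geometric_small (4 * c / (t / 2) `^ (1 - mu)) (e / 3); first lra.
  have [_ _ _ /(_ t tT) dU _] := rU n.
  have [|r r0 Hr] := dU (e / 3); first lra.
  exists (Num.min r (t / 2)); first by rewrite lt_min r0.
  move=> s sT; rewrite lt_min => /andP[/(Hr s sT) h1]; rewrite ltr_norml => h2.
  have wt a b s' : t / 2 <= s' -> s' <= T -> s' `^ (1 - mu) * a <= b -> 0 <= a ->
      a <= b / (t / 2) `^ (1 - mu).
    move=> ts sT' h a0; rewrite ler_pdivlMr //; apply: le_trans h.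
    by rewrite mulrC ler_wpM2r //; apply: powR_incr; lra.
  have diff k : `|(U (n + k)%N s - U n s) - (U (n + k)%N t - U n t)| <=
      4 * c / 2 ^+ n / (t / 2) `^ (1 - mu) * `|s - t|.
    have mv s1 s2 : t / 2 <= s1 -> s1 <= s2 -> s2 <= T ->
      `|(U (n + k)%N s2 - U n s2) - (U (n + k)%N s1 - U n s1)| <=
      4 * c / 2 ^+ n / (t / 2) `^ (1 - mu) * (s2 - s1).
      move=> *; have [_ _ _ dUU _] := rUU n k.
      apply: (@mvi _ _ T (fun t => U (n + k)%N t - U n t) (fun t => d (n + k)%N t - d n t)) => //; [lra| |].
        by move=> q qs; apply: dUU; lra.
      move=> q qs; apply: (wt _ _ q) => //; [lra|lra|].
      by apply: dd; lra.
    have [st|ts] := leP s t.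
      have -> : `|s - t| = t - s by rewrite ler0_norm ?subr_le0 // opprB.
      by rewrite distrC; apply: mv; lra.
    by rewrite gtr0_norm ?subr_gt0 //; apply: mv; lra.
  have key : `|(v s - U n s) - (v t - U n t)| <=
      4 * c / 2 ^+ n / (t / 2) `^ (1 - mu) * `|s - t|.
    apply: (@le_geometric _ _ _ (J * (s `^ (1 - mu))^-1 * (2 * c) + J * (t `^ (1 - mu))^-1 * (2 * c))) => k.
    have -> : v s - U n s - (v t - U n t) =
      (v s - U (n + k)%N s) - (v t - U (n + k)%N t) +
      ((U (n + k)%N s - U n s) - (U (n + k)%N t - U n t)) by modring R.
    apply: (le_trans (ler_normD _ _)); rewrite addrC lerD //.
    apply: (le_trans (ler_normB _ _)); rewrite mulrDl.
    have bd r' : 0 < r' <= T -> `|v r' - U (n + k)%N r'| <=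
        J * (r' `^ (1 - mu))^-1 * (2 * c) / 2 ^+ k.
      move=> r'T; apply: (le_trans (vlim r' (n + k)%N r'T)).
      rewrite ler_wpM2l //; last by have [] := half n k.
      by rewrite !mulr_ge0 // ?invr_ge0 ?powR_ge0 // ltW.
    by rewrite lerD // bd.
  have hd : `|d n t - d' t| <= 2 * c / 2 ^+ n / (t / 2) `^ (1 - mu).
    rewrite distrC; apply: (wt _ _ t) => //; [lra|lra|]; exact: db'.
  have -> : v s - v t - (s - t) *: d' t =
     ((v s - U n s) - (v t - U n t)) + (U n s - U n t - (s - t) *: d n t)
     + (s - t) *: (d n t - d' t) by modring R.
  apply: (le_trans (ler_normD _ _)); rewrite normrZ.
  have h3 := ler_normD (v s - U n s - (v t - U n t)) (U n s - U n t - (s - t) *: d n t).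
  have st0 := normr_ge0 (s - t).
  have h4 := ler_wpM2l st0 hd.
  move: Hn key h4; rewrite mulrAC [2 * c / _ / _]mulrAC.
  rewrite [4 * c / 2 ^+ n / _]mulrAC; set z := _ / (t / 2) `^ _ / 2 ^+ n => Hn key h4.
  have e4 : 2 * c / (t / 2) `^ (1 - mu) / 2 ^+ n = z / 2.
    by rewrite /z; field; rewrite !gt_eqF ?exprn_gt0.
  rewrite e4 in h4.
  have z0 := ler_wpM2r st0 Hn.
  have zz : 0 <= z by rewrite /z !divr_ge0 ?mulr_ge0 ?exprn_ge0 // ltW.
  have := mulr_ge0 zz st0; lra.
have vzero e : 0 < e -> exists2 r, 0 < r &
    forall t, 0 < t <= T -> t < r -> `|v t - v 0| <= e.
  move=> e0; rewrite v0.
  have [|n Hn] := geometric_small (4 * c / mu * T `^ mu) (e / 2); first lra.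
  have [_ _ _ _ cU] := rU n.
  have [|r r0 Hr] := cU (e / 2); first lra.
  exists r => // t tT tr.
  have key : `|(v t - U n t) - (x - U n 0)| <= 4 * c / 2 ^+ n / mu * T `^ mu.
    apply: (@le_geometric _ _ _ (J * (t `^ (1 - mu))^-1 * (2 * c) + `|c'|)) => k.
    have -> : v t - U n t - (x - U n 0) =
      (v t - U (n + k)%N t) - (x - U (n + k)%N 0) +
      ((U (n + k)%N t - U n t) - (U (n + k)%N 0 - U n 0)) by modring R.
    apply: (le_trans (ler_normD _ _)); rewrite addrC lerD //.
      have := reg_dist0 j mu mu01 T _ _ _ _ t (rUU n k) (dd n k) => /(_ _) h.
      apply: (le_trans (h _)); first lra.
      rewrite ler_wpM2l //; last by apply: powR_incr; lra.
      by rewrite !mulr_ge0 ?invr_ge0 ?exprn_ge0 // ltW.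
    apply: (le_trans (ler_normB _ _)); rewrite mulrDl lerD //.
      apply: (le_trans (vlim t (n + k)%N tT)); rewrite ler_wpM2l //; last by have [] := half n k.
      by rewrite !mulr_ge0 // ?invr_ge0 ?powR_ge0 // ltW.
    apply: (le_trans (x0 (n + k)%N)); apply: (@le_trans _ _ (`|c'| / 2 ^+ (n + k))).
      by rewrite ler_wpM2r ?invr_ge0 ?exprn_ge0 // ler_norm.
    by rewrite ler_wpM2l //; have [] := half n k.
  have -> : v t - x = ((v t - U n t) - (x - U n 0)) + (U n t - U n 0) by modring R.
  apply: (le_trans (ler_normD _ _)); have := Hr t tT tr.
  have e1 : 4 * c / 2 ^+ n / mu * T `^ mu = 4 * c / mu * T `^ mu / 2 ^+ n.
    by field; rewrite !gt_eqF ?exprn_gt0.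
  rewrite e1 in key; lra.
by exists v, y', d'; split=> //; split.
Qed.

End Linear.

Section LinearBounded.
Context {R : realType} {E0 E1 : completeNormedModType R} (j : {linear E1 -> E0}).
Context (mu : R) (Hj : banach_couple j) (mu01 : 0 < mu < 1).
Context (T : R) (T0 : 0 < T) (B : {linear E1 -> E0}) (Bc : continuous B).
Implicit Types (t c : R) (v w d f : R -> E0) (y : R -> E1).

Lemma linsol_lin S (a : R) f f' x x' v y d v' y' d' :
  linsol j mu S B f x v y d -> linsol j mu S B f' x' v' y' d' ->
  linsol j mu S B (fun t => a *: f t + f' t) (a *: x + x')
    (fun t => a *: v t + v' t) (fun t => a *: y t + y' t) (fun t => a *: d t + d' t).
Proof.
move=> [r1 e1 q1] [r2 e2 q2]; split; [exact: reg_lin|by rewrite e1 e2|].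
by move=> t tT; rewrite -q1 // -q2 // linearD linearZ /=; modring R.
Qed.

(** The solution operator is a seminorm on the data that is countably
    subadditive because the maximal regularity space is complete and solutions
    are unique: this is the open mapping theorem for the linear problem. *)
Lemma linsol_bounded :
  (forall f x, wcont mu T f -> cinterp j mu x ->
     exists v y d, linsol j mu T B f x v y d) ->
  exists2 M, 0 < M & forall f x c, 0 < c -> wcont mu T f -> wbound mu T f c ->
    cinterp j mu x -> interp_le j mu x c ->
    exists v y d, [/\ linsol j mu T B f x v y d, wbound mu T y (M * c) &
      wbound mu T d (M * c)].
Proof.
move=> solv.
have [J J0 HJ] := interp_embed0 j Hj mu.
have [K K0 HK] := continuous_linear_le B Bc.
have mu1' : 0 <= mu <= 1 by case/andP: mu01 => /ltW -> /ltW ->.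
pose L : lmodType R := ((R -> E0) * E0)%type.
pose Q (p : L) c := [/\ 0 <= c, wcont mu T p.1, wbound mu T p.1 c,
  cinterp j mu p.2 & interp_le j mu p.2 c].
pose P (p : L) c := 0 <= c /\ exists v y d,
  [/\ linsol j mu T B p.1 p.2 v y d, wbound mu T y c & wbound mu T d c].
have wb0 (E : normedModType R) : wbound mu T (fun _ => 0 : E) 0.
  by move=> t _; rewrite normr0 mulr0.
have zero_sol : linsol j mu T B (fun=> 0) 0 (fun=> 0) (fun=> 0) (fun=> 0).
  have := reg_cst j mu mu01 T 0; rewrite linear0 => r.
  by split=> // t _; rewrite linear0 addr0.
have Q_lin (a : R) (x x' : L) c c' : Q x c -> Q x' c' -> Q (a *: x + x') (`|a| * c + c').
  move=> [c0 h1 h2 h3 h4] [c0' h1' h2' h3' h4']; split => /=.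
  - by rewrite addr_ge0 // mulr_ge0.
  - exact: wcont_lin.
  - exact: wbound_lin.
  - exact: cinterp_lin.
  - exact: interp_le_lin.
have P_lin (a : R) (x x' : L) c c' : P x c -> P x' c' -> P (a *: x + x') (`|a| * c + c').
  move=> [c0 [v [z [d [h1 h2 h3]]]]] [c0' [v' [z' [d' [h1' h2' h3']]]]].
  split; first by rewrite addr_ge0 // mulr_ge0.
  exists (fun t => a *: v t + v' t), (fun t => a *: z t + z' t), (fun t => a *: d t + d' t).
  by split; [exact: linsol_lin|exact: wbound_lin|exact: wbound_lin].
have [||||||||||M M0 HM] := @countably_subadditive_bounded R L Q P.
- move=> x c c' cc [c0 h1 h2 h3 h4]; split=> //; [exact: le_trans cc| |].
  + exact: wbound_le cc h2.
  + exact: interp_le_trans cc h4.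
- exact: Q_lin.
- split=> /=; [exact: lexx|exact: wcont_cst|exact: wb0| |exact: interp_le0].
  by have := cinterp_j j Hj mu 0 mu1'; rewrite linear0.
- move=> s c Q0 Qs.
  have Qn n : exists c', Q (s n) c'.
    elim: n => [|n [c' IH]]; first by exists c.
    exists (`|1| * (c / 2 ^+ n) + c').
    have := Q_lin 1 _ _ _ _ (Qs n) IH.
    by have -> : 1 *: (s n.+1 - s n) + s n = s n.+1 by rewrite scale1r subrK.
  have [||f cf fb] := wcont_complete mu mu01 T c (fun n => (s n).1).
  + by move=> n; have [c' []] := Qn n.
  + by move=> n; have [_ _ h _ _] := Qs n.
  have [||x cx xb] := cinterp_complete j Hj mu (fun n => (s n).2) c.
  + by move=> n; have [c' []] := Qn n.
  + by move=> n; have [_ _ _ _ h] := Qs n.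
  exists (f, x) => n; have [c0 _ _ _ _] := Q0.
  have [c' [_ h1 _ h2 _]] := Qn n.
  split=> /=; [|exact: wcontB|exact: fb|exact: cinterpB|exact: xb].
  by rewrite divr_ge0 ?exprn_ge0 // mulr_ge0.
- by move=> x c [].
- exact: P_lin.
- by split=> //; exists (fun=> 0), (fun=> 0), (fun=> 0); split.
- move=> [f x] c [c0 /= cf fb cx xb].
  have [v [y [d h]]] := solv f x cf cx.
  have [[cy cd _ _ _] _ _] := h.
  have [a a0 ya] := wcont_bounded mu mu01 T y (ltW T0) cy.
  have [b b0 db] := wcont_bounded mu mu01 T d (ltW T0) cd.
  exists (a + b); split; first by rewrite addr_ge0 // ltW.
  exists v, y, d; split=> //.
    by apply: wbound_le ya; rewrite lerDl ltW.
  by apply: wbound_le db; rewrite lerDr ltW.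
- move=> x c c' cc [c0 [v [y [d [h1 h2 h3]]]]]; split; first exact: le_trans cc.
  by exists v, y, d; split=> //; apply: wbound_le cc _.
- move=> s p c e s0 Ps Qs.
  have choice n : {u : (R -> E0) * (R -> E1) * (R -> E0) |
      [/\ linsol j mu T B (s n.+1 - s n).1 (s n.+1 - s n).2 u.1.1 u.1.2 u.2,
          wbound mu T u.1.2 (c / 2 ^+ n) & wbound mu T u.2 (c / 2 ^+ n)]}.
    by apply: cid; have [_ [v [y [d h]]]] := Ps n; exists (v, y, d).
  pose u n := projT1 (choice n).
  pose U := fix U n : (R -> E0) * (R -> E1) * (R -> E0) :=
    if n is n'.+1 then (fun t => 1 *: (u n').1.1 t + (U n').1.1 t,
                        fun t => 1 *: (u n').1.2 t + (U n').1.2 t,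
                        fun t => 1 *: (u n').2 t + (U n').2 t)
    else (fun=> 0, fun=> 0, fun=> 0).
  have UP n : linsol j mu T B (s n).1 (s n).2 (U n).1.1 (U n).1.2 (U n).2.
    elim: n => [|n IH]; first by rewrite s0.
    have [h _ _] := projT2 (choice n).
    have [r1 r2 r3] := linsol_lin _ 1 _ _ _ _ _ _ _ _ _ _ h IH.
    split=> //=; first by rewrite r2 scale1r subrK.
    by move=> t tT; rewrite r3 // scale1r /= subrK.
  have [||||v [y [d [rv v0 yb db]]]] :=
    @reg_complete R E0 E1 j mu Hj mu01 T c (J * e) p.2 (fun n => (U n).1.1)
     (fun n => (U n).1.2) (fun n => (U n).2) T0.
  + by move=> n; have [] := UP n.
  + move=> n; have [_ h _] := projT2 (choice n).
    by apply: wbound_ext h => t _ /=; rewrite scale1r addrK.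
  + move=> n; have [_ _ h] := projT2 (choice n).
    by apply: wbound_ext h => t _ /=; rewrite scale1r addrK.
  + move=> n; have [_ -> _] := UP n; have [_ _ _ _ h] := Qs n.
    by have := HJ _ _ h; rewrite mulrA.
  have c0 : 0 <= c by have [h _] := Ps 0%N; rewrite expr0 divr1 in h.
  split; first by rewrite mulr_ge0.
  exists v, y, d; split; last first.
  + have := db 0%N; rewrite expr0 divr1; apply: wbound_ext => t _ /=; exact: subr0.
  + have := yb 0%N; rewrite expr0 divr1; apply: wbound_ext => t _ /=; exact: subr0.
  split=> // t tT; have t1 : 0 < t `^ (1 - mu) by rewrite powR_gt0; case/andP: tT.
  apply/eqP; rewrite -subr_eq0 -normr_le0 -(ler_pM2l t1) mulr0.
  apply: (@le_geometric _ _ _ ((1 + K) * (2 * c) + e)) => n; rewrite add0r.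
  have [_ _ /(_ t tT) Un] := UP n.
  have -> : d t + B (y t) - p.1 t =
    (d t - (U n).2 t) + B (y t - (U n).1.2 t) - (p.1 t - (s n).1 t).
    have aux (a b a' b' q : E0) :
      a + b - q = (a - a') + (b - b') - (q - (a' + b')) by modring R.
    by rewrite -Un linearB; exact: aux.
  have h1 := db n t tT; have h2 := yb n t tT; have [_ _ /(_ t tT) h3 _ _] := Qs n.
  have h4 := HK (y t - (U n).1.2 t).
  have h5 := ler_normB (d t - (U n).2 t + B (y t - (U n).1.2 t)) (p.1 t - (s n).1 t).
  have h6 := ler_normD (d t - (U n).2 t) (B (y t - (U n).1.2 t)).
  apply: (@le_trans _ _ (t `^ (1 - mu) * (`|d t - (U n).2 t| +
     K * `|y t - (U n).1.2 t| + `|p.1 t - (s n).1 t|))).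
    by rewrite ler_pM2l //; lra.
  have h7 : K * (t `^ (1 - mu) * `|y t - (U n).1.2 t|) <= K * (2 * c / 2 ^+ n) by rewrite ler_pM2l.
  move: h1 h3 h7; rewrite /=; lra.
exists M => // f x c c0 cf fb cx xb.
by have [|_] := HM (f, x) c c0; first by split=> //; exact: ltW.
Qed.

End LinearBounded.

(** * The linear problem on short intervals *)

Section ShortIntervals.
Context {R : realType} {E0 E1 : completeNormedModType R} (j : {linear E1 -> E0}).
Context (mu : R) (Hj : banach_couple j) (mu01 : 0 < mu < 1).
Implicit Types (t c T S : R) (v w d f : R -> E0) (y : R -> E1).

(** Beyond [S] the function continues with constant weighted norm, so that
    extension from [0, S] to [0, T] does not increase the norm. *)
Lemma wcont_extend {E : normedModType R} (T S : R) (f : R -> E) :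
  0 < S <= T -> wcont mu S f -> exists g, [/\ wcont mu T g,
    forall t, 0 < t <= S -> g t = f t &
    forall c, wbound mu S f c -> wbound mu T g c].
Proof.
have /andP[mu0 mu1] := mu01 => ST [cf zf].
have S0 : 0 < S by lra.
pose g t := if t <= S then f t else t `^ (mu - 1) *: (S `^ (1 - mu) *: f S).
have gE t : t <= S -> g t = f t by rewrite /g => ->.
have gS t : S <= t -> g t = t `^ (mu - 1) *: (S `^ (1 - mu) *: f S).
  rewrite /g; case: (leP t S) => // tS St; have -> : t = S by lra.
  rewrite scalerA -powRD; last by rewrite (gt_eqF S0) implybT.
  by rewrite (_ : mu - 1 + (1 - mu) = 0) ?powRr0 ?scale1r //; ring.
have c2 t : 0 < t -> contI T (fun r => r `^ (mu - 1) *: (S `^ (1 - mu) *: f S)) t.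
  move=> t0; apply: contI_scale; first exact: powR_cont.
  by move=> e e0; exists 1 => // s _ _; rewrite subrr normr0 ltW.
exists g; split.
- split=> [t tT|e e0]; last first.
    have [r r0 H] := zf e e0; exists (Num.min r S); first by rewrite lt_min r0; lra.
    move=> t tT; rewrite lt_min => /andP[tr tS]; rewrite gE ?(ltW tS) //.
    by apply: H => //; lra.
  have [tS|St|->] := ltgtP t S.
  + apply: (@contI_local _ _ T S f g t (S - t)); [lra|by rewrite gE // ltW| |].
      move=> s sT; rewrite ltr_norml => st; have sS : s <= S by lra.
      by rewrite gE.
    by apply: cf; lra.
  + have t0 : 0 < t by lra.
    apply: (@contI_local _ _ T T _ g t (t - S) _ _ _ (c2 t t0)); [lra|by rewrite gS // ltW|].
    move=> s sT; rewrite ltr_norml => st; have sS : S <= s by lra.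
    by rewrite gS //; split=> //; lra.
  + move=> e e0; have [|r r0 H] := cf S _ e e0; first lra.
    have [|r' r'0 H'] := c2 S _ e e0; first lra.
    exists (Num.min r r'); first by rewrite lt_min r0.
    move=> s sT; rewrite lt_min => /andP[sr sr'].
    have [sS|Ss] := leP s S; first by rewrite !gE //; apply: H => //; lra.
    by rewrite !gS ?(ltW Ss) //; apply: H'.
- by move=> t tS; apply: gE; lra.
- move=> c h t tT; have [tS|St] := leP t S; first by rewrite gE //; apply: h; lra.
  have t0 : 0 < t by lra.
  rewrite gS ?(ltW St) // !normrZ !ger0_norm ?powR_ge0 //.
  rewrite !mulrA -powRD; last by rewrite (gt_eqF t0) implybT.
  by rewrite (_ : 1 - mu + (mu - 1) = 0) ?powRr0 ?mul1r; [apply: h; lra|ring].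
Qed.

(** In the variable [t `^ mu] the integrand is [mu^-1 * t `^ (1 - mu) * y t], which
    is continuous and vanishes at 0, so the primitive exists up to 0. *)
Lemma wcont_primitive {E : completeNormedModType R} (S : R) (y : R -> E) :
  0 < S -> wcont mu S y -> exists W, [/\ W 0 = 0,
    forall t, 0 < t <= S -> derI S W t (y t) &
    forall e, 0 < e -> exists2 r, 0 < r &
      forall t, 0 < t <= S -> t < r -> `|W t| <= e].
Proof.
have /andP[mu0 mu1] := mu01 => S0 [cy zy].
pose g t := if t == 0 then 0 else mu^-1 *: (t `^ (1 - mu) *: y t).
have gE t : 0 < t -> g t = mu^-1 *: (t `^ (1 - mu) *: y t).
  by move=> t0; rewrite /g gt_eqF.
have g0 : g 0 = 0 by rewrite /g eqxx.
clearbody g.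
have [|s t s0 st tS|a aS e e0|W W0 WP] := primitive_exists (fun t => t `^ mu) g S.
- exact: ltW.
- by apply: powR_incr; lra.
- have [a0|an] := ltP 0 a; last first.
    have -> : a = 0 by lra.
    have [|r r0 H] := zy (mu * e); first by rewrite mulr_gt0.
    exists r => // s sS; rewrite subr0 g0 subr0 => sr.
    have [s0|sn] := ltP 0 s; last first.
      by have -> : s = 0 by [lra]; rewrite g0 normr0 ltW.
    rewrite gE // !normrZ gtr0_norm ?invr_gt0 // ger0_norm ?powR_ge0 //.
    rewrite mulrC ler_pdivrMr // [leRHS]mulrC; apply: H; first lra.
    by move: sr; rewrite gtr0_norm.
  have ca : contI S (fun t => mu^-1 *: (t `^ (1 - mu) *: y t)) a.
    apply: contI_scale; first by move=> e' e'0; exists 1 => // *; rewrite subrr normr0 ltW.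
    by apply: contI_scale; [exact: powR_cont|apply: cy; lra].
  have [r r0 H] := ca e e0.
  exists (Num.min r a); first by rewrite lt_min r0.
  move=> s sS; rewrite lt_min => /andP[sr]; rewrite ltr_norml => sa.
  by rewrite !gE; [apply: H => //; lra|lra|lra].
exists W; split=> //.
- move=> t tS e e0; have t0 : 0 < t by lra.
  pose z := t `^ (mu - 1).
  have z0 : 0 < z by exact: powR_gt0.
  have gt : (mu * z) *: g t = y t.
    rewrite gE // !scalerA (_ : _ * _ * _ = mu * mu^-1 * (z * t `^ (1 - mu))); last by ring.
    rewrite mulfV ?gt_eqF // mul1r /z -powRD; last by rewrite (gt_eqF t0) implybT.
    by rewrite (_ : mu - 1 + (1 - mu) = 0) ?powRr0 ?scale1r //; ring.
  have k0 : 0 < 2 * (mu * z + 1) by have := mulr_gt0 mu0 z0; lra.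
  pose e1 := e / (2 * (mu * z + 1)).
  have e10 : 0 < e1 by rewrite divr_gt0.
  have g1 : 0 < `|g t| + 1 by have := normr_ge0 (g t); lra.
  pose e2 := Num.min 1 (e / 2 / (`|g t| + 1)).
  have e20 : 0 < e2 by rewrite lt_min ltr01 divr_gt0 //; lra.
  have [|r1 r10 H1] := WP e1 e10 t; first lra.
  have [r2 r20 H2] := powR_der mu S t t0 e2 e20.
  exists (Num.min r1 r2); first by rewrite lt_min r10.
  move=> s sS; rewrite lt_min => /andP[sr1 sr2].
  have := H1 s (ltac:(lra)) sr1; have := H2 s sS sr2.
  rewrite /GRing.scale /= -/z; set p := s `^ mu - t `^ mu => h2 h1.
  have -> : W s - W t - (s - t) *: y t =
     (W s - W t - p *: g t) + (p - (s - t) * (mu * z)) *: g t.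
    by rewrite -gt; modring R.
  apply: (le_trans (ler_normD _ _)); rewrite normrZ.
  have st0 := normr_ge0 (s - t).
  have [e21 e22] : e2 <= 1 /\ e2 <= e / 2 / (`|g t| + 1) by rewrite !ge_min !lexx orbT.
  have hp : `|p| <= (mu * z + 1) * `|s - t|.
    have -> : p = (p - (s - t) * (mu * z)) + (s - t) * (mu * z) by ring.
    apply: (le_trans (ler_normD _ _)); rewrite normrM.
    rewrite (gtr0_norm (mulr_gt0 mu0 z0)).
    by have := ler_wpM2r st0 e21; lra.
  have a1 : e1 * `|p| <= e / 2 * `|s - t|.
    apply: (@le_trans _ _ (e1 * ((mu * z + 1) * `|s - t|))); first by rewrite ler_pM2l.
    rewrite mulrA ler_wpM2r // /e1 le_eqVlt; apply/orP; left; apply/eqP; field.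
    by rewrite gt_eqF //; have := mulr_gt0 mu0 z0; lra.
  have a2 : `|p - (s - t) * (mu * z)| * `|g t| <= e / 2 * `|s - t|.
    have b1 : e2 * (`|g t| + 1) <= e / 2 by rewrite -ler_pdivlMr.
    have b2 := ler_wpM2r st0 b1.
    have b3 := ler_wpM2r (normr_ge0 (g t)) h2.
    have := mulr_ge0 (ltW e20) st0; lra.
  lra.
- move=> e e0; have [|r r0 H] := WP 1 ltr01 0; first lra.
  have [r' r'0 H'] := powR_small mu e mu0 e0.
  exists (Num.min r r'); first by rewrite lt_min r0.
  move=> t tS; rewrite lt_min => /andP[tr tr'].
  have := H t (ltac:(lra)); rewrite subr0 g0 scaler0 subr0 W0 subr0 mul1r powR0 ?gt_eqF //.
  rewrite subr0 !gtr0_norm ?powR_gt0 //; [|lra..].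
  by move=> /(_ tr) h; apply: (le_trans h); apply: H'; lra.
Qed.

End ShortIntervals.

Section ShortUniqueness.
Context {R : realType} {E0 E1 : completeNormedModType R} (j : {linear E1 -> E0}).
Context (mu : R) (Hj : banach_couple j) (mu01 : 0 < mu < 1).
Implicit Types (t c T S : R) (v w d f : R -> E0) (y : R -> E1).

(** A null solution [w] on [0, S] cannot be shifted to the right, being singular
    at 0; its primitive [W], taken with values in [E1], can, because it is a
    classical null solution: [W' = w] and [w + B W] is constant, hence zero. The
    shifted function lives on [0, T], where uniqueness is known. *)
Lemma linsol_unique_short T S (B : {linear E1 -> E0}) : continuous B -> 0 < S <= T ->
  (forall v y d, linsol j mu T B (fun=> 0) 0 v y d -> forall t, 0 < t <= T -> v t = 0) ->
  forall v y d, linsol j mu S B (fun=> 0) 0 v y d -> forall t, 0 < t <= S -> y t = 0.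
Proof.
have /andP[mu0 mu1] := mu01 => Bc ST uniq w y d [[cy cd wy dw w0] w00 eqn].
have S0 : 0 < S by lra.
have [K K0 HK] := continuous_linear_le B Bc.
have [J J0 HJ] := j_bounded j Hj.
have [W [W0 WP Wz]] := wcont_primitive mu mu01 S y S0 cy.
have jW t : 0 < t <= S -> derI S (fun s => j (W s)) t (w t).
  by move=> tS; rewrite wy //; apply: derI_linear HJ (WP t tS).
have wBW t : 0 < t <= S -> w t + B (W t) = 0.
  move=> tS; apply/eqP; rewrite -normr_le0; apply/ler_addgt0Pr => e e0; rewrite add0r.
  have [|r r0 Hr] := w0 (e / 2); first lra.
  have [|r' r'0 Hr'] := Wz (e / 2 / K); first by rewrite divr_gt0 //; lra.
  pose s := Num.min t (Num.min (r / 2) (r' / 2)).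
  have s0 : 0 < s by rewrite !lt_min; lra.
  have [st [s1 s2]] : s <= t /\ s <= r / 2 /\ s <= r' / 2.
    by rewrite !ge_min !lexx !orbT.
  have h : `|1 *: w t + B (W t) - (1 *: w s + B (W s))| <= 0 * (t - s).
    apply: (@mvi _ _ S (fun s => 1 *: w s + B (W s)) (fun s => 1 *: d s + B (y s))) => //; [lra| |].
      move=> q qs; apply: derI_lin; first by apply: dw; lra.
      by apply: derI_linear HK (WP q _); lra.
    by move=> q qs; rewrite scale1r eqn ?normr0 //; lra.
  move: h; rewrite mul0r !scale1r normr_le0 subr_eq0 => /eqP ->.
  apply: (le_trans (ler_normD _ _)).
  have h1 := Hr s (ltac:(lra)) (ltac:(lra)); rewrite w00 subr0 in h1.
  have := Hr' s (ltac:(lra)) (ltac:(lra)); rewrite ler_pdivlMr // mulrC => h2.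
  by have := HK (W s); lra.
(* all functions on [0, S] are shifted by [a] and continued by their value at 0 *)
pose a := T - S.
have a0 : 0 <= a by rewrite /a; lra.
pose m t := Num.max (t - a) 0.
have m0 t : t <= a -> m t = 0 by move=> ta; rewrite /m max_r //; lra.
have mE t : a <= t -> m t = t - a by move=> ta; rewrite /m max_l //; lra.
have shift_cont (E : normedModType R) (h : R -> E) :
    (forall t, 0 < t <= S -> contI S h t) ->
    (forall e, 0 < e -> exists2 r, 0 < r &
      forall t, 0 < t <= S -> t < r -> `|h t - h 0| <= e) ->
    forall t, 0 <= t <= T -> contI T (fun s => h (m s)) t.
  move=> ch hz t tT e e0; have [at_|ta] := ltP a t.
    have [|r r0 H] := ch (t - a) _ e e0; first by rewrite /a in at_ *; lra.
    exists (Num.min r (t - a)); first by rewrite lt_min r0; lra.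
    move=> s sT; rewrite lt_min !ltr_norml => /andP[sr st].
    rewrite !mE; [|lra|lra]; apply: H; first by rewrite /a in st *; lra.
    by have -> : s - a - (t - a) = s - t by [ring]; rewrite ltr_norml.
  have [r r0 H] := hz e e0; exists r => // s sT; rewrite ltr_norml => sr.
  rewrite (m0 t) //; have [sa|as_] := leP s a; first by rewrite m0 // subrr normr0 ltW.
  rewrite mE; last exact: ltW.
  by apply: H; rewrite /a in as_ ta *; lra.
have cW : forall t, 0 <= t <= T -> contI T (fun s => W (m s)) t.
  apply: shift_cont; first by move=> t tS; apply: derI_contI (WP t tS).
  by move=> e e0; have [r r0 H] := Wz e e0; exists r => // t; rewrite W0 subr0; exact: H.
have cw : forall t, 0 <= t <= T -> contI T (fun s => w (m s)) t.
  by apply: shift_cont => // t tS; apply: derI_contI (dw t tS).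
have weight (E : normedModType R) (h : R -> E) :
    (forall t, 0 <= t <= T -> contI T h t) -> h 0 = 0 -> wcont mu T h.
  move=> ch h0; split=> [t tT|e e0]; first by apply: ch; lra.
  have [|r r0 H] := ch 0 _ 1 ltr01; first lra.
  have [r' r'0 H'] := @powR_small R (1 - mu) e (ltac:(lra)) e0.
  exists (Num.min r r'); first by rewrite lt_min r0.
  move=> t tT; rewrite lt_min => /andP[tr tr'].
  have h1 : `|h t| <= 1.
    by have := H t tT; rewrite h0 !subr0 gtr0_norm; [apply|lra].
  have h2 := H' t (ltac:(lra)) (ltW tr').
  by apply: (le_trans _ h2); rewrite ler_piMr ?powR_ge0.
have mzero : m 0 = 0 by exact: m0.
have dW t : 0 < t <= T -> derI T (fun s => j (W (m s))) t (w (m t)).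
  move=> tT; have [at_|ta|ta] := ltgtP a t.
  - have tS : 0 < t - a <= S by rewrite /a in at_ *; lra.
    move=> e e0; have [r r0 H] := jW (t - a) tS e e0.
    exists (Num.min r (t - a)); first by rewrite lt_min r0; lra.
    move=> s sT; rewrite lt_min !ltr_norml => /andP[sr st].
    rewrite !mE; [|lra|lra].
    have eqst : s - t = s - a - (t - a) by ring.
    rewrite eqst; apply: H; first by rewrite /a in st *; lra.
    by rewrite -eqst ltr_norml.
  - move=> e e0; exists (a - t); first lra.
    move=> s sT; rewrite ltr_norml => sr.
    rewrite !m0; [|lra|lra]; rewrite subrr w00 scaler0 subr0 normr0.
    by rewrite mulr_ge0 // ltW.
  - have mt u : t <= u -> m u = u - t by move=> tu; rewrite mE ta.
    move=> e e0; have [r r0 H] := w0 e e0; exists r => // s sT sr.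
    rewrite (m0 t) ?ta // w00 scaler0 subr0 W0 linear0 subr0.
    have [st|ts] := leP s t; first by rewrite m0 ?ta // W0 linear0 normr0 mulr_ge0 // ltW.
    rewrite ltr_norml in sr.
    (* [W] itself need not be differentiable at 0 in [E1], but [j (W _)] has the
       derivative [w], which is continuous there *)
    have b0 : 0 < s - t by lra.
    rewrite (mt _ (ltW ts)) (gtr0_norm b0).
    apply/ler_addgt0Pr => e' e'0.
    have [|q q0 Hq] := Wz (e' / J); first by rewrite divr_gt0.
    pose p := Num.min (s - t) (q / 2).
    have p0 : 0 < p by rewrite lt_min; lra.
    have [p1 p2] : p <= s - t /\ p <= q / 2 by rewrite !ge_min !lexx !orbT.
    have bS : s - t <= S by rewrite -ta /a; lra.
    have h1 : `|j (W (s - t)) - j (W p)| <= e * (s - t - p).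
      apply: (@mvi _ _ S (fun r => j (W r)) w) => //.
        by move=> u up; apply: jW; lra.
      move=> u up; have := H u (ltac:(lra)) (ltac:(lra)).
      by rewrite w00 subr0.
    have h2 := Hq p (ltac:(lra)) (ltac:(lra)); rewrite ler_pdivlMr // mulrC in h2.
    have h3 := HJ (W p).
    have -> : j (W (s - t)) = (j (W (s - t)) - j (W p)) + j (W p) by modring R.
    apply: (le_trans (ler_normD _ _)).
    have := mulr_ge0 (ltW e0) (ltW p0); lra.
pose Y t := W (m t).
have sol : linsol j mu T B (fun=> 0) 0 (fun t => j (Y t)) Y (fun t => w (m t)).
  split; last first.
  - move=> t tT; rewrite /Y; have [at_|ta] := ltP a t.
      by rewrite mE ?wBW // /a; [rewrite /a in at_; lra|exact: ltW].
    by rewrite m0 // w00 W0 linear0 addr0.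
  - by rewrite /Y mzero W0 linear0.
  split=> //.
  - by apply: weight => //; rewrite /Y mzero.
  - by apply: weight => //; rewrite mzero.
  - move=> e e0; have [||r r0 H] := cW 0 _ (e / J); [lra|by rewrite divr_gt0|].
    exists r => // t tT tr; rewrite -linearB; apply: (le_trans (HJ _)).
    rewrite mulrC -ler_pdivlMr //; apply: H => //.
    by rewrite subr0 gtr0_norm //; lra.
have Wzero t : 0 < t <= S -> W t = 0.
  move=> tS; have := uniq _ _ _ sol (t + a); rewrite /Y mE; last lra.
  rewrite addrK => h; have [jinj _ _] := Hj; apply: jinj; rewrite linear0; apply: h.
  by rewrite /a; lra.
move=> t tS; apply: (derI_unique S W t) => //; first exact: WP.
move=> e e0; exists 1 => // s sS _; rewrite !Wzero // scaler0 !subrr normr0.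
by rewrite mulr_ge0 // ltW.
Qed.

End ShortUniqueness.

Section MaximalRegularity.
Context {R : realType} {E0 E1 : completeNormedModType R} (j : {linear E1 -> E0}).
Context (mu : R) (Hj : banach_couple j) (mu01 : 0 < mu < 1).
Implicit Types (t c T S : R) (v w d f : R -> E0) (y : R -> E1).

Lemma linsolB S (B : {linear E1 -> E0}) f f' x x' v y d v' y' d' :
  linsol j mu S B f x v y d -> linsol j mu S B f' x' v' y' d' ->
  linsol j mu S B (fun t => f t - f' t) (x - x')
    (fun t => v t - v' t) (fun t => y t - y' t) (fun t => d t - d' t).
Proof.
move=> [r1 e1 q1] [r2 e2 q2]; split; [exact: regB|by rewrite e1 e2|].
have aux (a b c e : E0) : a - c + (b - e) = a + b - (c + e) by modring R.
by move=> t tT; rewrite -q1 // -q2 // linearB; exact: aux.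
Qed.

Lemma linsol_wcont S (B : {linear E1 -> E0}) f x v y d : continuous B ->
  linsol j mu S B f x v y d -> wcont mu S f.
Proof.
move=> /continuous_linear_le [K K0 HK] [[cy cd _ _ _] _ eqn].
have := wcont_lin mu S 1 d _ cd (wcont_linear mu S K y B HK cy).
by apply: wcont_ext => t tS; rewrite scale1r eqn.
Qed.

(** Extending the data to [0, T] gives a solution with the bound; by uniqueness on
    the shorter interval the bound holds for every solution. The constant does not
    depend on the length of the interval. *)
Lemma Mmu_estimate (B : {linear E1 -> E0}) : Mmu j mu B ->
  exists T M, [/\ 0 < T, 0 < M, forall S f x c, 0 < S <= T -> 0 < c ->
      wcont mu S f -> wbound mu S f c -> cinterp j mu x -> interp_le j mu x c ->
      exists v y d, [/\ linsol j mu S B f x v y d, wbound mu S y (M * c) &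
        wbound mu S d (M * c)] &
    forall S f x v y d c, 0 < S <= T -> 0 < c -> linsol j mu S B f x v y d ->
      wbound mu S f c -> interp_le j mu x c ->
      wbound mu S y (M * c) /\ wbound mu S d (M * c)].
Proof.
move=> [Bc [T T0 HT]].
have solv f x : wcont mu T f -> cinterp j mu x ->
    exists v y d, linsol j mu T B f x v y d.
  move=> /(BCwP _ mu01 _ _ T0) cf cx.
  have [v [rv eqn v0] _] := HT f x cf cx.
  by exists v, (linv j \o v), (ddt T v); split=> //; exact: E1mu_reg.
have mu1' : 0 <= mu <= 1 by case/andP: mu01 => /ltW -> /ltW ->.
have lin v y d f x : linsol j mu T B f x v y d -> linear_solution j mu B T f x v.
  move=> [rv v0 eqn]; have [h1 h2] := reg_E1mu j mu Hj mu01 T v y d T0 rv.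
  by split=> // t tT; have [-> ->] := h2 t tT; exact: eqn.
have zero_sol : linsol j mu T B (fun=> 0) 0 (fun=> 0) (fun=> 0) (fun=> 0).
  have := reg_cst j mu mu01 T 0; rewrite linear0 => r.
  by split=> // t _; rewrite linear0 addr0.
have uniq v y d : linsol j mu T B (fun=> 0) 0 v y d -> forall t, 0 < t <= T -> v t = 0.
  move=> h t tT.
  have [||u _ uu] := HT (fun=> 0) 0.
  - by apply/BCwP => //; exact: wcont_cst.
  - by have := cinterp_j j Hj mu 0 mu1'; rewrite linear0.
  have tT' : 0 <= t <= T by lra.
  by rewrite (uu _ (lin _ _ _ _ _ h) t tT') -(uu _ (lin _ _ _ _ _ zero_sol) t tT').
have [M M0 HM] := linsol_bounded j mu Hj mu01 T T0 B Bc solv.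
exists T, M.
have ex S f x c : 0 < S <= T -> 0 < c ->
      wcont mu S f -> wbound mu S f c -> cinterp j mu x -> interp_le j mu x c ->
      exists v y d, [/\ linsol j mu S B f x v y d, wbound mu S y (M * c) &
        wbound mu S d (M * c)].
  move=> ST c0 cf fb cx xb.
  have [g [cg gf gb]] := wcont_extend mu mu01 T S f ST cf.
  have [v [y [d [[rv v0 eqn] yb db]]]] := HM g x c c0 cg (gb c fb) cx xb.
  have SleT : S <= T by lra.
  exists v, y, d; split; [split=> //|exact: wbound_restrict SleT _|exact: wbound_restrict SleT _].
    exact: reg_restrict SleT _.
  by move=> t tS; rewrite eqn ?gf //; lra.
split=> // S f x v y d c ST c0 sol fb xb.
have S0 : 0 < S by lra.
have cf := linsol_wcont _ _ _ _ _ _ _ Bc sol.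
have [rv v0 eqn] := sol.
have cx : cinterp j mu x.
  by rewrite -v0; apply: (reg_cinterp j mu Hj mu01 S v y d) => //; rewrite lexx ltW.
have [v' [y' [d' [sol' yb db]]]] := ex S f x c ST c0 cf fb cx xb.
have diff := linsolB _ _ _ _ _ _ _ _ _ _ _ _ sol sol'.
have yE t : 0 < t <= S -> y' t = y t.
  move=> tS; apply/eqP; rewrite eq_sym -subr_eq0; apply/eqP.
  apply: (linsol_unique_short j mu Hj mu01 T S B Bc ST uniq (fun t => v t - v' t)
    (fun t => y t - y' t) (fun t => d t - d' t)) => //.
  have [r1 e1 q1] := diff; split=> //; first by rewrite e1 subrr.
  by move=> s sS; rewrite q1 // subrr.
split; first by apply: wbound_ext yb.
apply: wbound_ext db => t tS.
have [_ _ eqn'] := sol'; apply: (addIr (B (y t))).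
by rewrite eqn // -{1}(yE t tS) eqn'.
Qed.

End MaximalRegularity.

(** * The nonlinearity *)

Lemma opnorm_ge {R : realType} {E F : normedModType R} (f : E -> F) (K : R) :
  (forall (a : R) v, f (a *: v) = a *: f v) -> (forall v, `|f v| <= K * `|v|) ->
  0 <= opnorm f /\ forall v, `|f v| <= opnorm f * `|v|.
Proof.
move=> fZ fK.
have ub v : `|v| <= 1 -> `|f v| <= opnorm f.
  move=> v1; apply: ub_le_sup; last by exists v.
  exists `|K| => _ [u u1 <-]; apply: (le_trans (fK u)).
  have := ler_norm K; have := normr_ge0 u; have := normr_ge0 K.
  by rewrite /= in u1; nra.
have f0 : f 0 = 0 by rewrite -(scale0r 0) fZ scale0r.
split; first by have := ub 0; rewrite f0 !normr0; apply.
move=> v; have [->|vn] := eqVneq v 0; first by rewrite f0 !normr0 mulr0.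
have v0 : 0 < `|v| by rewrite normr_gt0.
have := ub (`|v|^-1 *: v); rewrite fZ !normrZ normfV normr_id mulVf ?gt_eqF //.
by move=> /(_ (lexx _)); rewrite mulrC ler_pdivrMr.
Qed.

Lemma powR_balance {R : realType} (e q D a : R) : 0 < e -> 0 < q ->
  (e / q) `^ (1 - a) * (D * q `^ (- a)) = e `^ (1 - a) * D / q.
Proof.
move=> e0 q0; rewrite powRM ?invr_ge0 ?(ltW e0) ?(ltW q0) //.
have qE : q^-1 `^ (1 - a) * q `^ (- a) = q^-1.
  rewrite -(powR_inv1 (ltW q0)) -powRrM -powRD; last by rewrite (gt_eqF q0) implybT.
  by congr (_ `^ _); ring.
by rewrite -[in RHS]qE; ring.
Qed.

Section Nonlinearity.
Context {R : realType} {E0 E1 : completeNormedModType R} (j : {linear E1 -> E0}).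
Context (mu : R) (Hj : banach_couple j) (mu01 : 0 < mu < 1).
Context (V : set E0) (A : E0 -> {linear E1 -> E0}) (F1 F2 : E0 -> E0).
Context (HV : interp_open j mu V) (H1 : hypothesis1 j mu V A F1)
  (H2 : hypothesis2 j mu V F2).
Implicit Types (x : E0) (y : E1).

Let nrm x := interp_norm j mu x.
Let mu1' : 0 <= mu <= 1. Proof. by case/andP: mu01 => /ltW -> /ltW ->. Qed.
Let cj y : cinterp j mu (j y). Proof. exact: cinterp_j. Qed.
Let cV x : V x -> cinterp j mu x. Proof. exact: HV.1. Qed.

Lemma quasilinear_lipschitz x0 : V x0 -> exists r L, [/\ 0 < r, 0 <= L,
  forall x x', V x -> V x' -> nrm (x - x0) < r -> nrm (x' - x0) < r -> forall y,
    `|A x y - A x' y| <= L * nrm (x - x') * `|y| &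
  forall x x', V x -> V x' -> nrm (x - x0) < r -> nrm (x' - x0) < r ->
    `|F1 x - F1 x'| <= L * nrm (x - x')].
Proof.
case: H1 => AM H1' Vx0; have [r [L [r0 HL]]] := H1' x0 Vx0.
have main x x' : V x -> V x' -> nrm (x - x0) < r -> nrm (x' - x0) < r ->
    (forall y, `|A x y - A x' y| <= Num.max L 0 * nrm (x - x') * `|y|) /\
    `|F1 x - F1 x'| <= Num.max L 0 * nrm (x - x').
  move=> Vx Vx' xr x'r; have := HL x x' Vx Vx' xr x'r.
  have [Kx _ Hx] := continuous_linear_le _ (AM x Vx).1.
  have [Kx' _ Hx'] := continuous_linear_le _ (AM x' Vx').1.
  have [||o0 Ho] := @opnorm_ge R E1 E0 (fun v => A x v - A x' v) (Kx + Kx').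
  - by move=> a v; rewrite !linearZ /=; modring R.
  - move=> v; apply: (le_trans (ler_normB _ _)); rewrite mulrDl.
    by have := Hx v; have := Hx' v; lra.
  have n0 : 0 <= nrm (x - x') by exact: interp_norm_ge0.
  have LM : L * nrm (x - x') <= Num.max L 0 * nrm (x - x').
    by rewrite ler_wpM2r // le_max lexx.
  rewrite -/(nrm (x - x')) => h; split; last by apply: le_trans LM; lra.
  move=> y; apply: (le_trans (Ho y)); rewrite ler_wpM2r //.
  by apply: le_trans LM; have := normr_ge0 (F1 x - F1 x'); lra.
exists r, (Num.max L 0); split=> //; first by rewrite le_max lexx orbT.
- by move=> x x' Vx Vx' xr x'r y; have [h _] := main x x' Vx Vx' xr x'r; exact: h.
- by move=> x x' Vx Vx' xr x'r; have [_ h] := main x x' Vx Vx' xr x'r; exact: h.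
Qed.

(** The growth condition, critical case included: with [Y = e / q] the weight
    [1 + |x1|_beta ^ rho + |x2|_beta ^ rho] is of order [Y ^ (1 - a_k)] and the
    difference of order [D * q ^ (- a_k)], where [a_k] is the position of
    [beta_k] between [mu] and 1. The product is of order [D * e ^ (1 - a_k) / q],
    and [e ^ (1 - a_k)] is small with [e] since [a_k < 1]. *)
Lemma semilinear_lipschitz x0 : V x0 -> exists C k, [/\ 0 <= C, 0 < k &
  forall e q D y1 y2, 0 < e <= 1 -> 0 < q <= e ->
    V (j y1) -> V (j y2) -> nrm (j y1 - x0) <= 1 -> nrm (j y2 - x0) <= 1 ->
    q * `|y1| <= e -> q * `|y2| <= e ->
    nrm (j y1 - j y2) <= D -> q * `|y1 - y2| <= D ->
    q * `|F2 (j y1) - F2 (j y2)| <= C * e `^ k * D].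
Proof.
have /andP[mu0 mu1] := mu01.
case: H2 => beta [/andP[mub b1] [m [bet [rho [Hbr HF]]]]] Vx0.
have [C C0 HC] := HF x0 1 Vx0 ltr01.
pose a g := (g - mu) / (1 - mu).
pose N := nrm x0 + 1.
have N1 : 1 <= N by have := interp_norm_ge0 j mu x0; rewrite /N /nrm; lra.
have ab : 0 <= a beta < 1.
  by rewrite /a divr_ge0 /= ?ltr_pdivrMr //; lra.
exists (C * \sum_(i < m) 3 * N `^ rho i), (1 - a beta); split; [|lra|].
  by rewrite mulr_ge0 ?(ltW C0) // sumr_ge0 // => i _; rewrite mulr_ge0 ?powR_ge0.
move=> e q D y1 y2 /andP[e0 e1] /andP[q0 qe] V1 V2 n1 n2 qy1 qy2 nD qD.
have D0 : 0 <= D by apply: le_trans nD; exact: interp_norm_ge0.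
pose Y := e / q.
have Y1 : 1 <= Y by rewrite /Y ler_pdivlMr // mul1r.
have Y0 : 0 < Y by lra.
have norm1 y : nrm (j y - x0) <= 1 -> interp_le j mu (j y) N.
  move=> h; have -> : j y = (j y - x0) + x0 by modring R.
  apply: (@interp_le_trans _ _ _ _ _ _ (nrm (j y - x0) + nrm x0)); first by rewrite /N; lra.
  by apply: interp_leD; apply: cinterp_norm; [apply: cinterpB; [exact: cj|exact: cV]|exact: cV].
have bound y : nrm (j y - x0) <= 1 -> q * `|y| <= e ->
    interp_norm j beta (j y) <= N * Y `^ a beta.
  move=> hy qy.
  have yY : `|y| <= Y by rewrite /Y ler_pdivlMr // mulrC.
  have h := interp_ineq j mu beta y N Y mu01 (ltac:(lra)) (norm1 y hy) yY.
  apply: (le_trans (interp_le_norm _ _ _ _ h)); rewrite -/(a beta).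
  by rewrite ler_wpM2r ?powR_ge0 // ler1_powR //; lra.
have b01 : 0 <= beta <= 1 by lra.
have ball y : V (j y) -> nrm (j y - x0) <= 1 ->
    (interp_cball j mu x0 1 `&` (V `&` cinterp j beta)) (j y).
  by move=> Vy hy; split; [split=> //; exact: cj|split=> //; exact: cinterp_j].
apply: (@le_trans _ _ (q * (C * \sum_(i < m) (3 * N `^ rho i * (e `^ (1 - a beta) * D / q))))).
  rewrite ler_pM2l //; apply: (le_trans (HC _ _ (ball _ V1 n1) (ball _ V2 n2))).
  rewrite ler_pM2l //; apply: ler_sum => i _.
  have [/andP[mui ib] rho0 crit] := Hbr i.
  have ai : 0 <= a (bet i) <= a beta.
    by rewrite /a divr_ge0 ?subr_ge0 ?(ltW mu1) // ler_pM2r ?invr_gt0 ?subr_gt0 // lerD2r.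
  have ri : a beta * rho i <= 1 - a (bet i).
    have -> : a beta * rho i = (rho i * (beta - mu) + (bet i - mu)) / (1 - mu) - a (bet i).
      by rewrite /a; field; apply/eqP; lra.
    by rewrite lerD2r.
  have weight y : nrm (j y - x0) <= 1 -> q * `|y| <= e ->
      interp_norm j beta (j y) `^ rho i <= N `^ rho i * Y `^ (1 - a (bet i)).
    move=> hy qy; apply: (@le_trans _ _ ((N * Y `^ a beta) `^ rho i)).
      by apply: powR_incr => //; [exact: interp_norm_ge0|exact: bound].
    rewrite powRM ?powR_ge0 //; last lra.
    rewrite ler_wpM2l ?powR_ge0 // -powRrM; exact: ler_powR.
  have one : 1 <= N `^ rho i * Y `^ (1 - a (bet i)).
    have ge1 (z p : R) : 1 <= z -> 0 <= p -> 1 <= z `^ p.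
      by move=> z1 p0; have := @powR_incr R p 1 z p0 ler01 z1; rewrite powR1.
    have h1 : 1 <= N `^ rho i by exact: ge1.
    have h2 : 1 <= Y `^ (1 - a (bet i)).
      by apply: ge1 => //; apply: le_trans ri; case/andP: ab => ? _; exact: mulr_ge0.
    by have := ler_pM ler01 ler01 h1 h2; rewrite mulr1.
  have diff : interp_norm j (bet i) (j y1 - j y2) <= D * q `^ (- a (bet i)).
    rewrite -linearB.
    have h : interp_le j mu (j (y1 - y2)) D.
      apply: (interp_le_trans j _ _ _ _ nD); rewrite linearB.
      by apply: cinterp_norm; apply: cinterpB.
    have h' : `|y1 - y2| <= D / q by rewrite ler_pdivlMr // mulrC.
    have := interp_ineq j mu (bet i) (y1 - y2) D (D / q) mu01 (ltac:(lra)) h h'.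
    move=> /interp_le_norm k; apply: (le_trans k); rewrite -/(a (bet i)).
    rewrite powRM ?invr_ge0 ?(ltW q0) // mulrA -powRD; last by rewrite subrK oner_eq0.
    by rewrite subrK powRr1 // -(powR_inv1 (ltW q0)) -powRrM mulN1r.
  have w0 : 0 <= 1 + interp_norm j beta (j y1) `^ rho i + interp_norm j beta (j y2) `^ rho i.
    by rewrite !addr_ge0 ?powR_ge0.
  apply: (@le_trans _ _ ((3 * (N `^ rho i * Y `^ (1 - a (bet i)))) * (D * q `^ (- a (bet i))))).
    apply: ler_pM => //; first exact: interp_norm_ge0.
    have -> (p : R) : 3 * p = p + p + p by ring.
    by rewrite lerD ?weight // lerD ?weight.
  have -> : 3 * (N `^ rho i * Y `^ (1 - a (bet i))) * (D * q `^ (- a (bet i))) =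
    3 * N `^ rho i * (e `^ (1 - a (bet i)) * D / q).
    by rewrite mulrA -mulrA (powR_balance e q D).
  rewrite ler_wpM2l ?mulr_ge0 ?powR_ge0 // ler_wpM2r ?invr_ge0 ?(ltW q0) //.
  rewrite ler_wpM2r // ger_powR ?e0 ?e1 // lerD2l lerN2.
  by case/andP: ai.
rewrite -big_distrl /= le_eqVlt; apply/orP; left; apply/eqP.
by field; rewrite gt_eqF.
Qed.

Definition nonlin x0 y := A x0 y - A (j y) y + F1 (j y) + F2 (j y).

(** In the terms that come from [A] and [F1] every Lipschitz bound in [E_mu] is
    multiplied by a quantity of size at most [e]; [F2] is the previous lemma. The
    estimate is pointwise in time, [q] being the weight. *)
Lemma nonlin_lipschitz x0 k : V x0 -> 0 < k -> exists e, [/\ 0 < e, e <= 1,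
  forall x, cinterp j mu x -> nrm (x - x0) <= e -> V x &
  forall q D y1 y2, 0 < q <= e ->
    nrm (j y1 - x0) <= e -> nrm (j y2 - x0) <= e ->
    q * `|y1| <= e -> q * `|y2| <= e ->
    nrm (j y1 - j y2) <= D -> q * `|y1 - y2| <= D ->
    q * `|nonlin x0 y1 - nonlin x0 y2| <= k * D].
Proof.
move=> Vx0 k0.
have [r [L [r0 L0 HA HF1]]] := quasilinear_lipschitz x0 Vx0.
have [C [kap [C0 kap0 HF2]]] := semilinear_lipschitz x0 Vx0.
have [rV rV0 HrV] := HV.2 x0 Vx0.
have k1 : 0 < k / 2 / (C + 1) by rewrite !divr_gt0 //; lra.
have [d d0 Hd] := powR_small kap _ kap0 k1.
have k2 : 0 < k / 6 / (L + 1) by rewrite !divr_gt0 //; lra.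
pose e := Num.min 1 (Num.min (r / 2) (Num.min (rV / 2) (Num.min d (k / 6 / (L + 1))))).
have e0 : 0 < e by rewrite !lt_min ltr01 d0 k2 /=; lra.
have [e1 [er [eV [ed ek]]]] : e <= 1 /\ e <= r / 2 /\ e <= rV / 2 /\ e <= d /\ e <= k / 6 / (L + 1).
  by rewrite !ge_min !lexx !orbT.
clearbody e.
have closeV x : cinterp j mu x -> nrm (x - x0) <= e -> V x.
  by move=> cx xe; apply: HrV => //; rewrite -/(nrm _); lra.
exists e; split=> // q D y1 y2 /andP[q0 qe] n1 n2 qy1 qy2 nD qD.
have V1 := closeV _ (cj y1) n1; have V2 := closeV _ (cj y2) n2.
have D0 : 0 <= D by apply: le_trans nD; exact: interp_norm_ge0.
have N0 x : 0 <= nrm x by exact: interp_norm_ge0.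
have r00 : nrm (x0 - x0) < r.
  by apply: le_lt_trans r0; rewrite subrr; apply/interp_le_norm/interp_le0.
have er' : e < r by lra.
have r1 := le_lt_trans n1 er'.
have r2 := le_lt_trans n2 er'.
have a1 := HA _ _ Vx0 V1 r00 r1 (y1 - y2).
have a2 := HA _ _ V1 V2 r1 r2 y2.
have f1 := HF1 _ _ V1 V2 r1 r2.
have e01 : 0 < e <= 1 by rewrite e0.
have q0e : 0 < q <= e by rewrite q0.
have f2 := HF2 e q D y1 y2 e01 q0e V1 V2 (le_trans n1 e1) (le_trans n2 e1) qy1 qy2 nD qD.
have -> : nonlin x0 y1 - nonlin x0 y2 =
  (A x0 (y1 - y2) - A (j y1) (y1 - y2)) - (A (j y1) y2 - A (j y2) y2) +
  (F1 (j y1) - F1 (j y2)) + (F2 (j y1) - F2 (j y2)).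
  have aux (a b c a' b' c' f f' g g' : E0) : a - b + f + g - (a' - b' + f' + g') =
     (a - a') - (b - c) - (c - b') + (f - f') + (g - g') by modring R.
  have lA x : A x (y1 - y2) = A x y1 - A x y2 by exact: linearB.
  rewrite /nonlin !lA. exact: aux.
set u1 := A x0 _ - _ in a1 *; set u2 := A (j y1) y2 - _ in a2 *.
set u3 := F1 _ - _ in f1 *; set u4 := F2 _ - _ in f2 *.
have tri : `|u1 - u2 + u3 + u4| <= `|u1| + `|u2| + `|u3| + `|u4|.
  have := ler_normD (u1 - u2 + u3) u4; have := ler_normD (u1 - u2) u3.
  by have := ler_normB u1 u2; lra.
apply: (@le_trans _ _ (q * (`|u1| + `|u2| + `|u3| + `|u4|))); first by rewrite ler_pM2l.
have b1 : q * `|u1| <= L * e * D.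
  apply: (@le_trans _ _ (q * (L * nrm (x0 - j y1) * `|y1 - y2|))); first by rewrite ler_pM2l.
  have -> : q * (L * nrm (x0 - j y1) * `|y1 - y2|) =
    L * nrm (x0 - j y1) * (q * `|y1 - y2|) by ring.
  rewrite /nrm interp_normB -/(nrm _).
  by apply: ler_pM => //; [exact: mulr_ge0|rewrite mulr_ge0 // ltW|exact: ler_wpM2l].
have b2 : q * `|u2| <= L * e * D.
  apply: (@le_trans _ _ (q * (L * nrm (j y1 - j y2) * `|y2|))); first by rewrite ler_pM2l.
  have -> : q * (L * nrm (j y1 - j y2) * `|y2|) = L * ((q * `|y2|) * nrm (j y1 - j y2)).
    by ring.
  rewrite -[leRHS]mulrA; apply: ler_wpM2l => //; apply: ler_pM => //.
  by rewrite mulr_ge0 // ltW.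
have b3 : q * `|u3| <= L * e * D.
  have -> : L * e * D = e * (L * D) by ring.
  apply: ler_pM => //; first exact: ltW.
  by apply: (le_trans f1); exact: ler_wpM2l.
have b4 : q * `|u4| <= k / 2 * D.
  apply: (le_trans f2); apply: ler_wpM2r => //.
  have C1 : 0 < C + 1 by lra.
  have := Hd e (ltW e0) ed; rewrite ler_pdivlMr // => h.
  apply: le_trans h; rewrite mulrC; apply: ler_wpM2l; first exact: powR_ge0.
  by rewrite lerDl.
have b5 : L * e * D <= k / 6 * D.
  apply: ler_wpM2r => //; have L1 : 0 < L + 1 by lra.
  move: ek; rewrite ler_pdivlMr // => h; apply: le_trans h.
  by rewrite mulrC; apply: ler_wpM2l; [exact: ltW|rewrite lerDl].
apply: (@le_trans _ _ (3 * (k / 6 * D) + k / 2 * D)).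
  have -> : 3 * (k / 6 * D) = k / 6 * D + k / 6 * D + k / 6 * D by ring.
  rewrite !mulrDr; apply: lerD => //.
  by apply: lerD; [apply: lerD|]; apply: le_trans b5.
by have -> : 3 * (k / 6 * D) + k / 2 * D = k * D by field.
Qed.

End Nonlinearity.

(** * Gluing along an overlap *)

Definition splice {R : realType} {X : Type} (T s : R) (u v : R -> X) (r : R) : X :=
  if r <= T then u r else v (r - s).

Section Splice.
Context {R : realType} {E : normedModType R} (T1 T2 s : R).
Context (sT : 0 <= s < T1) (u1 u2 : R -> E).
Context (agree : forall r, s < r <= T1 -> r <= s + T2 -> u1 r = u2 (r - s)).

Lemma splice_left r : r <= T1 -> splice T1 s u1 u2 r = u1 r.
Proof. by rewrite /splice => ->. Qed.

Lemma splice_right r : s < r <= s + T2 -> splice T1 s u1 u2 r = u2 (r - s).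
Proof. by rewrite /splice => rs; case: leP => // rT; apply: agree; lra. Qed.

Lemma contI_splice t : 0 < t <= s + T2 ->
  (forall r, 0 < r <= T1 -> contI T1 u1 r) -> (forall r, 0 < r <= T2 -> contI T2 u2 r) ->
  contI (s + T2) (splice T1 s u1 u2) t.
Proof.
have sT' := sT => tT c1 c2 e e0; have [tT1|T1t] := ltP t T1.
  have [|r r0 H] := c1 t _ e e0; first lra.
  exists (Num.min r (T1 - t)); first by rewrite lt_min r0; lra.
  move=> q qT; rewrite lt_min => /andP[qr]; rewrite ltr_norml => qt.
  by rewrite !splice_left; [apply: H => //; lra|lra|lra].
have [|r r0 H] := c2 (t - s) _ e e0; first lra.
exists (Num.min r (t - s)); first by rewrite lt_min r0; lra.
move=> q qT; rewrite lt_min => /andP[qr]; rewrite ltr_norml => qt.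
rewrite !splice_right; [apply: H; first lra|lra|lra].
by have -> : q - s - (t - s) = q - t by ring.
Qed.

Lemma derI_splice t l : 0 < t <= s + T2 ->
  (t < T1 -> derI T1 u1 t l) -> (T1 <= t -> derI T2 u2 (t - s) l) ->
  derI (s + T2) (splice T1 s u1 u2) t l.
Proof.
have sT' := sT => tT d1 d2 e e0; have [tT1|T1t] := ltP t T1.
  have [r r0 H] := d1 tT1 e e0.
  exists (Num.min r (T1 - t)); first by rewrite lt_min r0; lra.
  move=> q qT; rewrite lt_min => /andP[qr]; rewrite ltr_norml => qt.
  by rewrite !splice_left; [apply: H => //; lra|lra|lra].
have [r r0 H] := d2 T1t e e0.
exists (Num.min r (t - s)); first by rewrite lt_min r0; lra.
move=> q qT; rewrite lt_min => /andP[qr]; rewrite ltr_norml => qt.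
rewrite !splice_right; [|lra|lra].
have qE : q - t = q - s - (t - s) by ring.
by rewrite qE; apply: H; [lra|rewrite -qE].
Qed.

Lemma wcont_splice mu : wcont mu T1 u1 -> wcont mu T2 u2 ->
  wcont mu (s + T2) (splice T1 s u1 u2).
Proof.
have sT' := sT => -[c1 z1] [c2 _]; split=> [t tT|e e0]; first exact: contI_splice.
have [r r0 H] := z1 e e0; exists (Num.min r T1); first by rewrite lt_min r0; lra.
move=> t tT; rewrite lt_min => /andP[tr tT1]; rewrite splice_left ?(ltW tT1) //.
by apply: H => //; lra.
Qed.

End Splice.

(** * Solutions of the quasilinear problem *)

(** Iterating an estimate that improves a bound [c] to [c / 2 + K]; the last term
    disappears in the limit, where [B] itself need not be closed. *)
Lemma halving {R : realType} (B : R -> Prop) (c K : R) : 0 <= c -> 0 <= K -> B c ->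
  (forall c c', c <= c' -> B c -> B c') ->
  (forall c, 0 <= c -> B c -> B (c / 2 + K)) -> forall n, B (2 * K + c / 2 ^+ n).
Proof.
move=> c0 K0 Bc mono H; elim=> [|n IH]; first by apply: mono Bc; rewrite expr0; lra.
have q0 : 0 <= (2 ^+ n)^-1 :> R by rewrite invr_ge0 exprn_ge0.
apply: mono (H _ _ IH); last by rewrite addr_ge0 ?mulr_ge0.
by rewrite exprS invfM; lra.
Qed.


Section Quasilinear.
Context {R : realType} {E0 E1 : completeNormedModType R} (j : {linear E1 -> E0}).
Context (mu : R) (Hj : banach_couple j) (mu01 : 0 < mu < 1).
Context (V : set E0) (A : E0 -> {linear E1 -> E0}) (F1 F2 : E0 -> E0).
Context (HV : interp_open j mu V) (H1 : hypothesis1 j mu V A F1)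
  (H2 : hypothesis2 j mu V F2).
Implicit Types (x : E0) (v d : R -> E0) (y : R -> E1) (t T : R).

Let nrm x := interp_norm j mu x.
Let nl := nonlin j A F1 F2.
Let cV x : V x -> cinterp j mu x. Proof. exact: HV.1. Qed.

Definition sol T x v y d := [/\ 0 < T, reg j mu T v y d,
  forall t, 0 <= t <= T -> V (v t),
  forall t, 0 < t <= T -> d t + A (v t) (y t) = F1 (v t) + F2 (v t) & v 0 = x].

Lemma sol_solution T x v y d : sol T x v y d -> solution j mu V A F1 F2 T x v.
Proof.
move=> [T0 rv Vv eqn v0]; have [h1 h2] := reg_E1mu j mu Hj mu01 T v y d T0 rv.
by split=> // t tT; have [-> ->] := h2 t tT; exact: eqn.
Qed.

Lemma solution_sol T x v : solution j mu V A F1 F2 T x v ->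
  sol T x v (linv j \o v) (ddt T v).
Proof. by move=> [T0 /(E1mu_reg j mu Hj mu01 T v T0) rv Vv eqn v0]. Qed.

Lemma sol_restrict S T x v y d : 0 < S <= T -> sol T x v y d -> sol S x v y d.
Proof.
move=> ST [T0 rv Vv eqn v0]; split=> //; first lra.
- by apply: (reg_restrict j mu T) => //; lra.
- by move=> t tS; apply: Vv; lra.
- by move=> t tS; apply: eqn; lra.
Qed.

Lemma sol_shift s T x v y d : 0 <= s < T -> sol T x v y d ->
  sol (T - s) (v s) (fun t => v (s + t)) (fun t => y (s + t)) (fun t => d (s + t)).
Proof.
move=> sT [T0 rv Vv eqn v0]; split; first lra.
- have [->|sn] := eqVneq s 0.
    by rewrite subr0; apply: (reg_ext _ _ _ _ _ _ _ _ _ rv) => t tT; rewrite add0r.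
  by apply: reg_shift => //; rewrite lt_neqAle eq_sym sn; lra.
- by move=> t tS; apply: Vv; lra.
- by move=> t tS; apply: eqn; lra.
- by rewrite addr0.
Qed.

Lemma sol_linsol x0 T x v y d : sol T x v y d ->
  linsol j mu T (A x0) (fun t => nl x0 (y t)) x v y d.
Proof.
move=> [T0 rv Vv eqn v0]; split=> // t tT; have [_ _ vy _ _] := rv.
have aux (a b c f g : E0) : a + b = f + g -> a + c = c - b + f + g.
  move=> h; have -> : a = f + g - b by rewrite -h addrK.
  modring R.
by rewrite /nl /nonlin -vy //; apply: aux; exact: eqn.
Qed.

(** The region in which the nonlinear terms are controlled; by the little-o
    condition at 0 every solution is in it for a short time. *)
Definition stays_close T x0 (e : R) v y := forall t, 0 < t <= T ->
  nrm (v t - x0) <= e /\ t `^ (1 - mu) * `|y t| <= e.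

Lemma reg_close T v y d x0 e : 0 < T -> reg j mu T v y d -> v 0 = x0 -> 0 < e ->
  exists2 S, 0 < S & forall S', 0 < S' <= T -> S' <= S -> stays_close S' x0 e v y.
Proof.
move=> T0 rv v0 e0; have [cy _ _ _ _] := rv.
have [|r r0 H] := reg_interp_cont j mu Hj mu01 T v y d 0 e T0 rv _ e0; first lra.
have [r' r'0 H'] := cy.2 e e0.
exists (Num.min (r / 2) (r' / 2)); first by rewrite lt_min; lra.
move=> S' S'T; rewrite le_min => /andP[Sr Sr'] t tS; split; last by apply: H'; lra.
rewrite -v0; apply: interp_le_norm; apply: H; first lra.
by rewrite subr0 gtr0_norm; lra.
Qed.

Lemma nonlin_change x0 z (p : E1) : nl x0 p = nl z p + (A x0 p - A z p).
Proof.
have aux (a b c f g : E0) : a - b + f + g = c - b + f + g + (a - c) by modring R.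
exact: aux.
Qed.

(** At [t > 0] the estimate of the nonlinear terms is applied around the state
    [v t]; at 0 it is applied around [v 0], against a constant in [E1], and the
    change of linearization point costs a bounded operator acting on [y], whose
    weighted norm tends to 0. *)
Lemma nonlin_wcont x0 T v y d : V x0 -> 0 < T -> reg j mu T v y d ->
  (forall t, 0 <= t <= T -> V (v t)) -> wcont mu T (fun t => nl x0 (y t)).
Proof.
have /andP[mu0 mu1] := mu01 => Vx0 T0 rv Vv; have [cy cd vy _ _] := rv.
have aux (a b : E0) : -1 *: a + b = b - a by modring R.
have lin z t : V z -> contI T y t -> contI T (fun s => A x0 (y s) - A z (y s)) t.
  move=> Vz ct.
  have [K _ HK] := continuous_linear_le _ (H1.1 x0 Vx0).1.
  have [K' _ HK'] := continuous_linear_le _ (H1.1 z Vz).1.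
  have := contI_lin T (-1) _ _ t (contI_linear T y t (A z) K' HK' ct)
     (contI_linear T y t (A x0) K HK ct).
  move=> c; apply: (contI_local T T _ _ t 1 _ _ _ c) => //=.
  by move=> s sT _ /=; split; [lra|exact: aux].
split=> [t tT|e e0].
- have Vz : V (v t) by apply: Vv; lra.
  have ct := cy.1 t tT.
  suff c : contI T (fun s => nl (v t) (y s)) t.
    have := contI_lin T 1 _ _ t c (lin _ _ Vz ct).
    move=> h; apply: (contI_local T T _ _ t 1 _ _ _ h) => //.
      by rewrite scale1r -nonlin_change.
    by move=> s sT _; split; [lra|rewrite scale1r -nonlin_change].
  have [e [e0 e1 _ He]] := nonlin_lipschitz j mu Hj mu01 V A F1 F2 HV H1 H2 (v t) 1 Vz ltr01.
  have y1 : 0 < `|y t| + 1 by have := normr_ge0 (y t); lra.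
  pose q := Num.min e (e / (`|y t| + 1)).
  have q0 : 0 < q by rewrite lt_min e0 divr_gt0.
  have [qe] : q <= e /\ q <= e / (`|y t| + 1) by rewrite !ge_min !lexx orbT.
  rewrite ler_pdivlMr // => qy.
  clearbody q.
  move=> k k0; have qk : 0 < q * k by rewrite mulr_gt0.
  have [||r r0 Hr] := reg_interp_cont j mu Hj mu01 T v y d t (Num.min e (q * k)) T0 rv _ _;
    [lra|by rewrite lt_min e0|].
  have [|r' r'0 Hr'] := ct (Num.min 1 k); first by rewrite lt_min ltr01.
  exists (Num.min r r'); first by rewrite lt_min r0.
  move=> s sT; rewrite lt_min => /andP[sr sr'].
  have := Hr' s sT sr'; rewrite le_min => /andP[h1 h2].
  have := interp_le_norm _ _ _ _ (Hr s (ltac:(lra)) sr).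
  rewrite -/(nrm _) le_min => /andP[h3 h4].
  rewrite -(ler_pM2l q0) -[leRHS]mul1r; apply: He.
  + by rewrite q0.
  + by rewrite -vy.
  + by rewrite -vy // subrr; apply/interp_le_norm/interp_le0/ltW.
  + apply: le_trans qy; rewrite ler_pM2l //.
    have -> : y s = y t + (y s - y t) by modring R.
    by apply: (le_trans (ler_normD _ _)); lra.
  + by apply: le_trans qy; rewrite ler_pM2l //; lra.
  + by rewrite -!vy.
  + by rewrite ler_pM2l.
- have Vz : V (v 0) by apply: Vv; lra.
  have k0 : 0 < e / 8 by lra.
  have [r [r0 r1 _ Hr]] := nonlin_lipschitz j mu Hj mu01 V A F1 F2 HV H1 H2 (v 0) (e / 8) Vz k0.
  have [_ /(_ r r0) [b hb]] := iffLR (cinterpP j mu (v 0)) (cV _ Vz).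
  have [K K0 HK] := continuous_linear_le _ (H1.1 x0 Vx0).1.
  have [K' K'0 HK'] := continuous_linear_le _ (H1.1 (v 0) Vz).1.
  have [S S0 HS] := reg_close T v y d (v 0) r T0 rv erefl r0.
  have [|S' S'0 HS'] := cy.2 (e / 4 / (K + K')); first by rewrite !divr_gt0 //; lra.
  have b1 : 0 < `|b| + 1 by have := normr_ge0 b; lra.
  have n1 : 0 < `|nl (v 0) b| + 1 by have := normr_ge0 (nl (v 0) b); lra.
  have q0 : 0 < Num.min r (Num.min (r / (`|b| + 1)) (e / 4 / (`|nl (v 0) b| + 1))).
    by rewrite !lt_min r0 !divr_gt0 //; lra.
  have [p p0 Hp] := @powR_small R (1 - mu) _ (ltac:(lra)) q0.
  exists (Num.min S (Num.min S' p)); first by rewrite !lt_min S0 S'0.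
  move=> t tT; rewrite !lt_min => /andP[tS /andP[tS' tp]].
  have := Hp t (ltac:(lra)) (ltW tp); rewrite !le_min => /andP[q1 /andP[]].
  rewrite ler_pdivlMr // => q2; rewrite ler_pdivlMr // => q3.
  have [c1 c2] := HS t (ltac:(lra)) (ltW tS) t (ltac:(lra)).
  have c3 := HS' t tT tS'.
  have wt0 : 0 < t `^ (1 - mu) by rewrite powR_gt0; lra.
  have hb' : nrm (j b - v 0) <= r.
    by rewrite /nrm interp_normB; exact: interp_le_norm.
  have qb : t `^ (1 - mu) * `|b| <= r by apply: le_trans q2; rewrite ler_pM2l //; lra.
  have cvt : cinterp j mu (v t) by apply: cV; apply: Vv; lra.
  have cb : cinterp j mu (j b) by apply: cinterp_j => //; case/andP: mu01 => /ltW -> /ltW ->.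
  have qr : 0 < t `^ (1 - mu) <= r by rewrite wt0.
  have D1 : nrm (v t - j b) <= 2 * r.
    apply: (le_trans (interp_dist j mu _ (v 0) _ cvt (cV _ Vz) cb)).
    by rewrite [interp_norm j mu (v 0 - _)]interp_normB -!/(nrm _); lra.
  have D2 : t `^ (1 - mu) * `|y t - b| <= 2 * r.
    apply: (@le_trans _ _ (t `^ (1 - mu) * (`|y t| + `|b|))).
      by rewrite ler_pM2l // ler_normB.
    by rewrite mulrDr; lra.
  rewrite vy // in c1 D1.
  have := Hr _ _ _ _ qr c1 hb' c2 qb D1 D2.
  rewrite -/nl (nonlin_change x0 (v 0)) => h.
  have -> : nl (v 0) (y t) = (nl (v 0) (y t) - nl (v 0) b) + nl (v 0) b by modring R.
  set X := nl (v 0) (y t) - _ in h *; set N := nl (v 0) b in q3 n1 *; set Z := A x0 (y t) - _.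
  have tri : `|X + N + Z| <= `|X| + `|N| + `|Z|.
    by have := ler_normD (X + N) Z; have := ler_normD X N; lra.
  apply: (@le_trans _ _ (t `^ (1 - mu) * (`|X| + `|N| + `|Z|))); first by rewrite ler_pM2l.
  have hZ : `|Z| <= (K + K') * `|y t|.
    apply: (le_trans (ler_normB _ _)); rewrite mulrDl.
    by have := HK (y t); have := HK' (y t); lra.
  have KK : 0 < K + K' by lra.
  have hZ' : t `^ (1 - mu) * `|Z| <= e / 4.
    move: c3; rewrite ler_pdivlMr // => c3; apply: le_trans c3.
    by rewrite -mulrA ler_pM2l // mulrC.
  have hN : t `^ (1 - mu) * `|N| <= e / 4 by apply: le_trans q3; rewrite ler_pM2l //; lra.
  rewrite !mulrDr; have : e / 8 * (2 * r) <= e / 4 by nra.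
  lra.
Qed.

End Quasilinear.

(** * Uniqueness and continuation *)

Section Uniqueness.
Context {R : realType} {E0 E1 : completeNormedModType R} (j : {linear E1 -> E0}).
Context (mu : R) (Hj : banach_couple j) (mu01 : 0 < mu < 1).
Context (V : set E0) (A : E0 -> {linear E1 -> E0}) (F1 F2 : E0 -> E0).
Context (HV : interp_open j mu V) (H1 : hypothesis1 j mu V A F1)
  (H2 : hypothesis2 j mu V F2).
Implicit Types (x : E0) (v d : R -> E0) (y : R -> E1) (t T : R).

Let nrm x := interp_norm j mu x.
Let nl := nonlin j A F1 F2.
Let cV x : V x -> cinterp j mu x. Proof. exact: HV.1. Qed.
Let sol := sol j mu V A F1 F2.

(** With the nonlinear terms as data the linear estimate bounds the difference
    of two solutions by a small multiple of itself and of [x1 - x2]. *)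
Lemma sol_lipschitz x0 T M k e S x1 x2 v1 y1 d1 v2 y2 d2 :
  0 < M -> 0 <= k -> M * k * (2 + mu^-1) <= 1 / 2 ->
  (forall S f x v y d c, 0 < S <= T -> 0 < c -> linsol j mu S (A x0) f x v y d ->
      wbound mu S f c -> interp_le j mu x c ->
      wbound mu S y (M * c) /\ wbound mu S d (M * c)) ->
  (forall q D z1 z2, 0 < q <= e ->
    nrm (j z1 - x0) <= e -> nrm (j z2 - x0) <= e ->
    q * `|z1| <= e -> q * `|z2| <= e ->
    nrm (j z1 - j z2) <= D -> q * `|z1 - z2| <= D ->
    q * `|nl x0 z1 - nl x0 z2| <= k * D) ->
  0 < S <= T -> S `^ (1 - mu) <= e -> sol S x1 v1 y1 d1 -> sol S x2 v2 y2 d2 ->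
  stays_close j mu S x0 e v1 y1 -> stays_close j mu S x0 e v2 y2 ->
  wbound mu S (fun t => y1 t - y2 t) (2 * M * (k + 1) * nrm (x1 - x2)) /\
  wbound mu S (fun t => d1 t - d2 t) (2 * M * (k + 1) * nrm (x1 - x2)).
Proof.
have /andP[mu0 mu1] := mu01 => M0 k0 Mk lin_le nl_le ST Se s1 s2 c1 c2.
have mi : 0 < mu^-1 by rewrite invr_gt0.
have l1 := sol_linsol j mu V A F1 F2 x0 S x1 v1 y1 d1 s1.
have l2 := sol_linsol j mu V A F1 F2 x0 S x2 v2 y2 d2 s2.
have ld := linsolB j mu S _ _ _ _ _ _ _ _ _ _ _ l1 l2.
have [S0 r1 V1 _ v10] := s1; have [_ r2 V2 _ v20] := s2.
have rd := regB j mu S _ _ _ _ _ _ r1 r2.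
have [cyd cdd _ _ _] := rd.
set N := nrm (x1 - x2).
have cx : cinterp j mu (x1 - x2).
  by apply: cinterpB; apply: cV; [rewrite -v10|rewrite -v20]; [apply: V1|apply: V2]; lra.
have N0 : 0 <= N by exact: interp_norm_ge0.
pose B c := wbound mu S (fun t => y1 t - y2 t) c /\ wbound mu S (fun t => d1 t - d2 t) c.
have [a a0 ya] := wcont_bounded mu mu01 S _ (ltW S0) cyd.
have [b b0 db] := wcont_bounded mu mu01 S _ (ltW S0) cdd.
have Bab : B (a + b).
  by split; [apply: wbound_le ya|apply: wbound_le db]; rewrite ?lerDl ?lerDr ltW.
have step c : 0 <= c -> B c -> B (c / 2 + M * (k + 1) * N).
  move=> c0 [yc dc].
  pose D := (2 + mu^-1) * c + N.
  have D0 : 0 <= D by rewrite /D addr_ge0 // mulr_ge0 // addr_ge0 // ltW.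
  have nD t : 0 <= t <= S -> nrm (v1 t - v2 t) <= D.
    move=> tS; apply: interp_le_norm.
    have -> : v1 t - v2 t = ((v1 t - v2 t) - (v1 0 - v2 0)) + (x1 - x2).
      by rewrite v10 v20; modring R.
    apply: interp_leD; last exact: cinterp_norm.
    exact: (reg_trace j mu mu01 S _ _ _ c t S0 rd yc dc tS).
  have cD : c <= D.
    have -> : D = c + (c + mu^-1 * c + N) by rewrite /D; ring.
    by rewrite lerDl !addr_ge0 // mulr_ge0 // ltW.
  have fb : wbound mu S (fun t => nl x0 (y1 t) - nl x0 (y2 t)) (k * D).
    move=> t tS; have [n1 q1] := c1 t tS; have [n2 q2] := c2 t tS.
    have t0 : 0 < t by lra.
    have [_ _ /(_ t tS) e1 _ _] := r1; have [_ _ /(_ t tS) e2 _ _] := r2.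
    have nDt := nD t (ltac:(lra)).
    rewrite e1 in n1 nDt; rewrite e2 in n2 nDt.
    apply: nl_le => //; last exact: le_trans (yc t tS) cD.
    rewrite powR_gt0 //=; apply: le_trans Se; apply: powR_incr; lra.
  have small dl : 0 < dl -> B (M * (k * D + N + dl)).
    move=> dl0; have kD : 0 <= k * D by rewrite mulr_ge0.
    apply: (lin_le S _ _ _ _ _ _ ST _ ld).
    - by lra.
    - by apply: wbound_le fb; lra.
    - by apply: interp_le_trans (cinterp_norm _ _ _ cx); rewrite -/(nrm _) -/N; lra.
  have lim : B (M * (k * D + N)).
    have gen (E : normedModType R) (g : R -> E) :
        (forall dl, 0 < dl -> wbound mu S g (M * (k * D + N + dl))) ->
        wbound mu S g (M * (k * D + N)).
      move=> h t tS; apply/ler_addgt0Pr => dl dl0.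
      apply: (le_trans (h (dl / M) (divr_gt0 dl0 M0) t tS)).
      by rewrite [leLHS]mulrDr lerD2l mulrC divfK // gt_eqF.
    by split; apply: gen => dl /small [].
  have le : M * (k * D + N) <= c / 2 + M * (k + 1) * N.
    have -> : M * (k * D + N) = M * k * (2 + mu^-1) * c + M * (k + 1) * N.
      by rewrite /D; ring.
    by rewrite lerD2r [c / 2]mulrC -[2^-1]mul1r ler_wpM2r.
  by case: lim => h1 h2; split; apply: wbound_le le _.
have MkN : 0 <= M * (k + 1) * N by rewrite !mulr_ge0 ?addr_ge0 // ltW.
have fin : forall n, B (2 * (M * (k + 1) * N) + (a + b) / 2 ^+ n).
  apply: halving => //; first by rewrite addr_ge0 // ltW.
  by move=> c c' cc [h1 h2]; split; apply: wbound_le cc _.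
have -> : 2 * M * (k + 1) * N = 2 * (M * (k + 1) * N) by ring.
split=> t tS; apply: (@le_geometric _ _ _ (a + b)) => n.
  by have [h _] := fin n; exact: h.
by have [_ h] := fin n; exact: h.
Qed.

Lemma local_uniqueness T x v1 y1 d1 v2 y2 d2 : sol T x v1 y1 d1 -> sol T x v2 y2 d2 ->
  exists2 S, 0 < S & forall t, 0 <= t <= T -> t <= S -> v1 t = v2 t.
Proof.
have /andP[mu0 mu1] := mu01 => s1 s2.
have mi : 0 < 2 + mu^-1 by rewrite addr_gt0 // invr_gt0.
have [T0 r1 V1 _ v10] := s1; have [_ r2 _ _ v20] := s2.
have Vx : V x by rewrite -v10; apply: V1; lra.
have [T1 [M [T10 M0 _ lin_le]]] := Mmu_estimate j mu Hj mu01 (A x) (H1.1 x Vx).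
pose k := (2 * M * (2 + mu^-1))^-1.
have k0 : 0 < k by rewrite invr_gt0 !mulr_gt0.
have [e [e0 e1 _ nl_le]] := nonlin_lipschitz j mu Hj mu01 V A F1 F2 HV H1 H2 x k Vx k0.
have [S1 S10 cl1] := reg_close j mu Hj mu01 T v1 y1 d1 x e T0 r1 v10 e0.
have [S2 S20 cl2] := reg_close j mu Hj mu01 T v2 y2 d2 x e T0 r2 v20 e0.
have [S3 S30 cl3] := @powR_small R (1 - mu) e (ltac:(by rewrite subr_gt0)) e0.
pose S := Num.min T (Num.min T1 (Num.min S1 (Num.min S2 S3))).
have S0 : 0 < S by rewrite !lt_min T0 T10 S10 S20 S30.
have [ST [ST1 [SS1 [SS2 SS3]]]] : S <= T /\ S <= T1 /\ S <= S1 /\ S <= S2 /\ S <= S3.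
  by rewrite !ge_min !lexx !orbT.
clearbody S.
have S0T : 0 < S <= T by rewrite S0.
have S0T1 : 0 < S <= T1 by rewrite S0.
have r1' := sol_restrict j mu V A F1 F2 S T x v1 y1 d1 S0T s1.
have r2' := sol_restrict j mu V A F1 F2 S T x v2 y2 d2 S0T s2.
have Mk : M * k * (2 + mu^-1) <= 1 / 2.
  rewrite /k le_eqVlt; apply/orP; left; apply/eqP; field.
  by rewrite (gt_eqF M0) (gt_eqF mu0) /= gt_eqF // addr_gt0 // mulr_gt0.
have [yb _] := sol_lipschitz x T1 M k e S x x v1 y1 d1 v2 y2 d2 M0 (ltW k0) Mk lin_le
  nl_le S0T1 (cl3 S (ltW S0) SS3) r1' r2' (cl1 S S0T SS1) (cl2 S S0T SS2).
have xx : nrm (x - x) = 0.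
  apply/eqP; rewrite eq_le interp_norm_ge0 andbT subrr.
  by apply/interp_le_norm/interp_le0.
exists S => // t tT tS; have [->|t0] := eqVneq t 0; first by rewrite v10 v20.
have t0' : 0 < t by rewrite lt_neqAle eq_sym t0; case/andP: tT.
have tS' : 0 < t <= S by rewrite t0'.
have := yb t tS'; rewrite xx mulr0 pmulr_rle0 ?powR_gt0 // normr_le0 subr_eq0 => /eqP yE.
have tT' : 0 < t <= T by rewrite t0'; case/andP: tT.
by have [_ _ /(_ t tT') -> _ _] := r1; have [_ _ /(_ t tT') -> _ _] := r2; rewrite yE.
Qed.

(** The set of times up to which two solutions agree is closed by continuity and
    open to the right because a solution can be restarted at any time. *)
Lemma sol_unique T x v1 y1 d1 v2 y2 d2 : sol T x v1 y1 d1 -> sol T x v2 y2 d2 ->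
  forall t, 0 <= t <= T -> v1 t = v2 t.
Proof.
move=> s1 s2; have [T0 r1 _ _ v10] := s1; have [_ r2 _ _ v20] := s2.
suff H : forall s, 0 <= s <= T -> v1 s = v2 s by [].
apply: (@real_induction_closed R (fun t => forall s, 0 <= s <= t -> v1 s = v2 s) 0 T).
- exact: ltW.
- by move=> s s0; have -> : s = 0 by [lra]; rewrite v10 v20.
- by move=> s t st tT H r rs; apply: H; lra.
- move=> c cT H s sc; have [sltc|cles] := ltP s c.
    by apply: (H s); lra.
  have -> : s = c by lra.
  have [_ _ _ /(_ c cT) D1 _] := r1; have [_ _ _ /(_ c cT) D2 _] := r2.
  apply/eqP; rewrite -subr_eq0 -normr_le0; apply/ler_addgt0Pr => e e0; rewrite add0r.
  have [|a a0 Ha] := derI_contI _ _ _ _ D1 (e / 2); first lra.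
  have [|b b0 Hb] := derI_contI _ _ _ _ D2 (e / 2); first lra.
  pose h := Num.min (c / 2) (Num.min (a / 2) (b / 2)).
  have h0 : 0 < h by rewrite !lt_min; lra.
  have [hc [ha hb]] : h <= c / 2 /\ h <= a / 2 /\ h <= b / 2.
    by rewrite !ge_min !lexx !orbT.
  have E : `|c - h - c| = h by rewrite addrAC subrr add0r normrN gtr0_norm.
  have h1 := Ha (c - h) (ltac:(lra)) (ltac:(rewrite E; lra)).
  have h2 := Hb (c - h) (ltac:(lra)) (ltac:(rewrite E; lra)).
  have eqh : v1 (c - h) = v2 (c - h) by apply: (H (c - h)); lra.
  have -> : v1 c - v2 c = (v2 (c - h) - v2 c) - (v1 (c - h) - v1 c).
    by rewrite eqh; modring R.
  by apply: (le_trans (ler_normB _ _)); lra.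
- move=> c cT H.
  have cc : v1 c = v2 c by apply: H; lra.
  have sh1 := sol_shift j mu mu01 V A F1 F2 c T x v1 y1 d1 cT s1.
  have sh2 := sol_shift j mu mu01 V A F1 F2 c T x v2 y2 d2 cT s2.
  rewrite -cc in sh2.
  have [S S0 HS] := local_uniqueness _ _ _ _ _ _ _ _ sh1 sh2.
  exists S => // t tT tS s st; have [sc|cs] := leP s c; first by apply: H; lra.
  by have := HS (s - c) (ltac:(lra)) (ltac:(lra)); rewrite addrC subrK.
Qed.

(** Restarting at time [s] before the end [T1] leaves an overlap, on which the
    two solutions agree by uniqueness; gluing there creates no singularity. *)
Lemma sol_splice T1 T2 s x v1 y1 d1 v2 y2 d2 : 0 <= s < T1 -> 
  sol T1 x v1 y1 d1 -> sol T2 (v1 s) v2 y2 d2 ->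
  exists y d, sol (s + T2) x (splice T1 s v1 v2) y d.
Proof.
move=> sT1 s1 s2; have [T10 r1 V1 q1 v10] := s1; have [T20 r2 V2 q2 v20] := s2.
have sh := sol_shift j mu mu01 V A F1 F2 s T1 x v1 y1 d1 sT1 s1.
pose S := Num.min (T1 - s) T2.
have S0 : 0 < S by rewrite lt_min T20; lra.
have [S1 S2] : S <= T1 - s /\ S <= T2 by rewrite !ge_min !lexx !orbT.
have agree r : 0 <= r -> r <= T1 - s -> r <= T2 -> v1 (s + r) = v2 r.
  move=> r0 rT1 rT2.
  have S01 : 0 < S <= T1 - s by rewrite S0.
  have S02 : 0 < S <= T2 by rewrite S0.
  apply: (sol_unique S (v1 s) _ _ _ v2 y2 d2
    (sol_restrict j mu V A F1 F2 S _ _ _ _ _ S01 sh)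
    (sol_restrict j mu V A F1 F2 S _ _ _ _ _ S02 s2)).
  by rewrite r0 /= le_min rT1.
have vv r : s < r <= T1 -> r <= s + T2 -> v1 r = v2 (r - s).
  move=> rs rT; have := agree (r - s) (ltac:(lra)) (ltac:(lra)) (ltac:(lra)).
  by rewrite addrC subrK.
have [jinj _ _] := Hj.
have [cy1 cd1 vy1 D1 z1] := r1; have [cy2 cd2 vy2 D2 z2] := r2.
have yy r : s < r <= T1 -> r <= s + T2 -> y1 r = y2 (r - s).
  by move=> rs rT; apply: jinj; rewrite -vy1 -?vy2 ?vv //; lra.
have dd r : s < r <= T1 -> r <= s + T2 -> d1 r = d2 (r - s).
  move=> rs rT; have := q1 r (ltac:(lra)); have := q2 (r - s) (ltac:(lra)).
  by rewrite -vv // -yy // => <- /addIr.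
exists (splice T1 s y1 y2), (splice T1 s d1 d2).
have gl X (u w : R -> X) r : r <= T1 -> splice T1 s u w r = u r by move=> rT; rewrite /splice rT.
have gr X (u w : R -> X) r : T1 < r -> splice T1 s u w r = w (r - s).
  by rewrite /splice leNgt => ->.
split; first lra.
- split.
  + exact: wcont_splice.
  + exact: wcont_splice.
  + move=> t tT; have [tT1|tT1] := leP t T1; first by rewrite !gl // vy1 //; lra.
    by rewrite !gr // vy2 //; lra.
  + move=> t tT; apply: derI_splice => //.
      by move=> tT1; rewrite gl ?(ltW tT1) //; apply: D1; lra.
    move=> T1t; rewrite (splice_right _ _ _ _ _ dd); [apply: D2; lra|lra].
  + move=> e e0; have [r r0 H] := z1 e e0.
    exists (Num.min r T1); first by rewrite lt_min r0.
    move=> t tT; rewrite lt_min => /andP[tr tT1].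
    by rewrite !gl //; [apply: H => //; lra|lra|lra].
- move=> t tT; have [tT1|tT1] := leP t T1; first by rewrite gl //; apply: V1; lra.
  by rewrite gr //; apply: V2; lra.
- move=> t tT; have [tT1|tT1] := leP t T1; first by rewrite !gl //; apply: q1; lra.
  by rewrite !gr //; apply: q2; lra.
- by rewrite gl //; lra.
Qed.

End Uniqueness.

(** * Local existence *)

Section LocalExistence.
Context {R : realType} {E0 E1 : completeNormedModType R} (j : {linear E1 -> E0}).
Context (mu : R) (Hj : banach_couple j) (mu01 : 0 < mu < 1).
Context (V : set E0) (A : E0 -> {linear E1 -> E0}) (F1 F2 : E0 -> E0).
Context (HV : interp_open j mu V) (H1 : hypothesis1 j mu V A F1)
  (H2 : hypothesis2 j mu V F2).
Implicit Types (x : E0) (v d : R -> E0) (y : R -> E1) (t T : R).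

Let nrm x := interp_norm j mu x.
Let nl := nonlin j A F1 F2.
Let cV x : V x -> cinterp j mu x. Proof. exact: HV.1. Qed.
Let sol := sol j mu V A F1 F2.

(** Picard iteration on the right-hand side [f] of the linear problem
    [v' + A x0 v = f]: the map sends [f] to the nonlinear terms along the
    solution with data [f]. The solutions are compared with the solution of the
    homogeneous problem, which is small on short intervals, and the nonlinear
    terms with those of a constant in [E1] close to [x0]. *)
Lemma local_existence x0 : V x0 -> exists tau eps sigma e,
  [/\ 0 < tau, 0 < eps, 0 < sigma,
    forall x, interp_cball j mu x0 eps x -> exists v y d,
      sol tau x v y d /\ stays_close j mu tau x0 e v y &
    forall x1 x2 v1 y1 d1 v2 y2 d2, sol tau x1 v1 y1 d1 -> sol tau x2 v2 y2 d2 ->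
      stays_close j mu tau x0 e v1 y1 -> stays_close j mu tau x0 e v2 y2 ->
      wbound mu tau (fun t => y1 t - y2 t) (sigma * nrm (x1 - x2)) /\
      wbound mu tau (fun t => d1 t - d2 t) (sigma * nrm (x1 - x2))].
Proof.
have /andP[mu0 mu1] := mu01 => Vx0.
have mi : 0 < mu^-1 by rewrite invr_gt0.
pose c1 := 2 + mu^-1.
have c10 : 2 < c1 by rewrite /c1; lra.
have c1_ge1 : 1 <= c1 by lra.
have c1_gt0 : 0 < c1 by lra.
have small32 : 1 / 32 <= 2^-1 :> R by lra.
have [T [M [T0 M0 lin_ex lin_le]]] := Mmu_estimate j mu Hj mu01 (A x0) (H1.1 x0 Vx0).
pose k := (32 * c1 * M)^-1.
have k0 : 0 < k by rewrite invr_gt0 !mulr_gt0 //; lra.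
have kM : k * c1 * M = 1 / 32.
  by rewrite /k; field; rewrite (gt_eqF M0) /= gt_eqF //; lra.
have [e [e0 e1 closeV nl_le]] := nonlin_lipschitz j mu Hj mu01 V A F1 F2 HV H1 H2 x0 k Vx0 k0.
(* the trace estimate turns the bound [e'] on the solution into the bound [e / 2]
   on its distance in [E_mu] to the initial value *)
pose e' := e / (2 * c1).
have e'0 : 0 < e' by rewrite divr_gt0 //; lra.
have ce' : c1 * e' = e / 2 by rewrite /e'; field; rewrite gt_eqF //; lra.
have e'e : e' <= e / 2.
  by rewrite -ce'; have := ler_wpM2r (ltW e'0) (ltW c10); lra.
(* data of size [2 * c0] produce solutions of size [e' / 2] *)
pose c0 := e' / (4 * M).
have c00 : 0 < c0 by rewrite divr_gt0 // mulr_gt0.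
have c02 : 0 < c0 / 2 by rewrite divr_gt0.
have c20 : 0 < 2 * c0 by rewrite mulr_gt0.
have c0le : c0 <= 2 * c0 by rewrite ler_peMl ?ler1n // ltW.
have Mc0 : M * (2 * c0) = e' / 2 by rewrite /c0; field; rewrite gt_eqF.
have [b hb] : exists b, interp_le j mu (x0 - j b) e.
  by have [_ h] := iffLR (cinterpP j mu x0) (cV _ Vx0); exact: h.
have hb' : nrm (j b - x0) <= e by rewrite /nrm interp_normB; exact: interp_le_norm.
have nx0 : 0 <= nrm x0 by exact: interp_norm_ge0.
have [us [ys [ds [[rs us0 eqs] _ _]]]] : exists v y d,
    [/\ linsol j mu T (A x0) (fun=> 0) x0 v y d, wbound mu T y (M * (nrm x0 + 1)) &
        wbound mu T d (M * (nrm x0 + 1))].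
  have n1 : 0 < nrm x0 + 1 by lra.
  apply: lin_ex => //; [by rewrite T0 lexx|exact: wcont_cst| |exact: cV|].
    by move=> t _; rewrite normr0 mulr0 ltW.
  by apply: (interp_le_trans j _ _ _ _ _ (cinterp_norm j mu x0 (cV _ Vx0))); rewrite lerDl.
have [cys cds _ _ _] := rs.
have e'2 : 0 < e' / 2 by lra.
have [r1 r10 Hr1] := cys.2 _ e'2; have [r2 r20 Hr2] := cds.2 _ e'2.
have b1 : 0 < `|b| + 1 by have := normr_ge0 b; lra.
have n1 : 0 < `|nl x0 b| + 1 by have := normr_ge0 (nl x0 b); lra.
have w0 : 0 < Num.min e (Num.min (e / (`|b| + 1)) (c0 / 2 / (`|nl x0 b| + 1))).
  by rewrite !lt_min e0 (divr_gt0 e0 b1) (divr_gt0 _ n1) //; lra.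
have [r3 r30 Hr3] := @powR_small R (1 - mu) _ (ltac:(by rewrite subr_gt0)) w0.
pose tau := Num.min T (Num.min (r1 / 2) (Num.min (r2 / 2) r3)).
have tau0 : 0 < tau by rewrite !lt_min T0 r30; lra.
have [tauT [tau1 [tau2 tau3]]] : tau <= T /\ tau <= r1 / 2 /\ tau <= r2 / 2 /\ tau <= r3.
  by rewrite !ge_min !lexx !orbT.
clearbody tau.
have tT : 0 < tau <= T by rewrite tau0.
have [we wb wn] : [/\ forall t, 0 < t <= tau -> 0 < t `^ (1 - mu) <= e,
    forall t, 0 < t <= tau -> t `^ (1 - mu) * `|b| <= e &
    forall t, 0 < t <= tau -> t `^ (1 - mu) * `|nl x0 b| <= c0 / 2].
  have H t : 0 < t <= tau -> [/\ 0 < t `^ (1 - mu), t `^ (1 - mu) <= e,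
      t `^ (1 - mu) * (`|b| + 1) <= e & t `^ (1 - mu) * (`|nl x0 b| + 1) <= c0 / 2].
    move=> /andP[t0 tt]; have q0 : 0 < t `^ (1 - mu) by rewrite powR_gt0.
    have := Hr3 t (ltW t0) (le_trans tt tau3); rewrite !le_min => /andP[h1 /andP[]].
    by rewrite ler_pdivlMr // => h2; rewrite ler_pdivlMr // => h3.
  split=> t /H [q0 h1 h2 h3]; first by rewrite q0.
    by apply: le_trans h2; rewrite mulrDr lerDl mulr1 ltW.
  by apply: le_trans h3; rewrite mulrDr lerDl mulr1 ltW.
have ys' : wbound mu tau ys (e' / 2).
  move=> t /andP[t0 tt]; apply: Hr1; [by rewrite t0 (le_trans tt)|].
  by apply: le_lt_trans (le_trans tt tau1) _; rewrite ltr_pdivrMr // ltr_pMr // ltr1n.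
have ds' : wbound mu tau ds (e' / 2).
  move=> t /andP[t0 tt]; apply: Hr2; [by rewrite t0 (le_trans tt)|].
  by apply: le_lt_trans (le_trans tt tau2) _; rewrite ltr_pdivrMr // ltr_pMr // ltr1n.
have ls : linsol j mu tau (A x0) (fun=> 0) x0 us ys ds.
  split=> //; first exact: reg_restrict tauT rs.
  by move=> t /andP[t0 tt]; apply: eqs; rewrite t0 (le_trans tt).
pose eps := Num.min (e / 2) (2 * c0).
have eps0 : 0 < eps by rewrite lt_min c20 divr_gt0.
have [epse epsc] : eps <= e / 2 /\ eps <= 2 * c0 by rewrite !ge_min !lexx !orbT.
clearbody eps.
exists tau, eps, (2 * M * (k + 1)), e; split=> //.
- by rewrite !mulr_gt0 // addr_gt0.
- move=> x [cx xb].
  have xe : nrm (x - x0) <= eps by [].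
  have Vx : V x.
    apply: closeV => //; apply: (le_trans xe); apply: (le_trans epse).
    by rewrite ler_pdivrMr // ler_peMr ?ler1n // ltW.
  pose good (f : R -> E0) := wcont mu tau f /\ wbound mu tau f (2 * c0).
  have S (f : R -> E0) : {u : (R -> E0) * (R -> E1) * (R -> E0) | good f ->
      linsol j mu tau (A x0) f x u.1.1 u.1.2 u.2}.
    apply: cid; have [[cf fb]|?] := pselect (good f); last first.
      by exists (fun=> 0, fun=> 0, fun=> 0).
    have nx : 0 <= nrm x by exact: interp_norm_ge0.
    have cc : 0 < 2 * c0 + nrm x by rewrite ltr_pwDl.
    have [||v [y [d [h _ _]]]] := lin_ex tau f x (2 * c0 + nrm x) tT cc cf _ cx.
    - by apply: wbound_le fb; rewrite lerDl.
    - by apply: (interp_le_trans j _ _ _ _ _ (cinterp_norm j mu x cx)); rewrite lerDr ltW.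
    by exists (v, y, d).
  pose v f := (projT1 (S f)).1.1; pose y f := (projT1 (S f)).1.2.
  pose d f := (projT1 (S f)).2.
  have vP f : good f -> linsol j mu tau (A x0) f x (v f) (y f) (d f).
    exact: (projT2 (S f)).
  pose Psi f t := nl x0 (y f t).
  have bounds f : good f -> wbound mu tau (y f) e' /\ wbound mu tau (d f) e'.
    move=> gf; have lf := linsolB j mu tau _ _ _ _ _ _ _ _ _ _ _ (vP f gf) ls.
    have cc := c20.
    have [||h1 h2] := lin_le tau _ _ _ _ _ (2 * c0) tT cc lf.
    - by move=> t tt; rewrite subr0; exact: gf.2.
    - have cxx : cinterp j mu (x - x0) by apply: cinterpB => //; exact: cV.
      by apply: (interp_le_trans j _ _ _ _ _ (cinterp_norm j mu _ cxx)); exact: le_trans epsc.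
    rewrite Mc0 in h1 h2.
    have he : e' = `|1| * (e' / 2) + e' / 2 by rewrite normr1; field.
    split; rewrite he.
      by have := wbound_lin mu tau 1 _ _ _ _ h1 ys'; apply: wbound_ext => t _; modring R.
    by have := wbound_lin mu tau 1 _ _ _ _ h2 ds'; apply: wbound_ext => t _; modring R.
  have near f t : good f -> 0 <= t <= tau -> nrm (v f t - x0) <= e.
    move=> gf tt; have [yb db] := bounds f gf; have [rf v0 _] := vP f gf.
    have h := reg_trace j mu mu01 tau _ _ _ e' t tau0 rf yb db tt.
    rewrite v0 -/c1 ce' in h.
    have cxx : cinterp j mu (x - x0) by apply: cinterpB => //; exact: cV.
    have -> : v f t - x0 = (v f t - x) + (x - x0) by modring R.
    apply: interp_le_norm.
    apply: (interp_le_trans j _ _ _ _ _ (interp_leD j _ _ _ _ _ h (cinterp_norm j mu _ cxx))).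
    have ee : e / 2 + e / 2 = e by field.
    by rewrite -[leRHS]ee; apply: lerD => //; exact: le_trans xe epse.
  have Vv f t : good f -> 0 <= t <= tau -> V (v f t).
    move=> gf tt; apply: closeV; last exact: near.
    by have [rf _ _] := vP f gf; exact: (reg_cinterp j mu Hj mu01 tau _ _ _ _ tau0 rf).
  have vclose f : good f -> stays_close j mu tau x0 e (v f) (y f).
    move=> gf t tt; have [yb db] := bounds f gf; split.
      by apply: near => //; case/andP: tt => /ltW -> ->.
    apply: le_trans (yb t tt) (le_trans e'e _).
    by rewrite ler_pdivrMr // ler_peMr ?ler1n // ltW.
  have vj f t : good f -> 0 < t <= tau -> v f t = j (y f t).
    by move=> gf tt; have [[_ _ h _ _] _ _] := vP f gf; exact: h.
  have goodPsi f : good f -> wcont mu tau (Psi f) /\ wbound mu tau (Psi f) c0.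
    move=> gf; split.
      have [rf _ _] := vP f gf.
      apply: (nonlin_wcont j mu Hj mu01 V A F1 F2 HV H1 H2 x0 tau _ _ _ Vx0 tau0 rf) => t.
      exact: Vv.
    move=> t tt; have [n2 q2] := vclose f gf t tt.
    rewrite vj // in n2; have qe := we t tt.
    have D1 : nrm (j (y f t) - j b) <= 2 * e.
      apply: (le_trans (interp_dist j mu _ x0 _ _ (cV _ Vx0) _)).
      - by apply: cinterp_j => //; rewrite !ltW.
      - by apply: cinterp_j => //; rewrite !ltW.
      have -> : 2 * e = e + e by ring.
      by apply: lerD; [exact: n2|exact: interp_le_norm].
    have D2 : t `^ (1 - mu) * `|y f t - b| <= 2 * e.
      apply: (@le_trans _ _ (t `^ (1 - mu) * (`|y f t| + `|b|))).
        by rewrite ler_wpM2l ?powR_ge0 // ler_normB.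
      have -> : 2 * e = e + e by ring.
      by rewrite mulrDr; apply: lerD => //; exact: wb.
    have h := nl_le _ _ _ _ qe n2 hb' q2 (wb t tt) D1 D2.
    rewrite -/nl -/(Psi f t) in h.
    have -> : Psi f t = (Psi f t - nl x0 b) + nl x0 b by modring R.
    apply: (@le_trans _ _ (t `^ (1 - mu) * (`|Psi f t - nl x0 b| + `|nl x0 b|))).
      by rewrite ler_wpM2l ?powR_ge0 // ler_normD.
    rewrite mulrDr.
    have kc : k * (2 * e) <= c0 / 2.
      rewrite le_eqVlt; apply/orP; left; apply/eqP; rewrite /k /c0 /e'; field.
      by rewrite (gt_eqF M0) (gt_eqF c1_gt0).
    have cc : c0 / 2 + c0 / 2 = c0 by field.
    by rewrite -[leRHS]cc; apply: lerD; [exact: le_trans h kc|exact: wn].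
  have contr f g r : good f -> good g -> 0 < r -> wbound mu tau (fun t => f t - g t) r ->
      wbound mu tau (fun t => Psi f t - Psi g t) (r / 2).
    move=> gf gg r0 fg.
    have lf := linsolB j mu tau _ _ _ _ _ _ _ _ _ _ _ (vP f gf) (vP g gg).
    have [|h1 h2] := lin_le tau _ _ _ _ _ r tT r0 lf fg.
      by rewrite subrr; apply: interp_le0; exact: ltW.
    have [rd vd0 _] := lf.
    have Mr : 0 < M * r by rewrite mulr_gt0.
    move=> t tt; have [n2 q2] := vclose f gf t tt; have [n3 q3] := vclose g gg t tt.
    have tt' : 0 <= t <= tau by case/andP: tt => /ltW -> ->.
    have h := reg_trace j mu mu01 tau _ _ _ (M * r) t tau0 rd h1 h2 tt'.
    rewrite vd0 subrr subr0 -/c1 in h.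
    have D1 := interp_le_norm _ _ _ _ h.
    rewrite !vj // in n2 n3 D1.
    have D2 : t `^ (1 - mu) * `|y f t - y g t| <= c1 * (M * r).
      apply: (le_trans (h1 t tt)); by rewrite ler_peMl ?(ltW Mr).
    have := nl_le _ _ _ _ (we t tt) n2 n3 q2 q3 D1 D2.
    rewrite -/nl -!/(Psi _ t) => hh; apply: (le_trans hh).
    have -> : k * (c1 * (M * r)) = k * c1 * M * r by ring.
    by rewrite kM mulrC [r / 2]mulrC -[leLHS]mulrC ler_wpM2r // ltW.
  pose fs := fix fs n := if n is n'.+1 then Psi (fs n') else (fun=> 0 : E0).
  have gs n : good (fs n).
    elim: n => [|n [IH1 IH2]].
      split; first exact: wcont_cst.
      by move=> t _; rewrite normr0 mulr0 ltW.
    have [h1 h2] := goodPsi (fs n) (conj IH1 IH2).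
    by split=> //; exact: wbound_le c0le h2.
  have diff n : wbound mu tau (fun t => fs n.+1 t - fs n t) (c0 / 2 ^+ n).
    elim: n => [|n IH].
      have [_ h] := goodPsi (fs 0%N) (gs 0%N).
      by rewrite expr0 divr1; apply: wbound_ext h => t _ /=; rewrite subr0.
    have -> : c0 / 2 ^+ n.+1 = c0 / 2 ^+ n / 2 by rewrite exprS invfM; ring.
    have r0 : 0 < c0 / 2 ^+ n by exact: divr_gt0 c00 (exprn_gt0 n _).
    exact: (contr (fs n.+1) (fs n) _ (gs n.+1) (gs n) r0 IH).
  have [|f cf fb] := wcont_complete mu mu01 tau c0 fs _ diff.
    by move=> n; have [] := gs n.
  have gf : good f.
    split=> //; have := fb 0%N; rewrite expr0 divr1.
    by apply: wbound_ext => t _ /=; exact: subr0.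
  exists (v f), (y f), (d f); split; last exact: vclose.
  have [rf vf0 eqf] := vP f gf.
  split=> //; first by move=> t; exact: Vv.
  move=> t tt.
  have fE : f t = Psi f t.
    have q0 : 0 < t `^ (1 - mu) by have /andP[] := we t tt.
    apply/eqP; rewrite eq_sym -subr_eq0 -normr_le0 -(ler_pM2l q0) mulr0.
    apply: (@le_geometric _ _ _ (2 * c0)) => n; rewrite add0r.
    have r0 : 0 < 2 * c0 / 2 ^+ n by exact: divr_gt0 c20 (exprn_gt0 n _).
    have h1 := contr f (fs n) _ gf (gs n) r0 (fb n) t tt.
    have h2 := fb n.+1 t tt.
    have -> : Psi f t - f t = (Psi f t - Psi (fs n) t) - (f t - fs n.+1 t).
      have aux (p q r : E0) : p - q = (p - r) - (q - r) by modring R.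
      exact: aux.
    apply: (@le_trans _ _ (t `^ (1 - mu) * (`|Psi f t - Psi (fs n) t| + `|f t - fs n.+1 t|))).
      by rewrite ler_pM2l // ler_normB.
    rewrite mulrDr; apply: (le_trans (lerD h1 h2)).
    rewrite le_eqVlt; apply/orP; left; apply/eqP; rewrite exprS; field.
    by rewrite expf_neq0.
  have := eqf t tt; rewrite fE /Psi /nl /nonlin -vj //.
  have aux (p q r s z : E0) : p + q = q - r + s + z -> p + r = s + z.
    move=> h; have -> : p = q - r + s + z - q by rewrite -h addrK.
    by modring R.
  exact: aux.
- move=> x1 x2 v1 y1 d1 v2 y2 d2 s1 s2 cl1 cl2.
  have tte : tau `^ (1 - mu) <= e by have /andP[] := we tau (ltac:(by rewrite tau0 lexx)).
  apply: (sol_lipschitz j mu mu01 V A F1 F2 HV x0 T M k e tau x1 x2 v1 y1 d1 v2 y2 d2) => //.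
  + exact: ltW.
  + have -> : M * k * (2 + mu^-1) = k * c1 * M by rewrite /c1; ring.
    by rewrite kM [1 / 2]mul1r.
Qed.

End LocalExistence.

(** * Maximal solutions and the semiflow *)

Section Flow.
Context {R : realType} {E0 E1 : completeNormedModType R} (j : {linear E1 -> E0}).
Context (mu : R) (Hj : banach_couple j) (mu01 : 0 < mu < 1).
Context (V : set E0) (A : E0 -> {linear E1 -> E0}) (F1 F2 : E0 -> E0).
Context (HV : interp_open j mu V) (H1 : hypothesis1 j mu V A F1)
  (H2 : hypothesis2 j mu V F2).
Implicit Types (x y : E0) (v w : R -> E0) (t T : R).

Let nrm x := interp_norm j mu x.
Let cV x : V x -> cinterp j mu x. Proof. exact: HV.1. Qed.
Let solution := solution j mu V A F1 F2.

Let nrm_ge0 x : 0 <= nrm x. Proof. exact: interp_norm_ge0. Qed.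

Lemma solution_unique T x v w : solution T x v -> solution T x w ->
  forall t, 0 <= t <= T -> v t = w t.
Proof.
move=> /(solution_sol j mu Hj mu01) s1 /(solution_sol j mu Hj mu01) s2.
exact: (sol_unique j mu Hj mu01 V A F1 F2 HV H1 H2 T x _ _ _ _ _ _ s1 s2).
Qed.

Lemma solution_restrict S T x v : 0 < S <= T -> solution T x v -> solution S x v.
Proof.
move=> ST /(solution_sol j mu Hj mu01) s1.
exact: sol_solution (sol_restrict j mu V A F1 F2 S T _ _ _ _ ST s1).
Qed.

Lemma solution_shift s T x v : 0 <= s < T -> solution T x v ->
  solution (T - s) (v s) (fun t => v (s + t)).
Proof.
move=> sT /(solution_sol j mu Hj mu01) s1.
exact: sol_solution (sol_shift j mu mu01 V A F1 F2 s T x v _ _ sT s1).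
Qed.

Lemma solution_ext T x v w : (forall t, 0 <= t <= T -> v t = w t) ->
  solution T x v -> solution T x w.
Proof.
move=> vw /(solution_sol j mu Hj mu01) [T0 rv Vv eqn v0].
apply: (sol_solution j mu Hj mu01 V A F1 F2 T x w (linv j \o v) (ddt T v)); split=> //.
- exact: (reg_ext j mu T v _ _ w _ _ rv vw).
- by move=> t tT; rewrite -vw //; exact: Vv.
- by move=> t tT; rewrite -vw; [exact: eqn|lra].
- by rewrite -vw //; lra.
Qed.

Lemma solution_splice T1 T2 s x v w : 0 <= s < T1 -> solution T1 x v ->
  solution T2 (v s) w -> solution (s + T2) x (splice T1 s v w).
Proof.
move=> sT /(solution_sol j mu Hj mu01) s1 /(solution_sol j mu Hj mu01) s2.
have [y [d h]] := sol_splice j mu Hj mu01 V A F1 F2 HV H1 H2 T1 T2 s x _ _ _ _ _ _ sT s1 s2.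
exact: sol_solution h.
Qed.

Lemma solution_cinterp T x v t : solution T x v -> 0 <= t <= T -> cinterp j mu (v t).
Proof. by move=> [_ _ Vv _ _] tT; apply/cV/Vv. Qed.

Lemma solution_cont T x v t e : solution T x v -> 0 <= t <= T -> 0 < e ->
  exists2 r, 0 < r & forall s, 0 <= s <= T -> `|s - t| < r -> nrm (v s - v t) <= e.
Proof.
move=> /(solution_sol j mu Hj mu01) [T0 rv _ _ _] tT e0.
have [r r0 H] := reg_interp_cont j mu Hj mu01 T v _ _ t e T0 rv tT e0.
by exists r => // s sT sr; apply: interp_le_norm; exact: H.
Qed.

Lemma solution_exists x : V x -> exists T v, solution T x v.
Proof.
move=> Vx; have [tau [eps [sigma [e [tau0 eps0 _ ex _]]]]] :=
  local_existence j mu Hj mu01 V A F1 F2 HV H1 H2 x Vx.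
have [|v [y [d [s _]]]] := ex x.
  split; first exact: cV.
  by apply: interp_le_norm; rewrite subrr; apply: interp_le0; exact: ltW.
by exists tau, v; exact: sol_solution s.
Qed.

(** The existence time is bounded below near the final value, so restarting
    shortly before the final time leads beyond it. *)
Lemma solution_extend T x v : solution T x v -> exists2 T', T < T' & exists w, solution T' x w.
Proof.
move=> sv; have [T0 _ Vv _ _] := sv.
have VT : V (v T) by apply: Vv; rewrite lexx ltW.
have [tau [eps [sigma [e [tau0 eps0 _ ex _]]]]] :=
  local_existence j mu Hj mu01 V A F1 F2 HV H1 H2 (v T) VT.
have [|r r0 H] := solution_cont T x v T eps sv _ eps0; first by rewrite lexx ltW.
pose h := Num.min (T / 2) (Num.min (tau / 2) (r / 2)).
have h0 : 0 < h by rewrite !lt_min; lra.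
have [hT [htau hr]] : h <= T / 2 /\ h <= tau / 2 /\ h <= r / 2.
  by rewrite !ge_min !lexx !orbT.
clearbody h.
have sT : 0 <= T - h < T by lra.
have [|w [y [d [s _]]]] := ex (v (T - h)).
  split; first by apply: (solution_cinterp T x) => //; lra.
  apply: H; first lra.
  by rewrite addrAC subrr add0r normrN gtr0_norm //; lra.
exists (T - h + tau); first lra.
exists (splice T (T - h) v w); apply: solution_splice => //.
exact: sol_solution s.
Qed.

(** By uniqueness all solutions are restrictions of one function on the union of
    their intervals, and that union has no largest element. *)
Lemma maximal_solution_exists x : V x ->
  exists (tp : \bar R) v, maximal_solution j mu V A F1 F2 x tp v.
Proof.
move=> Vx.
pose S := [set T%:E | T in [set T : R | exists v, solution T x v]].
have pick t : {w : E0 | forall T v, solution T x v -> 0 <= t <= T -> v t = w}.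
  apply: cid; have [[T [v [s tT]]]|no] := pselect (exists T v, solution T x v /\ 0 <= t <= T).
    exists (v t) => T' v' s' tT'.
    have [T0 _ _ _ _] := s; have [T'0 _ _ _ _] := s'.
    pose T2 := Num.min T T'.
    have [h1 h2] : T2 <= T /\ T2 <= T' by rewrite !ge_min !lexx orbT.
    have h0 : 0 < T2 by rewrite lt_min T0.
    apply: (solution_unique T2 x).
    - by apply: (solution_restrict _ T') => //; rewrite h0.
    - by apply: (solution_restrict _ T) => //; rewrite h0.
    - by rewrite le_min; case/andP: tT => -> ->; case/andP: tT' => _ ->.
  by exists 0 => T v s tT; exfalso; apply: no; exists T, v.
pose v t := projT1 (pick t).
have vP T w : solution T x w -> forall t, 0 <= t <= T -> w t = v t.
  by move=> s t tT; exact: (projT2 (pick t) T w s tT).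
exists (ereal_sup S), v; split.
- have [T [w s]] := solution_exists x Vx; have [T0 _ _ _ _] := s.
  apply: (@lt_le_trans _ _ T%:E); first by rewrite lte_fin.
  by apply: ereal_sup_ubound; exists T => //; exists w.
- move=> T T0 /ereal_sup_gt [_ [T' [w s] <-]]; rewrite lte_fin => TT'.
  have TT : 0 < T <= T' by rewrite T0 ltW.
  apply: solution_ext (solution_restrict _ _ _ _ TT s) => t tT.
  by apply: (vP T') => //; lra.
- move=> T w s; split; last exact: vP.
  have [T' TT' [w' s']] := solution_extend T x w s.
  apply: (@lt_le_trans _ _ T'%:E); first by rewrite lte_fin.
  by apply: ereal_sup_ubound; exists T' => //; exists w'.
Qed.

Context (tp : E0 -> \bar R) (u : E0 -> R -> E0).
Context (Hu : forall x, V x -> maximal_solution j mu V A F1 F2 x (tp x) (u x)).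

Lemma flow_solution T x v : V x -> solution T x v ->
  [/\ (T%:E < tp x)%E, solution T x (u x) & forall t, 0 <= t <= T -> v t = u x t].
Proof.
move=> Vx s; have [_ h2 h3] := Hu x Vx; have [T0 _ _ _ _] := s.
by have [h4 h5] := h3 T v s; split=> //; exact: h2.
Qed.

Lemma flow_domain_solution t x : flow_domain V tp t x ->
  exists2 T, t < T & solution T x (u x).
Proof.
move=> [Vx t0 ttp]; have [_ h2 h3] := Hu x Vx.
suff [T tT [v s]] : exists2 T, t < T & exists v, solution T x v.
  by exists T => //; have [_ h _] := flow_solution T x v Vx s.
have [tn|tn] := ltP 0 t; first exact: solution_extend (h2 t tn ttp).
have [T [v s]] := solution_exists x Vx; have [T0 _ _ _ _] := s.
by exists T; [exact: le_lt_trans tn T0|exists v].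
Qed.

Lemma flow0 x : V x -> u x 0 = x.
Proof.
move=> Vx; have [T [v s]] := solution_exists x Vx.
by have [_ [_ _ _ _ ->] _] := flow_solution T x v Vx s.
Qed.

Lemma flow_domain0 x : V x -> flow_domain V tp 0 x.
Proof. by move=> Vx; have [h _ _] := Hu x Vx; split. Qed.

Lemma flow_V t x : flow_domain V tp t x -> V (u x t).
Proof.
move=> dom; have [T tT [_ _ Vv _ _]] := flow_domain_solution t x dom.
by have [_ t0 _] := dom; apply: Vv; rewrite t0 ltW.
Qed.

Lemma flow_semigroup s t x : flow_domain V tp s x -> flow_domain V tp t (u x s) ->
  flow_domain V tp (s + t) x /\ u x (s + t) = u (u x s) t.
Proof.
move=> ds dt; have Vs := flow_V s x ds; have [Vx s0 stp] := ds; have [_ t0 ttp] := dt.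
have [tpos|tn] := ltP 0 t; last first.
  have -> : t = 0 by apply/eqP; rewrite eq_le tn t0.
  by rewrite addr0 flow0.
have [T1 sT1 s1] := flow_domain_solution s x ds.
have [_ h2 _] := Hu (u x s) Vs; have s2 := h2 t tpos ttp.
have sT : 0 <= s < T1 by rewrite s0.
have [st ss _] := flow_solution _ x _ Vx (solution_splice _ _ _ _ _ _ sT s1 s2).
split; first by split=> //; rewrite addr_ge0.
have sst : 0 <= s < s + t by rewrite s0 ltrDl.
have sh := solution_shift s (s + t) x (u x) sst ss.
rewrite addrAC subrr add0r in sh.
have [_ _ h] := flow_solution _ _ _ Vs sh.
by apply: (h t); rewrite t0 lexx.
Qed.

(** On the difference of two solutions the norm of the maximal regularity space
    is expressed through the differences of the derivatives and of the
    [E1]-valued representatives. *)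
Lemma solution_diff T x1 x2 : solution T x1 (u x1) -> solution T x2 (u x2) ->
  reg j mu T (fun t => u x1 t - u x2 t)
    (fun t => linv j (u x1 t) - linv j (u x2 t)) (fun t => ddt T (u x1) t - ddt T (u x2) t)
  /\ forall t, 0 < t <= T ->
    ddt T (fun t => u x1 t - u x2 t) t = ddt T (u x1) t - ddt T (u x2) t /\
    linv j (u x1 t - u x2 t) = linv j (u x1 t) - linv j (u x2 t).
Proof.
move=> /(solution_sol j mu Hj mu01) [T0 r1 _ _ _] /(solution_sol j mu Hj mu01) [_ r2 _ _ _].
have r := regB j mu T _ _ _ _ _ _ r1 r2; split=> //.
by have [_ h] := reg_E1mu j mu Hj mu01 T _ _ _ T0 r; exact: h.
Qed.

Lemma local_constants_exist x0 : V x0 ->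
  exists tau eps sigma : R, local_constants j mu V A F1 F2 u x0 tau eps sigma.
Proof.
move=> Vx0; have [tau [eps [sigma [e [tau0 eps0 sigma0 ex lip]]]]] :=
  local_existence j mu Hj mu01 V A F1 F2 HV H1 H2 x0 Vx0.
have flow x : interp_cball j mu x0 eps x -> [/\ V x, solution tau x (u x) &
    stays_close j mu tau x0 e (u x) (linv j \o u x)].
  move=> bx; have [v [y [d [s cl]]]] := ex x bx.
  have [_ rv Vv _ v0] := s.
  have Vx : V x by rewrite -v0; apply: Vv; rewrite lexx ltW.
  have [_ h2 h3] := flow_solution tau x v Vx (sol_solution _ _ Hj mu01 _ _ _ _ _ _ _ _ _ s).
  split=> // t tt; have tt' : 0 <= t <= tau by lra.
  rewrite /= -h3 //; have [_ _ /(_ t tt) vj _ _] := rv.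
  by rewrite {2}vj (linvK j Hj); exact: cl.
exists tau, eps, (2 * sigma); split; [|split].
- by split=> //; rewrite mulr_gt0.
- move=> x /flow [Vx s _]; split=> // w sw t tt.
  by have [_ _ h] := flow_solution tau x w Vx sw; exact: h.
- move=> x1 x2 /flow [Vx1 s1 c1] /flow [Vx2 s2 c2].
  have [hy hd] := lip x1 x2 _ _ _ _ _ _ (solution_sol _ _ Hj mu01 _ _ _ _ _ _ _ s1)
    (solution_sol _ _ Hj mu01 _ _ _ _ _ _ _ s2) c1 c2.
  have [_ hE] := solution_diff tau x1 x2 s1 s2.
  apply/ereal_supP => _ [t tt <-]; rewrite /= in_itv /= in tt.
  have [-> ->] := hE t tt; rewrite lee_fin mulrDr.
  have -> : 2 * sigma * interp_norm j mu (x1 - x2) =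
    sigma * interp_norm j mu (x1 - x2) + sigma * interp_norm j mu (x1 - x2) by ring.
  by apply: lerD; [exact: hd|exact: hy].
Qed.

(** The trace estimate, applied to the difference of the two solutions. *)
Lemma local_constants_lipschitz x0 tau eps sigma x1 x2 t :
  local_constants j mu V A F1 F2 u x0 tau eps sigma ->
  interp_cball j mu x0 eps x1 -> interp_cball j mu x0 eps x2 -> 0 <= t <= tau ->
  nrm (u x1 t - u x2 t) <= (1 + (2 + mu^-1) * sigma) * nrm (x1 - x2).
Proof.
move=> [[tau0 eps0 sigma0] [ex lip]] b1 b2 tt.
have [s1 _] := ex x1 b1; have [s2 _] := ex x2 b2.
have [r hE] := solution_diff tau x1 x2 s1 s2.
have /ereal_supP bd := lip x1 x2 b1 b2.
have sum s : 0 < s <= tau -> s `^ (1 - mu) * (`|ddt tau (u x1) s - ddt tau (u x2) s| +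
    `|linv j (u x1 s) - linv j (u x2 s)|) <= sigma * nrm (x1 - x2).
  move=> st; have [e1 e2] := hE s st; rewrite -e1 -e2 -lee_fin.
  by apply: bd; exists s => //=; rewrite in_itv.
have yb : wbound mu tau (fun t => linv j (u x1 t) - linv j (u x2 t)) (sigma * nrm (x1 - x2)).
  by move=> s st; apply: le_trans (sum s st); rewrite ler_wpM2l ?powR_ge0 // lerDr.
have db : wbound mu tau (fun t => ddt tau (u x1) t - ddt tau (u x2) t) (sigma * nrm (x1 - x2)).
  by move=> s st; apply: le_trans (sum s st); rewrite ler_wpM2l ?powR_ge0 // lerDl.
have h := reg_trace j mu mu01 tau _ _ _ _ t tau0 r yb db tt.
have [_ _ _ _ z1] := s1; have [_ _ _ _ z2] := s2.
rewrite z1 z2 in h.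
have cx : cinterp j mu (x1 - x2) by apply: cinterpB; [case: b1|case: b2].
have -> : u x1 t - u x2 t = (u x1 t - u x2 t - (x1 - x2)) + (x1 - x2) by modring R.
apply: interp_le_norm.
have -> : (1 + (2 + mu^-1) * sigma) * nrm (x1 - x2) =
  (2 + mu^-1) * (sigma * nrm (x1 - x2)) + nrm (x1 - x2) by ring.
by apply: interp_leD => //; exact: cinterp_norm.
Qed.

Lemma solution_interp_C0 T x v : solution T x v -> interp_C0 j mu T v.
Proof.
move=> s; split=> t tT; first exact: solution_cinterp s tT.
apply/cvgrPdist_le => e e0; have [r r0 H] := solution_cont T x v t e s tT e0.
exists r => // q /= qr; rewrite in_itv /= => qT.
rewrite sub0r normrN ger0_norm ?interp_norm_ge0 //; apply: H => //.
by rewrite distrC.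
Qed.

(** The property propagated along the trajectory of [x0]. *)
Let lipschitz_upto x0 t := exists d c : R, [/\ 0 < d, 0 < c &
  forall x, V x -> nrm (x - x0) < d -> (t%:E < tp x)%E /\
    forall y, V y -> nrm (y - x0) < d -> forall s, 0 <= s <= t ->
      nrm (u x s - u y s) <= c * nrm (x - y)].

(** Close to [x0] the states at time [s] lie in the ball around [z] where
    solutions exist for a time [tau] and depend Lipschitz continuously on their
    initial value; the two Lipschitz constants multiply. *)
Lemma lipschitz_step x0 z tau eps sigma s t : V x0 ->
  local_constants j mu V A F1 F2 u z tau eps sigma -> V z ->
  0 <= s -> (s%:E < tp x0)%E -> nrm (u x0 s - z) <= eps / 2 ->
  s <= t <= s + tau -> lipschitz_upto x0 s -> lipschitz_upto x0 t.
Proof.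
move=> Vx0 lc Vz s0 stp sz st [d [c [d0 c0 H]]].
have [[tau0 eps0 sigma0] [ex _]] := lc.
have mi : 0 < 2 + mu^-1 by rewrite addr_gt0 // invr_gt0; case/andP: mu01.
pose c' := 1 + (2 + mu^-1) * sigma.
have c'0 : 0 < c' by rewrite addr_gt0 // mulr_gt0.
have domx0 : flow_domain V tp s x0 by [].
have k0 : 0 < eps / 2 / c by rewrite divr_gt0 //; lra.
exists (Num.min d (eps / 2 / c)), (c + c' * c); split; first by rewrite lt_min d0.
  by rewrite addr_gt0 // mulr_gt0.
have near x : V x -> nrm (x - x0) < Num.min d (eps / 2 / c) ->
    [/\ nrm (x - x0) < d, (s%:E < tp x)%E & interp_cball j mu z eps (u x s)].
  move=> Vx; rewrite lt_min => /andP[xd]; rewrite ltr_pdivlMr // => xe.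
  have [sx lip] := H x Vx xd; split=> //.
  have ss : 0 <= s <= s by rewrite s0 lexx.
  have x00 : nrm (x0 - x0) < d.
    by apply: le_lt_trans d0; apply: interp_le_norm; rewrite subrr; exact: interp_le0.
  have Vs : V (u x s) by apply: flow_V.
  have cs := cV _ Vs; have cs0 := cV _ (flow_V s x0 domx0).
  split=> //; apply: (le_trans (interp_dist j mu _ _ _ cs cs0 (cV _ Vz))).
  have := lip x0 Vx0 x00 s ss; rewrite -/(nrm _) -/(nrm (_ - z)).
  by move=> h; have := le_trans h (ltW (_ : c * nrm (x - x0) < eps / 2)); rewrite mulrC => /(_ xe); lra.
have reach x r : V x -> nrm (x - x0) < Num.min d (eps / 2 / c) -> 0 <= r <= tau ->
    ((s + r)%:E < tp x)%E /\ u x (s + r) = u (u x s) r.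
  move=> Vx xd rt; have [_ sx bx] := near x Vx xd.
  have [sol _] := ex _ bx; have domx : flow_domain V tp s x by [].
  have Vs := flow_V s x domx.
  have [taux _ _] := flow_solution _ _ _ Vs sol.
  have domr : flow_domain V tp r (u x s).
    by split=> //; [lra|apply: le_lt_trans taux; rewrite lee_fin; lra].
  by have [[_ _ h1] h2] := flow_semigroup s r x domx domr.
move=> x Vx xd; split.
  by have := reach x (t - s) Vx xd (ltac:(lra)); rewrite addrC subrK => -[].
move=> y Vy yd r rt; have [xd' _ bx] := near x Vx xd; have [yd' _ by_] := near y Vy yd.
have n0 := nrm_ge0 (x - y).
have [_ lip] := H x Vx xd'.
have cc : c * nrm (x - y) <= (c + c' * c) * nrm (x - y).
  by rewrite ler_wpM2r // lerDl mulr_ge0 // ltW.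
have [rs|sr] := leP r s.
  apply: le_trans cc; apply: lip => //; lra.
have rtau : 0 <= r - s <= tau by lra.
have [_ ex1] := reach x _ Vx xd rtau; have [_ ey1] := reach y _ Vy yd rtau.
rewrite addrC subrK in ex1 ey1; rewrite ex1 ey1.
apply: (le_trans (local_constants_lipschitz _ _ _ _ _ _ _ lc bx by_ rtau)).
rewrite -/c'; have ss : 0 <= s <= s by rewrite s0 lexx.
have h := lip y Vy yd' s ss.
apply: (@le_trans _ _ (c' * (c * nrm (x - y)))); first by rewrite ler_pM2l.
have -> : (c + c' * c) * nrm (x - y) = c * nrm (x - y) + c' * (c * nrm (x - y)) by ring.
by rewrite lerDr mulr_ge0 // ltW.
Qed.

Lemma lipschitz_flow t0 x0 : flow_domain V tp t0 x0 ->
  exists2 delta, 0 < delta & lipschitz_upto x0 (t0 + delta).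
Proof.
move=> dom; have [Vx0 t00 ttp] := dom.
have [T tT sT] := flow_domain_solution t0 x0 dom.
have domt t : 0 <= t <= t0 -> flow_domain V tp t x0.
  by move=> tt; split=> //; [lra|apply: le_lt_trans ttp; rewrite lee_fin; lra].
have Pt0 : lipschitz_upto x0 t0.
  apply: (@real_induction _ (lipschitz_upto x0) 0 t0) => //.
    exists 1, 1; split=> // x Vx _; split; first by have [] := Hu x Vx.
    move=> y Vy _ s s0; have -> : s = 0 by lra.
    by rewrite !flow0 // mul1r.
  move=> c ct; have Vc := flow_V c x0 (domt c ct).
  have [tau [eps [sigma lc]]] := local_constants_exist _ Vc.
  have [[tau0 eps0 _] _] := lc.
  have [||r r0 Hr] := solution_cont T x0 (u x0) c (eps / 2) sT; [lra|lra|].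
  exists (Num.min (tau / 2) r); first by rewrite lt_min r0; lra.
  move=> s t sc; rewrite ltrBlDr -ltrBlDl lt_min => /andP[h1 h2] ct'.
  rewrite -ltrBlDl lt_min => /andP[h3 h4].
  have [_ _ stp] := domt s (ltac:(lra)).
  apply: (lipschitz_step x0 (u x0 c) tau eps sigma) => //; [lra| |lra].
  by apply: Hr; [lra|rewrite ltr_norml; lra].
have Vt0 := flow_V t0 x0 dom.
have [tau [eps [sigma lc]]] := local_constants_exist _ Vt0.
have [[tau0 eps0 _] _] := lc.
exists tau => //.
apply: (lipschitz_step x0 (u x0 t0) tau eps sigma t0) => //; [|lra].
by apply: interp_le_norm; rewrite subrr; apply: interp_le0; lra.
Qed.

(** Openness of the domain, joint continuity and the Lipschitz bound all follow
    from the Lipschitz bound beyond [t0] and the continuity of one trajectory. *)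
Lemma flow_locally_lipschitz : locally_lipschitz_semiflow j mu V tp u.
Proof.
have nhds t0 x0 delta : flow_domain V tp t0 x0 -> 0 < delta ->
    lipschitz_upto x0 (t0 + delta) -> forall d', 0 < d' -> forall delta', 0 < delta' ->
    exists U W c, [/\ time_nbhs t0 U /\ state_nbhs j mu V x0 W, 0 < c,
      forall t x, U t -> W x -> flow_domain V tp t x,
      forall t x y, U t -> W x -> W y -> nrm (u x t - u y t) <= c * nrm (x - y) &
      forall t x, U t -> W x -> [/\ 0 <= t <= t0 + delta, `|t - t0| < delta' &
        nrm (x - x0) * c < d'] ].
  move=> [Vx0 t00 _] delta0 [d [c [d0 c0 H]]] d' d'0 delta' delta'0.
  exists [set t | 0 <= t /\ `|t - t0| < Num.min delta delta'],
    [set x | V x /\ nrm (x - x0) < Num.min d (d' / c)], c.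
  have Ut t : 0 <= t /\ `|t - t0| < Num.min delta delta' -> 0 <= t <= t0 + delta.
    by move=> [t0' ]; rewrite lt_min ltr_norml => /andP[h _]; lra.
  split=> //.
  - split; split; [by move=> t [] | |by move=> x []|].
      by exists (Num.min delta delta') => //; rewrite lt_min delta0.
    by exists (Num.min d (d' / c)) => //; rewrite lt_min d0 divr_gt0.
  - move=> t x ut [Vx]; rewrite lt_min => /andP[xd _].
    have tt := Ut t ut; have [h _] := H x Vx xd; split=> //; first by lra.
    by apply: le_lt_trans h; rewrite lee_fin; lra.
  - move=> t x y ut [Vx]; rewrite lt_min => /andP[xd _] [Vy].
    rewrite lt_min => /andP[yd _]; have [_ h] := H x Vx xd.
    by apply: h => //; exact: Ut.
  - move=> t x ut [Vx]; rewrite lt_min ltr_pdivlMr // => /andP[_ xd].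
    split=> //; first exact: Ut.
    by case: ut => _; rewrite lt_min => /andP[].
split.
- split.
  + by move=> x Vx; split; [exact: flow_domain0|exact: flow0].
  + by move=> t x; exact: flow_V.
  + by move=> s t x; exact: flow_semigroup.
- move=> t0 x0 dom; have [delta delta0 P] := lipschitz_flow t0 x0 dom.
  have [U [W [c [[h1 h2] _ h3 _ _]]]] := nhds t0 x0 delta dom delta0 P 1 ltr01 1 ltr01.
  by exists U, W.
- move=> t0 x0 e dom e0; have [delta delta0 P] := lipschitz_flow t0 x0 dom.
  have [Vx0 t00 _] := dom.
  have domd : flow_domain V tp (t0 + delta) x0.
    have [d [c [d0 c0 H]]] := P; have [|h _] := H x0 Vx0.
      by apply: le_lt_trans d0; apply: interp_le_norm; rewrite subrr; exact: interp_le0.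
    by split=> //; lra.
  have [T dT sT] := flow_domain_solution _ x0 domd.
  have e2 : 0 < e / 2 by lra.
  have tT : 0 <= t0 <= T by lra.
  have [r r0 Hr] := solution_cont T x0 (u x0) t0 (e / 2) sT tT e2.
  have [U [W [c [[h1 h2] c0 h3 h4 h5]]]] := nhds t0 x0 delta dom delta0 P (e / 2) e2 r r0.
  exists U, W; split=> // t x Ut Wx domx.
  have [tt tr xe] := h5 t x Ut Wx.
  have Wx0 : W x0.
    case: h2 => _ [d d0 Hd]; apply: Hd => //.
    by apply: le_lt_trans d0; apply: interp_le_norm; rewrite subrr; exact: interp_le0.
  have dt := h3 t x0 Ut Wx0.
  apply: (le_lt_trans (interp_dist j mu _ _ _ (cV _ (flow_V _ _ domx))
    (cV _ (flow_V _ _ dt)) (cV _ (flow_V _ _ dom)))).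
  have k1 := h4 t x x0 Ut Wx Wx0.
  have k2 := Hr t (ltac:(lra)) tr.
  rewrite -/(nrm _) -/(nrm (_ - u x0 t0)); rewrite mulrC in xe.
  by have := le_lt_trans k1 xe; lra.
- move=> t0 x0 dom; have [delta delta0 P] := lipschitz_flow t0 x0 dom.
  have [U [W [c [[h1 h2] c0 h3 h4 _]]]] := nhds t0 x0 delta dom delta0 P 1 ltr01 1 ltr01.
  by exists U, W, c; split.
Qed.

End Flow.
Theorem corollary2p3 (R : realType) (E0 E1 : completeNormedModType R)
    (j : {linear E1 -> E0}) (mu : R) (V : set E0)
    (A : E0 -> {linear E1 -> E0}) (F1 F2 : E0 -> E0)
    (Hcouple : banach_couple j) (Hmu : 0 < mu < 1)
    (HV : interp_open j mu V)
    (H1 : hypothesis1 j mu V A F1) (H2 : hypothesis2 j mu V F2) :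
  (forall x, V x ->
     exists (tp : \bar R) (v : R -> E0), maximal_solution j mu V A F1 F2 x tp v)
  /\
  forall (tp : E0 -> \bar R) (u : E0 -> R -> E0),
    (forall x, V x -> maximal_solution j mu V A F1 F2 x (tp x) (u x)) ->
    (forall x0, V x0 ->
       (exists tau eps sigma : R,
          local_constants j mu V A F1 F2 u x0 tau eps sigma) /\
       forall tau eps sigma : R,
         local_constants j mu V A F1 F2 u x0 tau eps sigma ->
         exists2 c : R, 0 < c &
           forall x1 x2 : E0,
             interp_cball j mu x0 eps x1 -> interp_cball j mu x0 eps x2 ->
             [/\ interp_C0 j mu tau (u x1), interp_C0 j mu tau (u x2) &
                 (interp_C0_norm j mu tau (fun t => (u x1 t - u x2 t)%R)
                    <= (c * interp_norm j mu (x1 - x2))%:E)%E])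
    /\ locally_lipschitz_semiflow j mu V tp u.
Proof.
split; first by move=> x Vx; exact: (maximal_solution_exists j mu Hcouple Hmu V A F1 F2 HV H1 H2).
move=> tp u Hu; split; last exact: (flow_locally_lipschitz j mu Hcouple Hmu V A F1 F2 HV H1 H2).
move=> x0 Vx0; split.
  exact: (local_constants_exist j mu Hcouple Hmu V A F1 F2 HV H1 H2 tp u Hu).
move=> tau eps sigma lc; have [[_ _ sigma0] [ex _]] := lc.
exists (1 + (2 + mu^-1) * sigma).
  by rewrite addr_gt0 // mulr_gt0 // addr_gt0 // invr_gt0; case/andP: Hmu.
move=> x1 x2 b1 b2; split.
- by have [s _] := ex x1 b1; exact: (solution_interp_C0 j mu Hcouple Hmu V A F1 F2 HV _ _ _ s).
- by have [s _] := ex x2 b2; exact: (solution_interp_C0 j mu Hcouple Hmu V A F1 F2 HV _ _ _ s).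
apply/ereal_supP => _ [t tt <-]; rewrite /= in_itv /= in tt.
rewrite lee_fin.
exact: (local_constants_lipschitz j mu Hcouple Hmu V A F1 F2 u x0 tau eps sigma x1 x2 t lc b1 b2 tt).
Qed.
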